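(* Let $\mathbb{K}$ be a field and let $G$ be a finite, simple, connected, non bipartite graph. The toric ideal $I_G$ is robust and is generated by quadrics if and only if all the blocks of $G$ are bipartite except one, which is either a $K_{2,\ell}\cup\{e\}$, or a double-$K_{2,(r,s)}$ graph, or a necklace-$K_{2,\ell}$ graph, and every bipartite block of $G$ is either a $K_{2,\ell}$ (for some $\ell\geq 2$) or a cut edge.
   Context: Toric ideal of a graph: for a graph $G$ with vertices $v_1,\ldots,v_n$ and edges $e_1,\ldots,e_m$, associate to each edge $e=\{v_i,v_j\}$ the vector $a_e=\mathbf{v}_i+\mathbf{v}_j\in\mathbb{N}^n$, where $\mathbf{v}_i$ is the $i$-th canonical basis vector. For a monomial in $\mathbb{K}[e_1,\ldots,e_m]$ put $\deg_A(e_1^{u_1}\cdots e_m^{u_m})=\sum_k u_k a_{e_k}$. The toric ideal $I_G\subseteq\mathbb{K}[e_1,\ldots,e_m]$ is generated by all binomials $\mathbf{e}^{\mathbf{u}}-\mathbf{e}^{\mathbf{v}}$ with $\deg_A(\mathbf{e}^{\mathbf{u}})=\deg_A(\mathbf{e}^{\mathbf{v}})$. A quadric is a homogeneous polynomial of degree two; the zero ideal is generated by quadrics (empty generating set). The universal Gröbner basis of $I_G$ is the union of its reduced Gröbner bases over all monomial orders; binomials are considered up to sign. $I_G$ is robust if its universal Gröbner basis is a minimal set of generators of $I_G$. Graphs: a cut edge (cut vertex) is an edge (vertex) whose removal increases the number of connected components; a graph is biconnected if it is connected and has no cut vertex; a block is a maximal biconnected subgraph. A block ''is a cut edge'' if it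 consists of a single edge and its two endpoints. $K_{r,s}$ is the complete bipartite graph with parts of sizes $r,s$; in $K_{2,\ell}$ one has $\ell\ge 2$. $K_{2,\ell}\cup\{e\}$ denotes a non bipartite graph obtained from $K_{2,\ell}$ by adding one edge $e$ joining two of its vertices. Double-$K_{2,(r,s)}$ graph ($r,s\geq 2$): let $G_1=K_{2,r}\cup\{e\}$ be non bipartite, where $e$ is an edge connecting two vertices of $K_{2,r}$, and let $G_2=K_{2,s}$. A double-$K_{2,(r,s)}$ is a graph obtained from $G_1$ and $G_2$ by identifying the edge $e$ of $G_1$ with any edge of $G_2$ (a 2-clique sum). Necklace-$K_{2,\ell}$ graph: a chain of bipartite blocks is a graph with bipartite blocks whose block tree is a path, where the block tree is the bipartite graph whose vertices are the blocks and the cut vertices, a block $B$ being adjacent to a cut vertex $u$ iff $u\in B$. Let $R$ be a bipartite graph consisting of a chain of blocks $B_1,\ldots,B_k$, $k\geq 2$, where each $B_i$ is either a $K_{2,n_i}$ with $n_i\geq 2$ or a cut edge of $R$. Let $x_1\in V(B_1)$ and $x_2\in V(B_k)$ be two non-adjacent vertices of $R$ at odd distance which are not cut vertices of $R$. A necklace-$K_{2,\ell}$ graph is the graph obtained from $R$ by identifying $x_1$ and $x_2$, i.e. the graph with vertex set $(V(R)\setminus\{x_1,x_2\})\cup\{x\}$ and edge set $E(R\setminus\{x_1,x_2\})\cup\{\{u,x\} : \{u,x_1\}\in E(R)\text{ or }\{u,x_2\}\in E(R)\}$. *)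

(* Defs.v *)
From HB Require Import structures.
From mathcomp Require Import all_boot all_order all_algebra.
From mathcomp Require Import mpoly.

Set Implicit Arguments.
Unset Strict Implicit.
Unset Printing Implicit Defensive.

Import GRing.Theory.
Local Open Scope ring_scope.

(** * Finite simple graphs

    A graph on a finite type [T] has its own vertex set [vset G : {set T}], so
    that subgraphs of [G] are again graphs on [T]. *)

Definition sgraph_axiom (T : finType) (VE : {set T} * {set {set T}}) : bool :=
  [forall e in VE.2, (e \subset VE.1) && (#|e| == 2)].

Record sgraph (T : finType) := SGraph {
  sgraph_val : {set T} * {set {set T}};
  sgraph_valP : sgraph_axiom sgraph_val
}.

HB.instance Definition _ (T : finType) := [isSub for @sgraph_val T].
HB.instance Definition _ (T : finType) := [Finite of sgraph T by <:].

Section Graphs.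
Variable T : finType.
Implicit Types (G H K B : sgraph T) (x y v : T).

Definition vset G : {set T} := (sgraph_val G).1.
Definition eset G : {set {set T}} := (sgraph_val G).2.

Definition adj G : rel T := [rel x y | [set x; y] \in eset G].

Definition subgraph H G : bool :=
  (vset H \subset vset G) && (eset H \subset eset G).

Definition ncomp G : nat := n_comp (adj G) (mem (vset G)).

(* In particular the graph without vertices is not connected. *)
Definition connected G : bool := ncomp G == 1%N.

Lemma del_vertex_subproof G v :
  sgraph_axiom (vset G :\ v, [set e in eset G | v \notin e]).
Proof.
apply/forall_inP => e; rewrite inE => /andP[eG ve] /=.
have /andP[sub ->] := forall_inP (sgraph_valP G) e eG.
by rewrite andbT subsetD1 ve andbT.
Qed.

Definition del_vertex G v : sgraph T := SGraph (del_vertex_subproof G v).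

Definition cut_vertex G v : bool :=
  (v \in vset G) && (ncomp G < ncomp (del_vertex G v))%N.

Definition biconnected G : bool := connected G && [forall v, ~~ cut_vertex G v].

Definition is_block G B : bool :=
  [&& subgraph B G, biconnected B &
      [forall H : sgraph T,
        [&& subgraph H G, biconnected H & subgraph B H] ==> (H == B)]].

Definition blocks G : {set sgraph T} := [set B | is_block G B].

Definition cut_vertices G : {set T} := [set v | cut_vertex G v].

(* A block that "is a cut edge". *)
Definition single_edge G : Prop := exists2 e, eset G = [set e] & vset G = e.

Definition bipartition G (A A' : {set T}) : Prop :=
  [/\ A :|: A' = vset G, [disjoint A & A'] &
      forall e, e \in eset G ->
        exists x y, [/\ x \in A, y \in A' & e = [set x; y]]].

Definition bipartite G : Prop := exists A A', bipartition G A A'.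

Definition complete_bipartite (r s : nat) G : Prop :=
  exists A A', [/\ bipartition G A A', #|A| = r, #|A'| = s &
    forall x y, x \in A -> y \in A' -> [set x; y] \in eset G].

Definition is_K2 (l : nat) G : Prop := (2 <= l)%N /\ complete_bipartite 2 l G.

(* [G] is non bipartite and is a K_{2,l} with the edge [e] added. *)
Definition is_K2_plus (l : nat) G (e : {set T}) : Prop :=
  exists K x y,
    [/\ is_K2 l K, [/\ x \in vset K, y \in vset K, x != y & e = [set x; y]],
        vset G = vset K, eset G = e |: eset K & ~ bipartite G].

(* 2-clique sum of [G1] and [G2] along [e]: the identification is performed
   inside [G], whose subgraphs [G1] and [G2] share exactly the edge [e]. *)
Definition is_double_K2 (r s : nat) G : Prop :=
  exists G1 G2 e,
    [/\ is_K2_plus r G1 e, is_K2 s G2, e \in eset G2, vset G1 :&: vset G2 = e &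
        vset G = vset G1 :|: vset G2 /\ eset G = eset G1 :|: eset G2].

Definition is_dist G x y (d : nat) : Prop :=
  (exists p, [/\ path (adj G) x p, last x p = y & size p = d]) /\
  (forall p, path (adj G) x p -> last x p = y -> (d <= size p)%N).

(* [G] is the path graph visiting the vertices [p] in this order. *)
Definition is_path_graph G (p : seq T) : Prop :=
  [/\ uniq p, vset G = [set x in p] &
      eset G = [set [set xy.1; xy.2] | xy in zip p (behead p)]].

End Graphs.

Definition sgraph_iso (T U : finType) (G : sgraph T) (H : sgraph U) : Prop :=
  exists f : {x | x \in vset G} -> {y | y \in vset H},
    bijective f /\
    forall x y, adj G (val x) (val y) = adj H (val (f x)) (val (f y)).

(** * Block tree and necklaces *)

Section BlockTree.
Variables (T : finType) (G : sgraph T).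

Definition block_tree_vset : {set (sgraph T + T)%type} :=
  [set inl B | B in blocks G] :|: [set inr u | u in cut_vertices G].

Definition block_tree_eset : {set {set (sgraph T + T)%type}} :=
  [set [set inl B; inr u]
    | B in blocks G, u in cut_vertices G & u \in vset B].

Lemma block_tree_subproof : sgraph_axiom (block_tree_vset, block_tree_eset).
Proof.
apply/forall_inP => e /= /imset2P[B u BG]; rewrite inE => /andP[uG _] ->.
rewrite cards2 /= andbT subUset !sub1set !inE.
by rewrite (imset_f inl BG) (imset_f inr uG) orbT.
Qed.

Definition block_tree : sgraph (sgraph T + T)%type := SGraph block_tree_subproof.

(* The block tree of [G] is a path, along which the blocks are met in the
   order [Bs]. *)
Definition block_chain (Bs : seq (sgraph T)) : Prop :=
  exists2 p, is_path_graph block_tree p &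
    Bs = pmap (fun z => if z is inl B then Some B else None) p.

End BlockTree.

Section Identify.
Variables (T : finType) (R : sgraph T) (x1 x2 : T).

(* The graph obtained from [R] by identifying the non-adjacent vertices [x1]
   and [x2]: the new vertex is [None], the others are [Some u]. *)
Definition identify_vset : {set option T} :=
  None |: [set Some u | u in vset R :\: [set x1; x2]].

Definition identify_eset : {set {set option T}} :=
  [set [set Some u | u in e : {set T}]
    | e in [set e in eset R | (x1 \notin e) && (x2 \notin e)]] :|:
  [set [set Some u; None]
    | u in [set u in vset R :\: [set x1; x2] | adj R u x1 || adj R u x2]].

Lemma identify_subproof : sgraph_axiom (identify_vset, identify_eset).
Proof.
apply/forall_inP => e /=; rewrite inE => /orP[] /imsetP[].
  move=> f; rewrite inE => /andP[fR /andP[x1f x2f]] ->.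
  have /andP[sub f2] := forall_inP (sgraph_valP R) f fR.
  rewrite card_imset ?f2 ?andbT; last exact: Some_inj.
  apply/subsetP => _ /imsetP[u uf ->]; rewrite !inE /= imset_f //.
  rewrite !inE (subsetP sub u uf) andbT.
  by apply/norP; split; [apply: contraNneq x1f | apply: contraNneq x2f] => <-.
move=> u; rewrite inE => /andP[uR _] ->.
rewrite cards2 /= andbT; apply/subsetP => z; rewrite !inE.
by case/orP => /eqP -> //=; rewrite imset_f.
Qed.

Definition identify : sgraph (option T) := SGraph identify_subproof.

End Identify.

Definition is_necklace_K2 (T : finType) (H : sgraph T) : Prop :=
  exists (U : finType) (R : sgraph U) (B1 Bk : sgraph U)
         (Bs : seq (sgraph U)) (x1 x2 : U),
    [/\ bipartite R /\ block_chain R (B1 :: rcons Bs Bk),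
        forall B, B \in blocks R -> (exists l, is_K2 l B) \/ single_edge B,
        [/\ x1 \in vset B1, x2 \in vset Bk,
            ~~ cut_vertex R x1 & ~~ cut_vertex R x2],
        ~~ adj R x1 x2 /\ (exists2 d, is_dist R x1 x2 d & odd d) &
        sgraph_iso (identify R x1 x2) H].

(** * Ideals of polynomial rings and Gröbner bases *)

Section Groebner.
Variables (K : fieldType) (m : nat).
Local Notation poly := {mpoly K[m]}.
Local Notation pset := (poly -> Prop).
Implicit Types (I S : pset) (le : rel 'X_{1..m}) (p g h : poly).

Definition ideal_gen S : pset := fun p =>
  exists (k : nat) (c g : 'I_k -> poly),
    (forall i, S (g i)) /\ p = \sum_(i < k) c i * g i.

Definition generates S I : Prop := forall p, ideal_gen S p <-> I p.

Definition generated_by_quadrics I : Prop :=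
  exists S : pset, (forall p, S p -> p \is 2.-homog) /\ generates S I.

(* By Dickson's lemma, such an order is a well-order. *)
Definition monomial_order le : Prop :=
  [/\ total le, antisymmetric le, transitive le,
      (forall u, le 0%MM u) &
      (forall u v w, le u v -> le (u + w)%MM (v + w)%MM)].

Definition is_lm le p (u : 'X_{1..m}) : Prop :=
  u \in msupp p /\ (forall v, v \in msupp p -> le v u).

Definition initial_ideal le I : pset :=
  ideal_gen (fun q => exists p u, [/\ I p, is_lm le p u & q = 'X_[u]]).

Definition groebner_basis le I (B : seq poly) : Prop :=
  (forall g, g \in B -> I g) /\
  generates (fun q => exists g u, [/\ g \in B, is_lm le g u & q = 'X_[u]])
            (initial_ideal le I).

Definition reduced_groebner_basis le I (B : seq poly) : Prop :=
  [/\ groebner_basis le I B,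
      (forall g, g \in B -> exists2 u, is_lm le g u & g@_u = 1) &
      (forall g h u v, g \in B -> h \in B -> g != h ->
         is_lm le h u -> v \in msupp g -> ~~ (u <= v)%MM)].

Definition universal_groebner_basis I : pset := fun p =>
  exists le B, [/\ monomial_order le, reduced_groebner_basis le I B & p \in B].

(* A minimal set of generators, the elements being considered up to sign: a
   generating subset of [S] contains each element of [S] or its opposite. *)
Definition minimal_generators_up_to_sign S I : Prop :=
  generates S I /\
  forall S' : pset, (forall p, S' p -> S p) -> generates S' I ->
    forall p, S p -> S' p \/ S' (- p).

Definition robust I : Prop :=
  minimal_generators_up_to_sign (universal_groebner_basis I) I.

End Groebner.

(** * Toric ideal of a graph

    The variables are indexed by ['I_#|eset G|], the [i]-th one being the edge
    [enum_val i]. *)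

Section Toric.
Variables (K : fieldType) (T : finType) (G : sgraph T).

Definition canon_vec (v : T) : {ffun T -> nat} := [ffun w => (w == v) : nat].

Definition edge_vec (e : {set T}) : {ffun T -> nat} :=
  \sum_(v in e) canon_vec v.

Definition degA (u : 'X_{1..#|eset G|}) : {ffun T -> nat} :=
  \sum_(i < #|eset G|) edge_vec (enum_val i) *+ u i.

Definition toric_ideal : {mpoly K[#|eset G|]} -> Prop :=
  ideal_gen (fun p => exists u v, degA u = degA v /\ p = 'X_[u] - 'X_[v]).

End Toric.

Arguments toric_ideal K {T} G _.

(* Main.v *)
Require Import Defs.
From mathcomp Require Import all_boot all_order all_algebra.
From mathcomp Require Import zify ring.
From mathcomp Require Import ssrcomplements mpoly.
From Stdlib Require Import Classical.

(** Both sides of the equivalence say the same about the cycles of [G], namely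
    [cycle_condition]: every even cycle has length 4, some vertex [a] lies on
    all odd cycles, and no two odd cycles meet in [a] only.

    Algebra to cycles.  A toric ideal consists of the polynomials whose
    coefficients sum to zero on every fibre of the grading, so for a monomial
    order a monomial is standard iff it is the least of its fibre [nf], and the
    minimal nonstandard monomials give the reduced Gröbner basis
    ([min_nonstd_universal]).  If the ideal is robust and generated by quadrics,
    the quadrics of a single reduced basis already generate, so the universal
    Gröbner basis consists of quadrics ([universal_quadric]).  Taking an order
    that eliminates the edges outside a set [F], this shows that a nonzero
    integral vector on [F] in the kernel of the incidence matrix forces a
    4-cycle inside [F] ([robust_kernel_square]).  Applied to the alternating
    vectors of closed walks, it makes all even cycles squares and forbids two
    odd cycles that share at most one vertex ([even_cycle_size4],
    [odd_cycles_share2]); a 4-clique is excluded because its three perfect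
    matchings would give three binomials where two generate ([robust_no_K4]).
    Then a suitable vertex of a shortest odd cycle is on all odd cycles
    ([odd_cycles_hit]).

    Cycles to algebra.  Two monomials of one fibre colour the edges red and
    blue so that every vertex that meets one colour meets the other.  Following
    an alternating walk until it returns, one finds an alternating 4-cycle
    ([alternating_square_exists]), that is, a quadric of the ideal below the
    binomial.  Hence all reduced Gröbner bases consist of quadrics; their
    fibres have two elements, as there is no 4-clique, so none of them can be
    left out ([robust_quadratic]).

    Cycles to blocks.  In a bipartite block whose cycles have length 4,
    vertices of opposite colours are adjacent ([opposite_adj]), so it is an edge
    or a [K_{2,l}].  Odd cycles share two vertices, so they lie in one block
    [B].  Splitting the vertex [x] common to all odd cycles into two copies,
    one for each colour of its neighbours, turns [B] into a bipartite graph
    with short cycles, whose blocks form a chain between the copies because [B]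
    has no cut vertex ([block_chain_exists]).  Therefore [B] is always a
    necklace ([split_necklace]).

    Blocks to cycles.  Every cycle lies in a block, and the cycles of the three
    kinds of non bipartite blocks are inspected by 2-colourings
    ([K2_plus_condition], [double_K2_condition], [necklace_condition]). *)

Set Implicit Arguments.
Unset Strict Implicit.
Unset Printing Implicit Defensive.

(* [lia] treats sizes as atoms and compares their type argument
   syntactically, hence the normalisation. *)
Ltac slia :=
  repeat match goal with
  | H : context [@size (Equality.sort ?A) ?p] |- _ =>
    let B := eval hnf in (Equality.sort A) in
    progress change (@size (Equality.sort A) p) with (@size B p) in H
  | |- context [@size (Equality.sort ?A) ?p] =>
    let B := eval hnf in (Equality.sort A) in
    progress change (@size (Equality.sort A) p) with (@size B p)
  end; lia.

(** * Walks and cycles of a symmetric relation *)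

Lemma first_repeat (A : eqType) (p : seq A) :
  ~~ uniq p -> exists y p1 p2 p3,
    p = p1 ++ y :: p2 ++ y :: p3 /\ uniq (p1 ++ y :: p2).
Proof.
elim/last_ind: p => // p z IHp; rewrite rcons_uniq negb_and negbK orbC.
case: (boolP (uniq p)) => [un /= zp|/IHp[y [p1 [p2 [p3 [ep un]]]]] _].
  case/splitPr: zp un => p1 p2 un; exists z, p1, p2, [::].
  by rewrite rcons_cat /= cats1.
by exists y, p1, p2, (rcons p3 z); rewrite ep !rcons_cat /= rcons_cat.
Qed.

Section Walks.
Variables (T : finType) (e : rel T).
Hypothesis symE : ssrbool.symmetric e.

Lemma path_rev_sym x p z :
  path e x (rcons p z) -> path e z (rcons (rev p) x).
Proof.
move=> /[dup] pth; rewrite -rev_path last_rcons belast_rcons rev_cons => h.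
by rewrite -(eq_path (e := fun a b => e b a)) // => a b; rewrite symE.
Qed.

Lemma connect_symE : connect_sym e.
Proof. exact: sym_connect_sym. Qed.

(** Cutting a closed walk at a repeated vertex leaves two closed walks, one of
    which is odd again. *)
Lemma odd_closed_walk x p :
  path e x p -> last x p = x -> odd (size p) ->
  exists2 c, cycle e c /\ uniq c & odd (size c).
Proof.
have [n] := ubnP (size p); elim: n x p => // n IHn x p.
case: (lastP p) => // {}p z; rewrite size_rcons last_rcons => le_pn pth zx od.
subst z; case: (boolP (uniq (x :: p))) => [un|]; first by exists (x :: p).
rewrite /= negb_and negbK; case/orP => [xp|].
  move: pth le_pn od; case/splitPr: xp => p1 p2.
  rewrite rcons_cat rcons_cons cat_path /= size_cat /= => /and3P[q1 q2 q3] le od.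
  case: (boolP (odd (size p1).+1)) => od1.
    apply: (IHn x (rcons p1 x)); rewrite ?size_rcons ?last_rcons ?rcons_path ?q1 //; slia.
  apply: (IHn x (rcons p2 x)); rewrite ?size_rcons ?last_rcons //.
    by move: le; slia.
  by move: od od1; rewrite oddD /=; case: odd; case: odd.
case/first_repeat => y [p1 [p2 [p3 [ep _]]]].
move: pth le_pn od; rewrite {}ep !rcons_cat rcons_cons !rcons_cat rcons_cons.
rewrite cat_path /= cat_path /= !(size_cat, size_rcons) /= size_cat /=.
case/and5P => q1 q2 q3 q4 q5 le od.
case: (boolP (odd (size p2).+1)) => od2.
  apply: (IHn y (rcons p2 y)); rewrite ?size_rcons ?last_rcons //; first slia.
  by rewrite rcons_path q3.
apply: (IHn x (p1 ++ y :: rcons p3 x)).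
- rewrite size_cat /= size_rcons; slia.
- by rewrite cat_path /= q1 q2.
- by rewrite last_cat /= last_rcons.
- move: od od2; rewrite size_cat /= size_rcons !(oddD, oddS) /=.
  by do 3!case: (odd _).
Qed.

(** Colour a vertex by the parity of the walks that lead to it from the root of
    its component; two parities for one vertex close an odd walk. *)
Lemma two_colouring_or_odd_cycle :
  (exists f : T -> bool, forall x y, e x y -> f x != f y) \/
  (exists2 c, cycle e c /\ uniq c & odd (size c)).
Proof.
pose e2 : rel (T * bool) := [rel a b | e a.1 b.1 && (a.2 != b.2)].
pose r := fingraph.root e; pose f v := connect e2 (r v, false) (v, true).
have walk a b : connect e2 a b ->
    exists2 p, path e a.1 p /\ last a.1 p = b.1 & odd (size p) = (a.2 != b.2).
  case/connectP => p; elim: p a => [|c p IHp] a /=.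
    by move=> _ ->; exists [::]; rewrite ?eqxx.
  case/andP => /andP[ac nac] /IHp{}IHp /IHp[q [pq lq] oq].
  exists (c.1 :: q); rewrite /= ?ac //; move: nac oq => /=.
  by move: a.2 c.2 b.2 => [] [] [] // _ ->.
have step a x y b : connect e2 a (x, b) -> e x y -> connect e2 a (y, ~~ b).
  by move=> h exy; apply: connect_trans h (connect1 _); rewrite /e2 /= exy; case: b.
have reach v : f v || connect e2 (r v, false) (v, false).
  suff h b u : connect e u v -> connect e2 (u, b) (v, true) || connect e2 (u, b) (v, false).
    by apply: h; rewrite connect_symE connect_root.
  case/connectP => p; elim: p u b => [|w p IHp] u b /=.
    by move=> _ ->; case: b; rewrite connect0 ?orbT.
  case/andP => uw pw lw; have := IHp w (~~ b) pw lw.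
  have s : connect e2 (u, b) (w, ~~ b) by apply: step uw; exact: connect0.
  by case/orP => h; rewrite (connect_trans s h) ?orbT.
case: (boolP [forall x, forall y, e x y ==> (f x != f y)]) => [h|].
  by left; exists f => x y exy; have /forallP/(_ y)/implyP := forallP h x; apply.
rewrite negb_forall => /existsP[x]; rewrite negb_forall => /existsP[y].
rewrite negb_imply negbK => /andP[exy /eqP fxy]; right.
have rxy : r x = r y by apply/fingraph.rootP; [exact: connect_symE | exact: connect1].
have close b : connect e2 (r x, false) (x, b) -> connect e2 (r x, false) (y, b) ->
    exists2 c, cycle e c /\ uniq c & odd (size c).
  move=> h1 h2; have := walk _ _ (step _ _ _ _ h1 exy) => -[p [pp lp] op].
  have := walk _ _ h2 => -[q [pq lq] oq].
  case: (lastP q) pq lq oq => [|q' z] /=.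
    move=> _ ryy oq; apply: (odd_closed_walk pp); first by rewrite lp -ryy.
    by move: oq; rewrite op; case: (b).
  rewrite last_rcons => pq zy oq; subst z.
  have pr := path_rev_sym pq.
  apply: (@odd_closed_walk (r x) (p ++ rcons (rev q') (r x))).
  - by rewrite cat_path pp lp.
  - by rewrite last_cat last_rcons.
  - rewrite size_cat size_rcons size_rev oddD op -(size_rcons q' y) oq.
    by case: (b).
case fx: (f x); first by apply: (close true); rewrite // rxy -/(f y) -fxy.
have := reach x; have := reach y; rewrite -fxy fx /= -rxy => h1 h2.
exact: (close false).
Qed.

Lemma colour_walk (f : T -> bool) x p :
  (forall u v, u \in x :: p -> v \in x :: p -> e u v -> f u != f v) ->
  path e x p -> f (last x p) = odd (size p) (+) f x.
Proof.
elim: p x => [|y p IHp] x //= hf /andP[exy pth].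
rewrite IHp // => [|u v hu hv]; last by apply: hf; rewrite inE ?hu ?hv orbT.
have := hf x y; rewrite !inE !eqxx orbT /= => /(_ isT isT exy).
by case: (f x); case: (f y); case: (odd _).
Qed.

Lemma colour_cycle (f : T -> bool) c :
  (forall u v, u \in c -> v \in c -> e u v -> f u != f v) ->
  cycle e c -> ~~ odd (size c).
Proof.
case: c => // x p hf /= pth; have := @colour_walk f x (rcons p x).
rewrite last_rcons size_rcons => /(_ _ pth) /=.
have h u : u \in x :: rcons p x -> u \in x :: p.
  by rewrite !inE mem_rcons inE orbA orbb.
move=> H; have {}H : f x = ~~ odd (size p) (+) f x.
  by apply: H => u v /h hu /h hv; exact: hf.
by move: H; case: (f x); case: (odd _).
Qed.

Lemma rot_to_cycle c x :
  x \in c -> cycle e c -> uniq c ->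
  exists p, [/\ cycle e (x :: p), uniq (x :: p), size c = (size p).+1 & c =i x :: p].
Proof.
move=> xc cy un; case: (rot_to xc) => i p ep; exists p.
rewrite -ep rot_cycle rot_uniq; split=> //; last by move=> z; rewrite mem_rot.
by rewrite -(size_rot i) ep.
Qed.

Lemma connect_uniq_path x y :
  connect e x y -> exists p, [/\ path e x p, uniq (x :: p) & last x p = y].
Proof.
case/connectP => p pth ->; case/shortenP: pth => q pq un _.
by exists q.
Qed.

End Walks.

Lemma two_colouring_off (T : finType) (e : rel T) a :
  ssrbool.symmetric e ->
  (exists f : T -> bool, forall x y, x != a -> y != a -> e x y -> f x != f y) \/
  (exists c, [/\ cycle e c, uniq c, odd (size c) & a \notin c]).
Proof.
move=> symE; pose e' := [rel u v | [&& u != a, v != a & e u v]].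
have symE' : ssrbool.symmetric e' by move=> u v; rewrite /= symE; do 2!case: eqVneq.
have [[f hf]|[c [cyc un] od]] := two_colouring_or_odd_cycle symE'.
  by left; exists f => x y xa ya xy; apply: hf; rewrite /= xa ya.
right; exists c; split=> //; first by apply: sub_cycle cyc => u v /and3P[].
apply/negP => ac; have [p [cp _ _ _]] := rot_to_cycle ac cyc un.
by case: p cp => [|y p]; rewrite /= eqxx.
Qed.

(** * A vertex on all odd cycles *)

Lemma first_hit (A : eqType) (P : pred A) (d : seq A) :
  has P d -> exists p t d', [/\ d = p ++ t :: d', P t & ~~ has P p].
Proof.
elim: d => //= y d IHd; case: (boolP (P y)) => [Py _|nPy /= /IHd[p [t [d' [-> Pt nP]]]]].
  by exists [::], y, d.
by exists (y :: p), t, d'; rewrite /= negb_or nPy.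
Qed.

Lemma uniq_countP (A : eqType) (s : seq A) :
  reflect (forall z, count_mem z s <= 1) (uniq s).
Proof.
apply: (iffP idP) => [un z|]; first by rewrite count_uniq_mem // leq_b1.
elim: s => //= y s IHs h; rewrite IHs ?andbT => [|z]; last first.
  by apply: leq_trans (h z); rewrite leq_addl.
by have := h y; rewrite eqxx -has_pred1 has_count -leqNgt; lia.
Qed.

Lemma index_pivot (A : eqType) (v : A) p1 p2 :
  uniq (p1 ++ v :: p2) -> index v (p1 ++ v :: p2) = size p1.
Proof.
by rewrite -cat_rcons cat_uniq rcons_uniq index_cat mem_rcons mem_head
  => /andP[/andP[v1 _] _]; rewrite -cats1 index_cat (negPf v1) /= eqxx addn0.
Qed.

Lemma mem_split (A : eqType) (v : A) p : v \in p -> exists p1 p2, p = p1 ++ v :: p2.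
Proof. by case/splitPr => p1 p2; exists p1, p2. Qed.

(* Proves [uniq s'] from [h : forall z, count_mem z s <= 1] when the entries
   of [s'] are among those of [s]. *)
Ltac count_uniq h :=
  let z := fresh "z" in
  apply/uniq_countP => z; move: (h z);
  rewrite ?(count_cat, count_rev, =^~ cats1) /= ?(count_cat, count_rev) /=
          ?(count_cat, count_rev) /=;
  repeat match goal with
  | |- context [nat_of_bool ?b] => move: (nat_of_bool b) => ?
  | |- context [count ?a ?p] => move: (count a p) => ?
  end; clear; lia.

(* Decides parity statements about sizes by running through the parities of
   all atoms. *)
Ltac parity :=
  rewrite /= ?(size_cat, size_rcons, size_rev) /=
    ?(size_cat, size_rcons, size_rev) /= ?(size_cat, size_rcons, size_rev) /=
    ?(oddD, oddS) /= ?(oddD, oddS) /= ?(oddD, oddS) /= ?(oddD, oddS) /=;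
  repeat case: (odd _) => //=.

Section Hitting.
Variables (T : finType) (e : rel T).
Hypotheses (symE : ssrbool.symmetric e) (irrE : irreflexive e).
Hypothesis even4 : forall c, cycle e c -> uniq c -> ~~ odd (size c) -> size c <= 4.

(** With [q] the rest of a cycle through [x], the entries [head x q] and
    [last x q] are the neighbours of [x] on that cycle. *)
Definition no_twin x q :=
  forall x', x' \notin x :: q -> e x' (head x q) -> e x' (last x q) -> False.

Section Shortest.
Variables (x : T) (q : seq T).
Hypotheses (cycC : cycle e (x :: q)) (uniqC : uniq (x :: q)).
Hypothesis (oddC : odd (size q).+1).
Hypothesis shortC :
  forall d, cycle e d -> uniq d -> odd (size d) -> (size q).+1 <= size d.
Hypothesis notwin : no_twin x q.

(** An ear attached to a shortest odd cycle closes an even cycle, hence a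
    4-cycle, with one of the two arcs between its ends. If that arc is the
    one through [x], then minimality forces the ear to be a single vertex
    adjacent to both neighbours of [x]. *)
Lemma ear_parity q1 s q2 t q3 p :
  q = q1 ++ s :: q2 ++ t :: q3 ->
  path e s (rcons p t) -> uniq p -> (forall z, z \in p -> z \notin x :: q) ->
  odd (size p) = odd (size q2).
Proof.
move=> eq_q pth unp disj; apply/eqP; apply: contraT => npar.
have szq : size q = (size q1 + (size q2 + (size q3).+1).+1)%N.
  by rewrite eq_q size_cat /= size_cat.
have {}disj : uniq (q ++ x :: p).
  have /andP[xq uq] : (x \notin q) && uniq q := uniqC.
  rewrite cat_uniq /= (negPf xq) unp uq /= andbT.
  apply/andP; split; last by apply/negP => /disj; rewrite inE eqxx.
  by apply/hasPn => z /disj; rewrite inE negb_or => /andP[].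
move: cycC disj; rewrite eq_q /= rcons_cat /= rcons_cat /= cat_path /=.
rewrite cat_path /= => /and5P[c1 c2 c3 c4 c5].
move/uniq_countP => disj.
have cyc1 : cycle e (s :: p ++ t :: q3 ++ x :: q1).
  rewrite /= rcons_cat /= rcons_cat /= -cat_rcons cat_path pth last_rcons /=.
  rewrite -cat_rcons cat_path c5 last_rcons /=.
  by rewrite rcons_path c1 c2.
have un1 : uniq (s :: p ++ t :: q3 ++ x :: q1).
  by count_uniq disj.
have cyc2 : cycle e (s :: q2 ++ t :: rev p).
  rewrite /= rcons_cat /= -cat_rcons cat_path rcons_path c3 c4 last_rcons /=.
  exact: path_rev_sym.
have un2 : uniq (s :: q2 ++ t :: rev p).
  by count_uniq disj.
have par1 : ~~ odd (size (s :: p ++ t :: q3 ++ x :: q1)).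
  by move: npar oddC; rewrite szq; parity.
have par2 : odd (size (s :: q2 ++ t :: rev p)).
  by move: npar; parity.
have := even4 cyc1 un1 par1; have := shortC cyc2 un2 par2.
rewrite szq /= !size_cat /= size_rev size_cat /= => le2 le1.
have /andP[/eqP p1 /andP[/nilP q10 /nilP q30]] :
    [&& size p == 1, nilp q1 & nilp q3].
  rewrite /nilp; move: le1 le2; clear.
  by move: (size p) (size q1) (size q2) (size q3) => a b c d; lia.
move: eq_q pth disj p1; rewrite {}q10 {}q30 /= => eq_q.
case: p => [|x' []] //= in {unp npar szq cyc1 un1 cyc2 un2 par1 par2 le1 le2} *.
rewrite andbT => /andP[sx' x't] disj _; apply/negP => _.
apply: (notwin (x' := x')); rewrite ?eq_q /= ?last_cat //=; last by rewrite symE.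
have /uniq_countP : forall z, count_mem z ((s :: q2 ++ [:: t]) ++ [:: x; x']) <= 1.
  exact: disj.
rewrite -eq_q cat_uniq => /and3P[_ /norP[_ /norP[x'q _]] /andP[xx' _]].
by rewrite inE negb_or x'q andbT eq_sym -mem_seq1.
Qed.

Let lab v := odd (index v q).

(** Colouring the path [C - x] by parity, every ear that avoids [x] joins its
    ends consistently, and so does every walk between vertices of [C]. *)
Lemma stretch_parity s d :
  path e s d -> uniq (s :: d) -> x \notin d -> s \in q -> last s d \in q ->
  lab (last s d) = lab s (+) odd (size d).
Proof.
have [n] := ubnP (size d); elim: n s d => // n IHn s [|y d0] le_dn; first by rewrite addbF.
set d := y :: d0 in le_dn * => pth un xd sq lq.
have [p [t [d' [ed tq np]]]] : exists p t d', [/\ d = p ++ t :: d', t \in q & ~~ has (mem q) p].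
  by apply: first_hit; apply/hasP; exists (last s d) => //; rewrite /d /= mem_last.
move: pth un xd lq le_dn; rewrite ed -cat_rcons cat_path last_cat last_rcons.
case/andP => pth1 pth2 un xd lq le_dn.
move/uniq_countP: un => un.
have unp : uniq p by count_uniq un.
have und' : uniq (t :: d') by count_uniq un.
have unst : uniq (s :: rcons p t) by count_uniq un.
move: xd; rewrite mem_cat mem_rcons inE !negb_or => /andP[/andP[xt xp] xd'].
rewrite (IHn t d') //; last first.
  by move: le_dn; rewrite size_cat size_rcons; clear; lia.
have disj z : z \in p -> z \notin x :: q.
  move=> zp; rewrite inE negb_or (hasPn np) // andbT.
  by apply: contraNneq xp => <-.
have uq : uniq q by case/andP: uniqC.
have key u v q1 q2 q3 p' : q = q1 ++ u :: q2 ++ v :: q3 ->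
    path e u (rcons p' v) -> uniq p' -> p' =i p -> lab v = lab u (+) odd (size p').+1.
  move=> eq_q puv unp' pp'.
  have -> : odd (size p').+1 = odd (size q2).+1.
    by rewrite /= (ear_parity eq_q puv unp') // => z; rewrite pp'; exact: disj.
  have iu : index u q = size q1 by rewrite eq_q index_pivot -?eq_q.
  have iv : index v q = size (q1 ++ u :: q2).
    have eq_q' : q = (q1 ++ u :: q2) ++ v :: q3 by rewrite eq_q -catA.
    by rewrite eq_q' index_pivot -?eq_q'.
  by rewrite /lab iu iv; parity.
suff -> : lab t = lab s (+) odd (size p).+1 by rewrite /lab; parity.
have nst : s != t by move: unst; rewrite /= mem_rcons inE negb_or => /andP[/andP[]].
have [q1 [q2 eq_q]] := mem_split sq.
move: tq; rewrite eq_q mem_cat inE eq_sym (negPf nst) /=; case/orP=> tq.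
  have [q3 [q4 eq_q1]] := mem_split tq.
  have eq_q2 : q = q3 ++ t :: q4 ++ s :: q2 by rewrite eq_q eq_q1 -catA.
  have := key _ _ _ _ _ _ eq_q2 (path_rev_sym symE pth1).
  rewrite rev_uniq size_rev => /(_ unp (mem_rev p)) ->.
  by rewrite addbK.
have [q3 [q4 eq_q2]] := mem_split tq.
by apply: key pth1 unp _ => //; rewrite eq_q eq_q2.
Qed.

(** An odd cycle that avoids [x] would be cut by two of its common vertices
    with [C] into walks of equal parity. *)
Lemma no_odd_cycle_off d :
  cycle e d -> uniq d -> odd (size d) -> x \notin d ->
  forall s t, s != t -> s \in d -> t \in d -> s \in q -> t \in q -> False.
Proof.
move=> cd ud od xd s t nst sd td sq tq.
have [p [cp up sp memp]] := rot_to_cycle sd cd ud; rewrite {}sp in od.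
move: td; rewrite memp inE eq_sym (negPf nst) /=.
case/mem_split=> p1 [p2 ep]; rewrite {}ep in cp up od memp; move: cp.
rewrite /= rcons_cat /= -cat_rcons cat_path last_rcons => /andP[pth1 pth2].
have xp : x \notin s :: p1 ++ t :: p2 by rewrite -memp.
have /uniq_countP up' := up.
have h1 : lab t = lab s (+) odd (size p1).+1.
  rewrite -(size_rcons p1 t) -[in LHS](last_rcons s p1 t).
  apply: stretch_parity; rewrite ?last_rcons //; first by count_uniq up'.
  by apply: contra xp; rewrite mem_rcons !(inE, mem_cat) => /orP[]->; rewrite ?orbT.
have h2 : lab s = lab t (+) odd (size p2).+1.
  rewrite -(size_rcons p2 s) -[in LHS](last_rcons t p2 s).
  apply: stretch_parity; rewrite ?last_rcons //; first by count_uniq up'.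
  by apply: contra xp; rewrite mem_rcons !(inE, mem_cat) => /orP[]->; rewrite ?orbT.
by move: od h2; rewrite h1 /lab; parity.
Qed.
End Shortest.

Hypothesis noK4 : forall a b c d,
  ~~ [&& e a b, e a c, e a d, e b c, e b d & e c d].
Hypothesis odd2 : forall c d, cycle e c -> uniq c -> odd (size c) ->
  cycle e d -> uniq d -> odd (size d) ->
  exists x y, [/\ x != y, x \in c, x \in d, y \in c & y \in d].

Lemma irr_neq x y : e x y -> x != y.
Proof. by apply: contraTneq => ->; rewrite irrE. Qed.

(** Of two consecutive vertices [x], [t] of a shortest odd cycle, one has no
    twin: twins [x'] and [t'] would give a 4-clique or two triangles meeting
    in one vertex if the cycle is a triangle, and otherwise a shorter odd
    cycle or a 6-cycle. *)
Lemma no_twin_next x t q :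
  cycle e [:: x, t & q] -> uniq [:: x, t & q] -> odd (size q).+2 ->
  (forall d, cycle e d -> uniq d -> odd (size d) -> (size q).+2 <= size d) ->
  no_twin x (t :: q) \/ no_twin t (rcons q x).
Proof.
move=> cyc un od short.
case: (boolP [exists x', [&& x' \notin [:: x, t & q], e x' t & e x' (last t q)]]); last first.
  by move/existsPn=> h; left=> x' nx /= h1 h2; case/negP: (h x'); apply/and3P.
case/existsP => x' /and3P[nx' x't x'l]; right=> t' nt' /=.
case: q od short cyc un nx' x'l nt' => [|w q] //= od short.
move=> cyc un nx' x'l nt' t'w; rewrite last_rcons => t'x.
have xt : e x t by case/andP: cyc.
have tw : e t w by case/and3P: cyc.
have nt'' : t' \notin [:: x, t, w & q].
  by apply: contra nt'; rewrite !inE mem_rcons inE; do 3?case/orP => [->|]; rewrite ?orbT // => ->; rewrite !orbT.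
move: nx' nt''; rewrite !inE !negb_or.
case/and4P => x'Dx x'Dt x'Dw x'q /and4P[t'Dx t'Dt t'Dw t'q].
have xDt := irr_neq xt; have tDw := irr_neq tw.
have xDw : x != w by case/andP: un; rewrite !inE !negb_or => /and3P[].
case: (lastP q) od short cyc un x'l x'q t'q => [|q0 s] /= od short cyc un.
  (* [C] is the triangle [x t w] *)
  case/and4P: cyc => _ _ wx _ x'w _ _.
  case: (eqVneq x' t') => [ex|ntx].
    have := noK4 x t w x'; rewrite xt symE wx symE ex t'x tw (symE t) -ex x't.
    by rewrite (symE w) x'w.
  have [||||||u [v [+ u1 u2 v1 v2]]] := @odd2 [:: w; x'; t] [:: w; t'; x] => //=.
  - by rewrite symE x'w x't tw.
  - by rewrite !inE negb_or (eq_sym w) x'Dw eq_sym tDw x'Dt.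
  - by rewrite symE t'w t'x symE wx.
  - by rewrite !inE negb_or (eq_sym w) t'Dw eq_sym xDw t'Dx.
  suff comm z : z \in [:: w; x'; t] -> z \in [:: w; t'; x] -> z = w.
    by rewrite (comm u u1 u2) (comm v v1 v2) eqxx.
  rewrite !inE; case: (z =P w) => //= _ /orP[]/eqP->.
    by rewrite (negPf ntx) (negPf x'Dx).
  by rewrite eq_sym (negPf t'Dt) eq_sym (negPf xDt).
rewrite last_rcons => x's x'q t'q.
have sx : e s x by move: cyc; rewrite rcons_path last_rcons => /and4P[].
case: (eqVneq x' t') => [ex|ntx].
  have := short [:: x'; t; w]; rewrite /= x't tw symE ex t'w -ex !inE negb_or x'Dt x'Dw tDw.
  by rewrite size_rcons; move=> /(_ isT isT isT).
have := @even4 [:: x; s; x'; t; w; t']; rewrite /= (symE x) sx (symE s) x's x't tw (symE w) t'w t'x.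
move=> /(_ isT) h6; suff un6 : uniq [:: x; s; x'; t; w; t'] by have := h6 un6 isT.
move: un x'q t'q; rewrite /= !inE !mem_rcons !inE !negb_or rcons_uniq.
case/and4P => /and4P[_ _ nxs _] /and3P[_ nts _] /andP[nws _] _ /andP[nx's _] /andP[nt's _].
rewrite (eq_sym x x') (eq_sym x t') (eq_sym s x') (eq_sym s t) (eq_sym s w) (eq_sym s t') (eq_sym t t') (eq_sym w t').
by rewrite nxs x'Dx xDt xDw t'Dx nx's nts nws nt's x'Dt x'Dw ntx tDw t'Dt t'Dw.
Qed.

(** Some vertex of a shortest odd cycle has no twin. An odd cycle that misses it
    would still meet the shortest one in two vertices, against the parity of
    its arcs between them. *)
Lemma odd_cycles_hit c0 :
  cycle e c0 -> uniq c0 -> odd (size c0) ->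
  exists x (f : T -> bool), forall u v, u != x -> v != x -> e u v -> f u != f v.
Proof.
move=> cy0 un0 od0.
pose P n := [exists c : n.-tuple T, [&& cycle e c, uniq c & odd (size c)]].
have Pc c : cycle e c -> uniq c -> odd (size c) -> P (size c).
  by move=> h1 h2 h3; apply/existsP; exists (in_tuple c); rewrite h1 h2 h3.
have exP : exists n, P n by exists (size c0); exact: Pc.
case: (ex_minnP exP) => n /existsP[c /and3P[cy un od]] short0.
have short d : cycle e d -> uniq d -> odd (size d) -> size c <= size d.
  by move=> h1 h2 h3; rewrite size_tuple; apply/short0/Pc.
have [x [q [cyx unx odx shx nt]]] : exists x q, [/\ cycle e (x :: q), uniq (x :: q),
    odd (size q).+1, forall d, cycle e d -> uniq d -> odd (size d) -> (size q).+1 <= size d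
    & no_twin x q].
  case: (tval c) cy un od short => [|x [|t q]] //= cy un od short.
    by move: cy; rewrite irrE.
  case: (no_twin_next cy un od short) => nt; first by exists x, (t :: q).
  exists t, (rcons q x); split=> //.
  - by change (cycle e (rcons (t :: q) x)); rewrite -rot1_cons rot_cycle.
  - by change (uniq (rcons (t :: q) x)); rewrite -rot1_cons rot_uniq.
  - by rewrite size_rcons.
  - by move=> d; rewrite size_rcons; exact: short.
case: (two_colouring_off x symE) => [[f hf]|[d [cyd' und odd_d xd]]]; first by exists x, f.
have [s [t [nst sc sd tc td]]] := odd2 cyx unx odx cyd' und odd_d.
have inq z : z \in x :: q -> z \in d -> z \in q.
  by rewrite inE => /orP[/eqP-> /(negP xd)|].
by case: (no_odd_cycle_off cyx unx odx shx nt cyd' und odd_d xd nst); auto.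
Qed.
End Hitting.

(** * Alternating 4-cycles *)

(** The relations [r] and [b] are the supports of two monomials with the same
    degree, seen as the red and the blue edges of a graph. *)
Section Alternating.
Variables (T : finType) (e r b : rel T).
Hypotheses (symR : ssrbool.symmetric r) (symB : ssrbool.symmetric b).
Hypotheses (subR : subrel r e) (subB : subrel b e).
Hypothesis disjRB : forall x y, r x y -> b x y -> False.

Let col (k : bool) := if k then r else b.

Let symcol k : ssrbool.symmetric (col k).
Proof. by case: k. Qed.

Let subcol k : subrel (col k) e.
Proof. by case: k. Qed.

Fixpoint altpath (k : bool) (x : T) (p : seq T) : bool :=
  if p is y :: p' then col k x y && altpath (~~ k) y p' else true.

Lemma altpath_cat k x p q :
  altpath k x (p ++ q) = altpath k x p && altpath (odd (size p) (+) k) (last x p) q.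
Proof.
elim: p k x => [|y p IHp] k x //=; rewrite IHp andbA; congr (_ && altpath _ _ _).
by case: k; case: odd.
Qed.

Lemma altpath_rev k x p z :
  altpath k x (rcons p z) -> altpath (odd (size p) (+) k) z (rcons (rev p) x).
Proof.
elim: p k x => [|y p IHp] k x /=; first by rewrite !andbT symcol.
case/andP => xy /IHp {}IHp.
rewrite rev_cons -cats1 altpath_cat addNb -addbN IHp /= andbT last_rcons symcol.
by rewrite size_rcons size_rev /=; move: xy; case: k {IHp}; case: odd.
Qed.

Lemma altpath_path k x p : altpath k x p -> path e x p.
Proof. by elim: p k x => //= y p IHp k x /andP[/subcol-> /IHp]. Qed.

Definition alternating_square :=
  exists x y z t, [/\ r x y, b y z, r z t & b t x].

Hypothesis even4 : forall c, cycle e c -> uniq c -> ~~ odd (size c) -> size c <= 4.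

Lemma even_altcycle k x p :
  altpath k x (rcons p x) -> uniq (x :: p) -> odd (size p) -> alternating_square.
Proof.
move=> alt un od.
have le4 := even4 (c := x :: p) (altpath_path alt) un; move: le4 alt od {un}.
case: p => [|y1 [|y2 [|y3 [|y4 p]]]] //=.
- case: k => _ /and3P[h1 h2 _] _; rewrite symcol in h2.
    by case: (disjRB h1).
  by case: (disjRB h2).
- case: k => _ /and5P[h1 h2 h3 h4 _] _; last by exists y1, y2, y3, x.
  by exists x, y1, y2, y3.
- by move=> h _ od; have := h (introT negPn od).
Qed.

Variables (a : T) (f : T -> bool).
Hypothesis colF : forall u v, u != a -> v != a -> e u v -> f u != f v.
Hypothesis symE : ssrbool.symmetric e.
Hypothesis odd_meet : forall p q,
  cycle e (a :: p) -> uniq (a :: p) -> odd (size p).+1 ->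
  cycle e (a :: q) -> uniq (a :: q) -> odd (size q).+1 -> has (mem p) q.
Hypothesis balanced : forall x, [exists y, r x y] = [exists y, b x y].

(** The walk closes an alternating cycle at its first repeated vertex; the
    cycle avoids [a], so it is even and therefore a square. *)
Lemma repeat_off k x p :
  altpath k x p -> a \notin x :: p -> ~~ uniq (x :: p) -> alternating_square.
Proof.
move=> alt na /first_repeat[y [p1 [p2 [p3 [ep un]]]]].
have [k' alt'] : exists k', altpath k' y (rcons p2 y).
  case: p1 ep {un} => [|z p1] [ex ep].
    move: alt; rewrite ep -ex -cat_rcons altpath_cat => /andP[alt _]; by exists k.
  move: alt; rewrite ep -cat_rcons altpath_cat last_rcons => /andP[_].
  rewrite -cat_rcons altpath_cat => /andP[alt _]; by exists (odd (size (rcons p1 y)) (+) k).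
have sub z : z \in y :: p2 -> z != a.
  move=> zy; apply: contraNneq na => <-; rewrite ep mem_cat inE mem_cat.
  by move: zy; rewrite inE => /orP[]->; rewrite ?orbT.
have un' : uniq (y :: p2) by move: un; rewrite cat_uniq => /and3P[].
apply: (even_altcycle alt') => //.
have := @colour_cycle _ e f (y :: p2).
rewrite /= negbK; apply; last exact: altpath_path alt'.
by move=> u v /sub hu /sub hv; exact: colF.
Qed.

(** Alternating walks never get stuck, by [balanced], so they come back to
    [a] unless they close an even cycle before. *)
Lemma return_or_square k x : [exists y, r x y] ->
  alternating_square \/
  exists p, [/\ altpath k x (rcons p a), a \notin p & uniq p].
Proof.
move=> nx.
have col_ex k' z : [exists y, r z y] -> exists y, col k' z y.
  by case: k' => nz; apply/existsP; rewrite // -balanced.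
suff grow n : alternating_square \/ (exists p, [/\ altpath k x (rcons p a), a \notin p & uniq p]) \/
    exists p, [/\ altpath k x p, a \notin p, uniq p, size p = n & [exists y, r (last x p) y]].
  case: (grow #|T|.+1) => [h|[h|]]; [by left|by right|].
  case=> p [_ _ un sp _]; have := max_card (mem p).
  by rewrite (card_uniqP un) sp ltnn.
elim: n => [|n [h|[h|[p [alt na un sp nl]]]]]; [|by left|by right; left|].
  by right; right; exists [::].
have [y cy] := col_ex (odd (size p) (+) k) _ nl.
have alt' : altpath k x (rcons p y) by rewrite -cats1 altpath_cat alt /= cy.
case: (eqVneq y a) => [ya|nya]; first by right; left; exists p; split; rewrite // -{1}ya.
case: (boolP (y \in p)) => [yp|nyp]; last first.
  right; right; exists (rcons p y); rewrite mem_rcons inE negb_or eq_sym nya.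
  rewrite rcons_uniq nyp un size_rcons sp last_rcons; split=> //.
  move: cy; rewrite symcol; case: (odd _ (+) _) => cy.
    by apply/existsP; exists (last x p).
  by rewrite balanced; apply/existsP; exists (last x p).
left; case: p {sp nl cy} alt na un alt' yp => [|z p] //= /andP[xz alt] na un /andP[_ alt'] yp.
apply: (repeat_off alt'); first by rewrite -rcons_cons mem_rcons inE negb_or eq_sym nya.
by rewrite -rcons_cons rcons_uniq yp.
Qed.

(** The two arcs between [a] and [v] on an odd cycle have lengths of different
    parities; the odd one leaves [a] and reaches [v] in the same colour. *)
Lemma odd_arc k p v :
  altpath k a (rcons p a) -> a \notin p -> uniq p -> ~~ odd (size p) -> v \in p ->
  exists p1, [/\ altpath k a (rcons p1 v), a \notin rcons p1 v, uniq (rcons p1 v) & ~~ odd (size p1)].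
Proof.
move=> alt na un ev /mem_split[p1 [p2 ep]]; rewrite ep in alt na un ev.
case: (boolP (odd (size p1))) => od1; last first.
  exists p1; split=> //.
  - by move: alt; rewrite rcons_cat /= -cat_rcons altpath_cat => /andP[].
  - by apply: contra na; rewrite mem_cat mem_rcons !inE => /orP[]->; rewrite ?orbT.
  - by move: un; rewrite -cat_rcons cat_uniq => /and3P[].
have od2 : ~~ odd (size p2) by move: ev od1; parity.
exists (rev p2); split; rewrite ?size_rev //.
- have := altpath_rev alt; rewrite (negPf ev) rev_cat rev_cons rcons_cat.
  by rewrite altpath_cat => /andP[].
- by apply: contra na; rewrite mem_cat mem_rcons !inE mem_rev => /orP[]->; rewrite ?orbT.
- move: un; rewrite cat_uniq => /and3P[_ _ /andP[vp2 u2]].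
  by rewrite rcons_uniq mem_rev vp2 rev_uniq.
Qed.

(** Two odd alternating cycles through [a], one leaving it in red and the other
    in blue, share a second vertex [v]; their odd arcs from [a] to [v] form an
    alternating closed walk of even length. *)
Lemma alternating_square_exists x : [exists y, r x y] -> alternating_square.
Proof.
move=> nx; case: (boolP [exists y, r a y]) => na; last first.
  have [//|[p [alt nap _]]] := return_or_square true nx.
  case/negP: na; move: alt; rewrite -cats1 altpath_cat /= => /and3P[_ cl _].
  move: cl; rewrite symcol; case: (odd _ (+) _) => cl.
    by apply/existsP; exists (last x p).
  by rewrite balanced; apply/existsP; exists (last x p).
have [//|[p [altp nap unp]]] := return_or_square true na.
have [//|[q [altq naq unq]]] := return_or_square false na.
case: (boolP (odd (size p))) => evp.
  by apply: (even_altcycle altp) => //=; rewrite nap.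
case: (boolP (odd (size q))) => evq.
  by apply: (even_altcycle altq) => //=; rewrite naq.
have /hasP[v vq /= vp] : has (mem p) q.
  by apply: odd_meet; rewrite /= ?nap ?naq //; apply: altpath_path; eassumption.
have [p1 [alt1 na1 un1 ev1]] := odd_arc altp nap unp evp vp.
have [q1 [alt2 na2 un2 ev2]] := odd_arc altq naq unq evq vq.
have alt3 : altpath true a (rcons (p1 ++ v :: rev q1) a).
  rewrite rcons_cat /= -cat_rcons altpath_cat alt1 last_rcons size_rcons /= (negPf ev1) /=.
  by have := altpath_rev alt2; rewrite (negPf ev2).
have na3 : a \notin p1 ++ v :: rev q1.
  move: na1 na2; rewrite mem_cat !mem_rcons !inE mem_rev !negb_or.
  by case/andP=> -> -> /andP[_ ->].
case: (boolP (uniq (p1 ++ v :: rev q1))) => un3.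
  apply: (even_altcycle alt3); first by rewrite /= na3.
  by move: ev1 ev2; parity.
case: (p1 ++ _) alt3 na3 un3 => [|z p3] //= /andP[_]; rewrite -cats1 altpath_cat.
by case/andP => alt3 _; exact: (repeat_off alt3).
Qed.

End Alternating.

(** * Integral edge vectors in the kernel of the incidence matrix *)

Section EdgeVectors.
Variable T : finType.

Lemma set2_inj (a b c : T) : [set a; b] = [set a; c] -> b = c.
Proof.
move=> E; have := set22 a b; rewrite E !inE => /orP[]/eqP // ba.
by have := set22 a c; rewrite -E ba !inE orbb => /eqP.
Qed.

Lemma eq_set2 (a b c d : T) :
  [set a; b] = [set c; d] -> (a = c /\ b = d) \/ (a = d /\ b = c).
Proof.
move=> E; have := set21 a b; rewrite E !inE => /orP[]/eqP ac.
  by left; split=> //; apply: (set2_inj (a := a)); rewrite E ac.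
by right; split=> //; apply: (set2_inj (a := a)); rewrite E ac setUC.
Qed.

Fixpoint walk_edges (x : T) (p : seq T) : seq {set T} :=
  if p is z :: p' then [set x; z] :: walk_edges z p' else [::].

Lemma walk_edges_cat x p q :
  walk_edges x (p ++ q) = walk_edges x p ++ walk_edges (last x p) q.
Proof. by elim: p x => //= z p IHp x; rewrite IHp. Qed.

Lemma mem_walk_edges x p E u : E \in walk_edges x p -> u \in E -> u \in x :: p.
Proof.
elim: p x => //= z p IHp x; rewrite inE => /orP[/eqP->|/IHp h /h uz].
  by rewrite !inE => /orP[]->; rewrite ?orbT.
by rewrite inE uz orbT.
Qed.

(** A square inside a closed walk has no choice at a vertex that is visited
    once: it comes from the previous vertex and goes on to the next one. *)
Lemma walk_edges_at x p u q v :
  [set u; v] \in walk_edges x (p ++ u :: q) -> u \notin x :: p -> u \notin q ->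
  v = last x p \/ exists q', q = v :: q'.
Proof.
move=> + up uq; rewrite walk_edges_cat mem_cat => /orP[h|].
  by case/negP: up; apply: mem_walk_edges h (set21 _ _).
rewrite /= inE => /orP[/eqP|].
  by rewrite [RHS]setUC => /set2_inj->; left.
case: q uq => //= w q uq; rewrite inE => /orP[/eqP/set2_inj->|h]; first by right; exists q.
by case/negP: uq; apply: mem_walk_edges h (set21 _ _).
Qed.

Local Open Scope ring_scope.
Import GRing.Theory.

(** For a closed walk of even length this is the exponent vector of the
    binomial attached to the walk. *)
Fixpoint walk_vec (x : T) (p : seq T) (E : {set T}) : int :=
  if p is z :: p' then (E == [set x; z])%:R - walk_vec z p' E else 0.

Lemma walk_vec_supp x p E : walk_vec x p E != 0 -> E \in walk_edges x p.
Proof.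
elim: p x => [|z p IHp] x //=.
rewrite inE; case: (eqVneq E [set x; z]) => //= _.
rewrite mulr0n sub0r oppr_eq0; exact: IHp.
Qed.

Definition balanced (y : {set T} -> int) :=
  forall v, \sum_(E : {set T} | v \in E) y E = 0.

Variable e : rel T.
Hypothesis irrE : irreflexive e.

Lemma sum_walk_vec x p v : path e x p ->
  \sum_(E : {set T} | v \in E) walk_vec x p E =
  (v == x)%:R - (-1) ^+ size p * (v == last x p)%:R.
Proof.
elim: p x => [|z p IHp] x /=; first by rewrite big1 // mul1r subrr.
case/andP => xz /IHp{}IHp; rewrite big_split /= sumrN IHp.
have -> : \sum_(E : {set T} | v \in E) (E == [set x; z])%:R = (v == x)%:R + (v == z)%:R :> int.
  transitivity ((v \in [set x; z])%:R : int).
    case: (boolP (v \in [set x; z])) => vS; last first.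
      by apply: big1 => E vE; case: eqP => // ES; rewrite -ES vE in vS.
    rewrite (bigD1 [set x; z]) //= eqxx big1 ?addr0 // => E /andP[_ /negPf->] //.
  rewrite !inE; case: (v =P x) => [->|] //=; last by rewrite add0r.
  by case: (x =P z) => [xz'|]; [rewrite xz' irrE in xz | rewrite addr0].
rewrite opprD opprK exprS mulN1r mulNr opprK; ring.
Qed.

Lemma closed_walk_balanced x p :
  path e x p -> last x p = x -> ~~ odd (size p) -> balanced (walk_vec x p).
Proof.
move=> pth lx od v; rewrite sum_walk_vec // lx -signr_odd (negPf od) mul1r.
by rewrite subrr.
Qed.

Definition square_in (y : {set T} -> int) s t q r :=
  [/\ uniq [:: s; t; q; r], y [set s; t] != 0, y [set t; q] != 0,
      y [set q; r] != 0 & y [set r; s] != 0].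

Variable ES : pred {set T}.
Hypothesis edgeS : forall x y, [set x; y] \in ES -> e x y.
Hypothesis kernel_square : forall y : {set T} -> int,
  (forall E, y E != 0 -> E \in ES) -> balanced y -> (exists E, y E != 0) ->
  exists s t q r, square_in y s t q r.

(** Eliminating an edge of a square disjoint from [E0] shrinks the support
    and keeps [E0] in it. *)
Lemma kernel_square_through (y : {set T} -> int) E0 :
  (forall E, y E != 0 -> E \in ES) -> balanced y -> y E0 != 0 ->
  exists s t q r, square_in y s t q r /\ E0 = [set s; t].
Proof.
have [n] := ubnP #|[set E | y E != 0]|; elim: n y => // n IHn y le_n suppy baly yE0.
have [|a [b [c [d [un ab bc cd da]]]]] := kernel_square suppy baly; first by exists E0.
have /uniq_countP un' := un.
case: (eqVneq E0 [set a; b]) => [->|nab]; first by exists a, b, c, d.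
case: (eqVneq E0 [set b; c]) => [->|nbc].
  by exists b, c, d, a; split=> //; split=> //; count_uniq un'.
case: (eqVneq E0 [set c; d]) => [->|ncd].
  by exists c, d, a, b; split=> //; split=> //; count_uniq un'.
case: (eqVneq E0 [set d; a]) => [->|nda].
  by exists d, a, b, c; split=> //; split=> //; count_uniq un'.
pose w := walk_vec a [:: b; c; d; a].
have pth : path e a [:: b; c; d; a] by rewrite /= !edgeS ?suppy.
have balw : balanced w by exact: closed_walk_balanced.
pose y' E := y E - y [set a; b] * w E.
have wab : w [set a; b] = 1.
  rewrite /w /= eqxx; move: un; rewrite /= !inE !negb_or.
  case/and4P => /and3P[nab' nac nad] /andP[nbc' nbd] ncd' _.
  have neq x z u v : x != z -> x != v -> ([set x; u] == [set z; v] :> {set T}) = false.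
    move=> xz xv; apply: contraNF xz => /eqP/eq_set2[[->]//|[xv' _]].
    by rewrite xv' eqxx in xv.
  have ad : ([set a; b] == [set d; a]) = false.
    by apply: contraNF nbd; rewrite [X in _ == X]setUC => /eqP/set2_inj->.
  by rewrite ad !neq //= !mulr0n !subr0.
have wE0 : w E0 = 0 by rewrite /w /= (negPf nab) (negPf nbc) (negPf ncd) (negPf nda).
have sub E : y' E != 0 -> y E != 0.
  apply: contraNneq => yE; rewrite /y' yE sub0r oppr_eq0 mulf_eq0 orbC.
  apply/orP; left; apply: contraTT isT => wE.
  have := walk_vec_supp wE; rewrite !inE => /or4P[]/eqP eE;
    by move: ab bc cd da; rewrite -eE yE eqxx.
have [||||s [t [q [r [[un'' h1 h2 h3 h4] ->]]]]] := IHn y'.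
- apply: leq_trans (_ : (_ < #|[set E | y E != 0%R]|)%N) _; last by rewrite -ltnS.
  apply: proper_card; apply/properP; split.
    by apply/subsetP => E; rewrite !inE; exact: sub.
  by exists [set a; b]; rewrite !inE // negbK /y' wab mulr1 subrr.
- by move=> E /sub; exact: suppy.
- by move=> v; rewrite sumrB baly -mulr_sumr balw mulr0 subr0.
- by rewrite /y' wE0 mulr0 subr0.
by exists s, t, q, r; split=> //; split=> //; exact: sub.
Qed.

(** In a closed walk that runs once around a cycle [c :: p] and then along [w]
    without touching [p] again, the first edge has coefficient 1. The square
    through it uses vertices of [p] until it is back at [c], so it is the
    cycle. *)
Lemma cycle_of_square c p w :
  cycle e (c :: p) -> uniq (c :: p) -> (1 < size p)%N ->
  path e c w -> last c w = c -> (forall z, z \in w -> z \notin p) ->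
  ~~ odd (size p).+1 (+) odd (size w) ->
  (forall x y, e x y -> [set x; y] \in ES) ->
  size p = 3.
Proof.
move=> cyc un sp pw lw wp ev edgeES.
have /andP[cp up] : (c \notin p) && uniq p by exact: un.
pose W := rcons p c ++ w.
have pW : path e c W by rewrite cat_path last_rcons pw andbT.
have lW : last c W = c by rewrite last_cat last_rcons.
have oW : ~~ odd (size W) by move: ev; rewrite /W; parity.
have supW E : walk_vec c W E != 0 -> E \in ES.
  move/walk_vec_supp; suff sub x q : path e x q -> {subset walk_edges x q <= ES} by exact: sub.
  elim: q x => //= z q IHq x /andP[xz /IHq{}IHq] F; rewrite inE => /orP[/eqP->|/IHq//].
  exact: edgeES.
case: p => [|p0 [|p1 p]] // in un up cp wp sp ev cyc W pW lW oW supW *.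
have fresh z l : z \in [:: p0, p1 & p] -> z \notin l -> z \notin l ++ c :: w.
  move=> zp zl; rewrite mem_cat inE !negb_or zl /=.
  apply/andP; split; first by apply: contraNneq cp => <-.
  by apply/negP => /wp; rewrite zp.
have eW : W = [:: p0, p1 & p] ++ c :: w by rewrite /W cat_rcons.
have p0W : p0 \notin p1 :: p ++ c :: w.
  by rewrite -cat_cons; apply: fresh; rewrite ?mem_head //; case/andP: up.
have cDp0 : c != p0 by apply: contraNneq cp => ->; rewrite mem_head.
have cDp1 : c != p1 by apply: contraNneq cp => ->; rewrite !inE eqxx orbT.
have pDp : p0 != p1 by move: up; rewrite /= inE negb_or => /andP[/andP[]].
have yE0 : walk_vec c W [set c; p0] != 0.
  have h : walk_vec p0 (behead W) [set c; p0] = 0.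
    apply/eqP; apply: contraTT isT => /walk_vec_supp; rewrite eW /= inE.
    case/orP => [/eqP|h].
      by rewrite setUC => /set2_inj cp1; rewrite cp1 eqxx in cDp1.
    by case/negP: p0W; have := mem_walk_edges h (set22 _ _).
  by move: h; rewrite eW /= eqxx => ->.
have [s [t [q [r [sq E0]]]]] := kernel_square_through supW (closed_walk_balanced pW lW oW) yE0.
have {sq E0} : exists s t q r, [/\ uniq [:: s; t; q; r], [set t; q] \in walk_edges c W,
    [set q; r] \in walk_edges c W, [set r; s] \in walk_edges c W & c = s /\ p0 = t].
  case: sq => unq h1 h2 h3 h4; have /uniq_countP unq' := unq.
  case: (eq_set2 E0) => [[es et]|[et es]].
    by exists s, t, q, r; split=> //; exact: walk_vec_supp.
  exists t, s, r, q; split=> //; [by count_uniq unq' | | | ];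
    by apply: walk_vec_supp; rewrite setUC.
case=> {}s [{}t [{}q [{}r [unq h1 h2 h3 [es et]]]]]; subst s t.
move: unq; rewrite /= !inE !negb_or => /and4P[/and3P[_ cq cr] /andP[p0q p0r] qr _].
(* the square continues with [p1] *)
have qp1 : q = p1.
  case: (@walk_edges_at c [::] p0 (p1 :: p ++ c :: w) q) => //.
  - by move: h1; rewrite eW.
  - by rewrite inE eq_sym.
  - by move=> h; rewrite h eqxx in cq.
  - by case=> q' [].
subst q; have p1W : p1 \notin p ++ c :: w.
  by apply: fresh; rewrite ?inE ?eqxx ?orbT //; case/and3P: up.
have [p' pr] : exists p', p ++ c :: w = r :: p'.
  case: (@walk_edges_at c [:: p0] p1 (p ++ c :: w) r) => //.
  - by move: h2; rewrite eW.
  - by rewrite !inE negb_or eq_sym cDp1 eq_sym.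
  - by move=> h; rewrite h eqxx in p0r.
move: h3; rewrite eW; move: pr fresh up cp cr cq; clear.
case: p => [|p2 p] /= [] => [<-|<- _] fresh up cp; first by rewrite eqxx.
move=> cr cq h3; case: p fresh up cp h3 => [|p3 p] // fresh up cp h3.
have /and4P[_ _ p2' _] := up.
case: (@walk_edges_at c [:: p0; p1] p2 (p3 :: p ++ c :: w) c) => //.
- move: up; rewrite /= !inE !negb_or => /and4P[/and3P[_ h _] /andP[h' _] _ _].
  by rewrite eq_sym cr eq_sym h eq_sym h'.
- by rewrite -cat_cons; apply: fresh => //; rewrite !inE eqxx !orbT.
- by move=> h; rewrite h eqxx in cq.
by case=> q' [h]; case/negP: cp; rewrite h !inE eqxx !orbT.
Qed.
End EdgeVectors.

Section CircuitConsequences.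
Variables (T : finType) (e : rel T).
Hypotheses (symE : ssrbool.symmetric e) (irrE : irreflexive e).
Hypothesis kernel_square : forall y : {set T} -> int,
  (forall E, y E != 0%R -> exists u v, e u v /\ E = [set u; v]) ->
  balanced y -> (exists E, y E != 0%R) ->
  exists s t q r, square_in y s t q r.

Let ES : pred {set T} := [pred E | [exists u, exists v, e u v && (E == [set u; v])]].

Let ESP E : reflect (exists u v, e u v /\ E = [set u; v]) (E \in ES).
Proof.
apply: (iffP existsP) => [[u /existsP[v /andP[uv /eqP->]]]|[u [v [uv ->]]]].
  by exists u, v.
by exists u; apply/existsP; exists v; rewrite uv eqxx.
Qed.

Let ESe u v : ([set u; v] \in ES) = e u v.
Proof.
apply/ESP/idP => [[u' [v' [uv /eq_set2[[-> ->]|[-> ->]]]]]|uv] //.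
  by rewrite symE.
by exists u, v.
Qed.

Let square_of_closed_walk c p w :
  cycle e (c :: p) -> uniq (c :: p) -> 1 < size p ->
  path e c w -> last c w = c -> (forall z, z \in w -> z \notin p) ->
  ~~ odd (size p).+1 (+) odd (size w) -> size p = 3.
Proof.
move=> h1 h2 h3 h4 h5 h6 h7.
apply: (@cycle_of_square _ e irrE ES _ _ c p w h1 h2 h3 h4 h5 h6 h7) => [u v|y supy|u v];
  rewrite ?ESe //.
by apply: kernel_square => E /supy/ESP.
Qed.

(** The closed walk is the cycle itself, so the square found in it is the whole
    cycle. *)
Lemma even_cycle_size4 c : cycle e c -> uniq c -> ~~ odd (size c) -> size c <= 4.
Proof.
case: c => [|c [|x [|y p]]] //= cyc un od.
have /= -> // : size [:: x, y & p] = 3.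
by apply: (@square_of_closed_walk c [:: x, y & p] [::]) => //=; rewrite addbF.
Qed.

(** Otherwise an odd closed walk starts on [c] and touches no other vertex of
    [c]: it goes around [d] when that is the common vertex, and else along a
    path to [d], around [d] and back. *)
Lemma odd_cycles_share2 (c d : seq T) :
  (forall x y, x \in c -> y \in d -> connect e x y) ->
  cycle e c -> uniq c -> odd (size c) -> cycle e d -> uniq d -> odd (size d) ->
  exists x y, [/\ x != y, x \in c, x \in d, y \in c & y \in d].
Proof.
move=> con cc uc oc cd ud od.
have big p x : cycle e (x :: p) -> odd (size p).+1 -> 1 < size p.
  by case: p => [|y [|]] //=; rewrite irrE.
have oddsize3 (p : seq T) : odd (size p).+1 -> size p = 3 -> False by move=> h1 h2; rewrite h2 in h1.
case: (boolP [exists x, (x \in c) && (x \in d)]) => [|nocommon].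
  case/existsP => x /andP[xc xd].
  have [p [cp up sp mp]] := rot_to_cycle xc cc uc; rewrite sp in oc.
  have [q [cq uq sq mq]] := rot_to_cycle xd cd ud; rewrite sq in od.
  case: (boolP (has (mem p) q)) => [/hasP[y yq yp]|dis].
    exists x, y; rewrite mp mq mp mq !mem_head !inE; split=> //; last 2 first.
    - by rewrite (yp : y \in p) orbT.
    - by rewrite yq orbT.
    by apply: contraTneq yq => <-; case/andP: uq.
  case: (oddsize3 p oc); apply: (@square_of_closed_walk x p (rcons q x)) => //.
  - exact: big cp oc.
  - by rewrite last_rcons.
  - move=> z; rewrite mem_rcons inE => /orP[/eqP->|zq]; first by case/andP: up.
    by apply: contra dis => zp; apply/hasP; exists z.
  - by move: oc od; parity.
have ndc z : z \in d -> z \notin c.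
  by move=> zd; apply: contra nocommon => zc; apply/existsP; exists z; rewrite zc.
have [y yd] : exists y, y \in d by case: (d) od => // y d' _; exists y; rewrite mem_head.
have [x xc] : exists x, x \in c by case: (c) oc => // x c' _; exists x; rewrite mem_head.
(* the part of a walk after its last visit to [c] *)
have last_exit n s x' : size s < n -> x' \in c -> path e x' s -> last x' s = y ->
    exists c0 s', [/\ c0 \in c, path e c0 s', last c0 s' = y & ~~ has (mem c) s'].
  elim: n s x' => // n IHn s x' le x'c pth ls.
  case: (boolP (has (mem c) s)) => [|no]; last by exists x', s.
  case/first_hit=> s1 [t [s2 [es tc _]]]; rewrite es in le pth ls.
  apply: (IHn s2 t) => //.
  - by move: le; rewrite size_cat /=; clear; lia.
  - by move: pth; rewrite cat_path /= => /and3P[].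
  - by rewrite last_cat in ls.
have /connectP[s0 ps0 ls0] := con x y xc yd.
have [c0 [s [c0c ps ls ns]]] := last_exit _ s0 x (ltnSn _) xc ps0 (esym ls0).
case: (lastP s) ps ls ns => [_ c0y|s1 y']; first by case/negP: (ndc y yd); rewrite -c0y.
rewrite last_rcons => ps y'y; subst y'; rewrite has_rcons negb_or => /andP[_ ns].
have [p [cp up sp mp]] := rot_to_cycle c0c cc uc; rewrite sp in oc.
have [q [cq uq sq mq]] := rot_to_cycle yd cd ud; rewrite sq in od.
case: (oddsize3 p oc).
apply: (@square_of_closed_walk c0 p (rcons s1 y ++ rcons q y ++ rcons (rev s1) c0)) => //.
- exact: big cp oc.
- rewrite cat_path ps last_rcons cat_path (cq : path e y (rcons q y)) last_rcons /=.
  exact: path_rev_sym.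
- by rewrite !last_cat last_rcons.
- move=> z; rewrite !(mem_cat, mem_rcons, inE, mem_rev) => zw.
  case: (eqVneq z c0) => [->|nz]; first by case/andP: up.
  have zc : z \notin c -> z \notin p by apply: contra => zp; rewrite mp inE zp orbT.
  move: zw; rewrite (negPf nz) /=; case/orP => [/orP[/eqP zy|zs]|/orP[zq|zs]].
  - by apply/zc/ndc; rewrite zy.
  - by apply/zc; exact: (hasPn ns).
  - by apply/zc/ndc; rewrite mq inE.
  - by apply/zc; exact: (hasPn ns).
- by move: oc od; parity.
Qed.

End CircuitConsequences.

Section BinomialIdeals.
Import GRing.Theory.
Local Open Scope ring_scope.

(** * Ideals *)

Section Ideals.
Variables (K : fieldType) (n : nat).
Local Notation poly := {mpoly K[n]}.
Implicit Types (S : poly -> Prop) (p q c : poly).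

Lemma ideal_gen_in S p : S p -> ideal_gen S p.
Proof.
by move=> Sp; exists 1%N, (fun=> 1), (fun=> p); rewrite big_ord1 mul1r.
Qed.

Lemma ideal_gen0 S : ideal_gen S 0.
Proof. by exists 0%N, (fun=> 0), (fun=> 0); rewrite big_ord0; split=> // -[]. Qed.

Lemma ideal_genD S p q : ideal_gen S p -> ideal_gen S q -> ideal_gen S (p + q).
Proof.
move=> [k [c [g [Sg ->]]]] [l [d [h [Sh ->]]]]; exists (k + l)%N.
exists (fun i => match split i with inl a => c a | inr b => d b end).
exists (fun i => match split i with inl a => g a | inr b => h b end).
split=> [i|]; first by case: (split i).
rewrite big_split_ord /=; congr (_ + _); apply: eq_bigr => i _.
  by rewrite (unsplitK (inl i)).
by rewrite (unsplitK (inr i)).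
Qed.

Lemma ideal_genM S c p : ideal_gen S p -> ideal_gen S (c * p).
Proof.
move=> [k [d [g [Sg ->]]]]; exists k, (fun i => c * d i), g; split=> //.
by rewrite mulr_sumr; apply: eq_bigr => i _; rewrite mulrA.
Qed.

Lemma ideal_genZ S (a : K) p : ideal_gen S p -> ideal_gen S (a *: p).
Proof. by rewrite -mul_mpolyC; exact: ideal_genM. Qed.

Lemma ideal_genN S p : ideal_gen S p -> ideal_gen S (- p).
Proof. by rewrite -mulN1r; exact: ideal_genM. Qed.

Lemma ideal_gen_sum S (I : eqType) (r : seq I) (F : I -> poly) :
  (forall i, i \in r -> ideal_gen S (F i)) -> ideal_gen S (\sum_(i <- r) F i).
Proof.
move=> SF; rewrite big_seq; elim/big_rec: _ => [|i x /SF Si Sx]; first exact: ideal_gen0.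
exact: ideal_genD.
Qed.

Lemma ideal_gen_sub S S' p :
  (forall q, S q -> ideal_gen S' q) -> ideal_gen S p -> ideal_gen S' p.
Proof.
move=> SS' [k [c [g [Sg ->]]]]; apply: ideal_gen_sum => i _.
exact/ideal_genM/SS'.
Qed.

End Ideals.

(** * Binomial ideals of a grading *)

Lemma mulpX (K : fieldType) (n : nat) (u v : 'X_{1..n}) :
  'X_[u] * 'X_[v] = 'X_[u + v] :> {mpoly K[n]}.
Proof. by rewrite mpolyXD. Qed.

Section FibreSums.
Variables (K : fieldType) (n : nat) (D : eqType) (dg : 'X_{1..n} -> D).
Local Notation poly := {mpoly K[n]}.

Definition binomial_ideal : poly -> Prop :=
  ideal_gen (fun p => exists u v, dg u = dg v /\ p = 'X_[u] - 'X_[v]).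

Hypothesis dgD : forall u v w, (dg (u + w)%MM == dg (v + w)%MM) = (dg u == dg v).

Definition fibre_sum (a : D) (p : poly) : K :=
  \sum_(m <- msupp p) p@_m *+ (dg m == a).

Lemma fibre_sumE k a (p : poly) : (msize p <= k)%N ->
  fibre_sum a p = \sum_(m : 'X_{1..n < k}) p@_m *+ (dg m == a).
Proof.
move=> le_pk; pose I : subFinType _ := 'X_{1..n < k}.
rewrite /fibre_sum (big_mksub I) //=; first last.
- by move=> x /msize_mdeg_lt /leq_trans; apply.
- by rewrite msupp_uniq.
by rewrite big_rmcond //= => i; move/memN_msupp_eq0 ->; rewrite mul0rn.
Qed.

Lemma fibre_sum_is_additive a : {morph fibre_sum a : p q / p + q}.
Proof.
move=> p q; pose k := (msize p + msize q + msize (p + q))%N.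
rewrite !(@fibre_sumE k) ?/k; [|lia..].
by rewrite -big_split /=; apply: eq_bigr => m _; rewrite mcoeffD mulrnDl.
Qed.

Lemma fibre_sum0 a : fibre_sum a 0 = 0.
Proof. by rewrite /fibre_sum msupp0 big_nil. Qed.

Lemma fibre_sum_sum a (I : Type) (r : seq I) (F : I -> poly) :
  fibre_sum a (\sum_(i <- r) F i) = \sum_(i <- r) fibre_sum a (F i).
Proof. exact: (big_morph _ (fibre_sum_is_additive a) (fibre_sum0 a)). Qed.

Lemma fibre_sumZX a (c : K) u : fibre_sum a (c *: 'X_[u]) = c *+ (dg u == a).
Proof.
case: (eqVneq c 0) => [->|nc]; first by rewrite scale0r fibre_sum0 mul0rn.
rewrite /fibre_sum (perm_big _ (msuppZ _ nc)) msuppX big_seq1 mcoeffZ mcoeffX eqxx.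
by rewrite mulr1.
Qed.

Lemma binomial_ideal_fibre_sum p a : binomial_ideal p -> fibre_sum a p = 0.
Proof.
move=> [k [c [g [Sg ->]]]]; rewrite fibre_sum_sum big1 // => i _.
have [u [v [uv ->]]] := Sg i; rewrite [c i]mpolyE mulr_suml fibre_sum_sum big1_seq //.
move=> m _; rewrite mulrBr -!scalerAl !mulpX -scaleNr fibre_sum_is_additive !fibre_sumZX.
rewrite mulNrn -[(m + u)%MM]addmC -[(m + v)%MM]addmC.
have /eqP -> : dg (u + m)%MM == dg (v + m)%MM by rewrite dgD uv.
by rewrite subrr.
Qed.

(** Modulo the ideal every monomial is a chosen representative of its fibre. *)
Lemma mem_binomial_ideal (rep : 'X_{1..n} -> 'X_{1..n}) p :
  (forall u, dg (rep u) = dg u) -> (forall u v, dg u = dg v -> rep u = rep v) ->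
  (forall a, fibre_sum a p = 0) ->
  p = \sum_(m <- msupp p) p@_m *: ('X_[m] - 'X_[rep m]).
Proof.
move=> dgr repE sum0.
have z : \sum_(m <- msupp p) p@_m *: 'X_[rep m] = 0 :> poly.
  apply/mpolyP => w; rewrite mcoeff0 raddf_sum /=.
  case: (eqVneq (rep w) w) => rw; last first.
    rewrite big1_seq // => m _; rewrite mcoeffZ mcoeffX; case: eqP => [e|]; last by rewrite mulr0.
    by case/eqP: rw; rewrite -e; apply: repE; rewrite dgr.
  rewrite -[RHS](sum0 (dg w)); apply: eq_bigr => m _; rewrite mcoeffZ mcoeffX mulr_natr.
  congr (_ *+ nat_of_bool _); apply/eqP/eqP => [<-|/repE->]; [by rewrite dgr | exact: rw].
under eq_bigr do rewrite scalerBr.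
by rewrite sumrB z subr0 -mpolyE.
Qed.

End FibreSums.

(** * Dickson's lemma *)

Lemma dickson_seq k (P : seq nat -> Prop) :
  exists2 L : seq (seq nat), (forall w, w \in L -> P w) &
    forall u, size u = k -> P u -> exists2 w, w \in L & all2 leq w u.
Proof.
elim: k P => [|k IHk] P.
  have [P0|nP0] := classic (P [::]); last by exists [::] => // u /size0nil->.
  by exists [:: [::]] => [w|u /size0nil-> _]; [rewrite inE => /eqP->|exists [::]].
(* [L] covers all tails; its entries have heads below some [N], and the
   vectors with a smaller head are covered slice by slice *)
have [L LP Lcov] := IHk (fun u => exists a, P (a :: u)).
have [N [L1 [L1P L1cov]]] : exists N (L1 : seq (seq nat)),
    (forall w, w \in L1 -> P w) /\
    (forall u, u \in L -> exists2 a, (a <= N)%N & (a :: u) \in L1).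
  elim: L LP {Lcov} => [|u L IHL] LP; first by exists 0%N, [::].
  have [a Pa] := LP u (mem_head _ _).
  have [|N [L1 [L1P L1cov]]] := IHL; first by move=> w wL; apply: LP; rewrite inE wL orbT.
  exists (maxn a N), ((a :: u) :: L1); split=> [w|w].
    by rewrite inE => /orP[/eqP->//|/L1P].
  rewrite inE => /orP[/eqP->|/L1cov[b bN bL]].
    by exists a; [lia|rewrite mem_head].
  by exists b; [lia|rewrite inE bL orbT].
have [L2 L2P L2cov] : exists2 L2 : seq (seq nat), (forall w, w \in L2 -> P w) &
    forall a u, (a < N)%N -> size u = k -> P (a :: u) ->
      exists2 w, w \in L2 & all2 leq w (a :: u).
  elim: (N) => [|M [L2 L2P L2cov]]; first by exists [::].
  have [L3 L3P L3cov] := IHk (fun u => P (M :: u)).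
  exists (map (cons M) L3 ++ L2) => [w|a u].
    by rewrite mem_cat => /orP[/mapP[u /L3P Pu ->]|/L2P].
  rewrite ltnS leq_eqVlt => /orP[/eqP->|aM] su Pu.
    have [w wL wu] := L3cov u su Pu; exists (M :: w); last by rewrite /= leqnn.
    by rewrite mem_cat (map_f (cons M)).
  have [w wL wu] := L2cov a u aM su Pu; exists w => //.
  by rewrite mem_cat wL orbT.
exists (L1 ++ L2) => [w|[|a u] //= [su] Pu].
  by rewrite mem_cat => /orP[/L1P|/L2P].
have [aN|Na] := ltnP a N.
  have [w wL wu] := L2cov a u aN su Pu; exists w => //.
  by rewrite mem_cat wL orbT.
have [|w wL wu] := Lcov u su; first by exists a.
have [b bN bL] := L1cov w wL; exists (b :: w); first by rewrite mem_cat bL.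
by rewrite /= wu andbT; lia.
Qed.

Lemma dickson n (P : 'X_{1..n} -> Prop) :
  exists2 L : seq 'X_{1..n}, (forall w, w \in L -> P w) &
    forall u, P u -> exists2 w, w \in L & (w <= u)%MM.
Proof.
pose P' (s : seq nat) := exists2 u : 'X_{1..n}, P u & s = u.
have [L LP Lcov] := dickson_seq n P'.
have [L' [L'P L'cov]] : exists L' : seq 'X_{1..n}, (forall w, w \in L' -> P w) /\
    (forall s, s \in L -> exists2 w : 'X_{1..n}, w \in L' & s = w).
  elim: L LP {Lcov} => [|s L IHL] LP; first by exists [::].
  have [u Pu su] := LP s (mem_head _ _).
  have [|L' [L'P L'cov]] := IHL; first by move=> w wL; apply: LP; rewrite inE wL orbT.
  exists (u :: L'); split=> [w|w]; rewrite inE => /orP[/eqP->//|]; first exact: L'P.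
    by exists u; rewrite ?mem_head.
  by move/L'cov=> [v vL ->]; exists v; rewrite // inE vL orbT.
exists L' => // u Pu; have [|s sL su] := Lcov (u : seq nat) (size_tuple _); first by exists u.
have [w wL ew] := L'cov s sL; exists w => //; apply/mnm_lepP => i.
move: su; rewrite ew all2E !size_tuple eqxx /= => /(all_nthP (0, 0)%N) /(_ i).
rewrite size_zip !size_tuple minnn nth_zip ?size_tuple //= -!mnm_nth; exact.
Qed.

Lemma is_lm_uniq n (K : fieldType) (le : rel 'X_{1..n}) (p : {mpoly K[n]}) u v :
  monomial_order le -> is_lm le p u -> is_lm le p v -> u = v.
Proof. by case=> _ anti _ _ _ [pu hu] [pv hv]; apply: anti; rewrite hu // hv. Qed.

(** * Normal forms and reduced Gröbner bases *)

Section InitialIdeal.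
Variables (K : fieldType) (n : nat) (D : eqType) (dg : 'X_{1..n} -> D).
Local Notation poly := {mpoly K[n]}.
Hypothesis dgD : forall u v w, (dg (u + w)%MM == dg (v + w)%MM) = (dg u == dg v).
Hypothesis dg_mdeg : forall u v, dg u = dg v -> mdeg u = mdeg v.

Local Notation I := (@binomial_ideal K n D dg).

Lemma binomialI u v : dg u = dg v -> I ('X_[u] - 'X_[v]).
Proof. by move=> uv; apply: ideal_gen_in; exists u, v. Qed.

Section NormalForm.
Variable le : rel 'X_{1..n}.
Hypothesis le_order : monomial_order le.

Let le_total : total le. Proof. by case: le_order. Qed.
Let le_anti u v : le u v -> le v u -> u = v.
Proof. by case: le_order => _ anti _ _ _ h1 h2; apply: anti; rewrite h1. Qed.
Let le_trans : ssrbool.transitive le. Proof. by case: le_order. Qed.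
Let le_refl : reflexive le. Proof. by move=> u; have := le_total u u; rewrite orbb. Qed.
Let le_add u v w : le u v -> le (u + w)%MM (v + w)%MM.
Proof. by case: le_order => _ _ _ _; exact. Qed.

Lemma lem_monomial_order u v : (u <= v)%MM -> le u v.
Proof.
move=> uv; rewrite -(submK uv) -{1}[u]add0m; apply: le_add.
by case: le_order => _ _ _ h _; exact: h.
Qed.

(** The least monomial of the fibre of [u]; fibres are finite because they
    have constant degree. *)
Definition nf (u : 'X_{1..n}) : 'X_{1..n} :=
  val (extremum le (BMultinom (ltnSn (mdeg u)))
    (fun v : 'X_{1..n < (mdeg u).+1} => dg v == dg u) val).

Lemma nf_spec u : dg (nf u) = dg u /\ forall v, dg v = dg u -> le (nf u) v.
Proof.
rewrite /nf; case: extremumP => //= [i /eqP di mini]; split=> // v dv.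
have lt_v : (mdeg v < (mdeg u).+1)%N by rewrite (dg_mdeg dv).
by apply: (mini (BMultinom lt_v)); rewrite /= dv.
Qed.

Lemma dg_nf u : dg (nf u) = dg u. Proof. by case: (nf_spec u). Qed.

Lemma nf_le u v : dg v = dg u -> le (nf u) v. Proof. by case: (nf_spec u) => _; exact. Qed.

Lemma eq_nf u v : dg u = dg v -> nf u = nf v.
Proof. by move=> uv; apply: le_anti; apply: nf_le; rewrite dg_nf. Qed.

Lemma nf_addl u w : nf u != u -> nf (u + w)%MM != (u + w)%MM.
Proof.
apply: contraNneq => e.
have : le (u + w)%MM (nf u + w)%MM.
  by rewrite -e; apply: nf_le; apply/eqP; rewrite dgD dg_nf.
move=> h; have := le_anti h (le_add w (nf_le (erefl (dg u)))).
by move/addIm => <-.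
Qed.

Lemma nf_lem u v : (u <= v)%MM -> nf u != u -> nf v != v.
Proof. by move=> uv; rewrite -(submK uv) addmC; exact: nf_addl. Qed.

Lemma binomial_lm u : nf u != u -> is_lm le ('X_[u] - 'X_[nf u] : poly) u.
Proof.
move=> nu; split=> [|v].
  by rewrite mcoeff_msupp mcoeffB !mcoeffX eqxx (negPf nu) subr0 oner_eq0.
move/msuppB_le; rewrite mem_cat !msuppX !inE => /orP[/eqP->|/eqP->]; first exact: le_refl.
exact: nf_le.
Qed.

(** A standard leading monomial would be the only monomial of [p] in its fibre,
    and the fibre sum would not vanish. *)
Lemma initial_nonstandard p u : I p -> is_lm le p u -> nf u != u.
Proof.
move=> Ip [pu hu]; apply/eqP => nu.
have := binomial_ideal_fibre_sum dgD (dg u) Ip.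
rewrite /fibre_sum (bigD1_seq u) ?msupp_uniq //= eqxx big1_seq ?addr0 => [/eqP|].
  by rewrite mcoeff_eq0 pu.
move=> m /andP[mu pm]; case: eqP => // dm; case/eqP: mu; apply: le_anti; first exact: hu.
by rewrite -{1}nu; exact: nf_le.
Qed.

Definition min_nonstd u :=
  (nf u != u) && [forall i, (u i != 0%N) ==> (nf (u - U_(i))%MM == (u - U_(i))%MM)].

Lemma min_nonstd_lem u w : min_nonstd u -> (w <= u)%MM -> nf w != w -> w = u.
Proof.
case/andP => _ /forallP mu wu nw; apply/mnmP => i; apply/eqP; apply: contraT => ne.
have lt_i : (w i < u i)%N by rewrite ltn_neqAle ne (mnm_lepP wu).
have /implyP std := mu i; suff wu' : (w <= u - U_(i))%MM.
  have /eqP std' : nf (u - U_(i))%MM == (u - U_(i))%MM by apply: std; lia.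
  by have := nf_lem wu' nw; rewrite std' eqxx.
apply/mnm_lepP => j; rewrite mnmBE mnm1E; case: eqP => [<-|_]; first by lia.
by rewrite subn0 (mnm_lepP wu).
Qed.

Lemma min_nonstd_exists u : nf u != u -> exists2 w, min_nonstd w & (w <= u)%MM.
Proof.
have [k] := ubnP (mdeg u); elim: k u => // k IHk u le_k nu.
case: (boolP (min_nonstd u)) => [mu|]; first by exists u; rewrite ?lepm_refl.
rewrite negb_and nu /= => /forallPn[i]; rewrite negb_imply => /andP[ui nui].
have iu : (U_(i) <= u)%MM by rewrite lep1mP.
have [|w mw wu] := IHk _ _ nui; last by exists w => //; exact: lepm_trans wu (lem_subr _ _).
by move: le_k; rewrite -{1}(submK iu) mdegD mdeg1; lia.
Qed.

Definition binomial_nf u : poly := 'X_[u] - 'X_[nf u].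

(** The binomials of the minimal nonstandard monomials form the reduced
    Gröbner basis; Dickson's lemma makes them finitely many. *)
Lemma min_nonstd_universal u :
  min_nonstd u -> universal_groebner_basis I (binomial_nf u).
Proof.
move=> mu; have [L0 L0P L0cov] := dickson (fun w => nf w != w).
pose L := [seq w <- L0 | min_nonstd w].
have Lcov w : min_nonstd w -> w \in L.
  move=> mw; rewrite mem_filter mw /=; have [|v vL vw] := L0cov w; first by case/andP: mw.
  by rewrite -(min_nonstd_lem mw vw) //; exact: L0P.
have Lmin w : w \in L -> min_nonstd w by rewrite mem_filter => /andP[].
have Lns w : w \in L -> nf w != w by move/Lmin/andP=> [].
exists le, (map binomial_nf L); split=> //; last by rewrite map_f // Lcov.
split; [split| |].
- by move=> g /mapP[w _ ->]; apply: binomialI; rewrite dg_nf.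
- move=> q; split; apply: ideal_gen_sub => _ [p [w [pL pw ->]]].
    case/mapP: pL => v vL ep; apply: ideal_gen_in; exists p, w; split=> //.
    by rewrite ep; apply: binomialI; rewrite dg_nf.
  have [v mv vw] := min_nonstd_exists (initial_nonstandard pL pw).
  rewrite -(submK vw) -mulpX; apply/ideal_genM/ideal_gen_in.
  exists (binomial_nf v), v; split=> //; first by rewrite map_f // Lcov.
  by apply: binomial_lm; case/andP: mv.
- move=> g /mapP[w wL ->]; exists w; first by apply: binomial_lm; exact: Lns.
  by rewrite mcoeffB !mcoeffX eqxx (negPf (Lns _ wL)) subr0.
move=> _ _ u0 v /mapP[w1 w1L ->] /mapP[w2 w2L ->] ne lm2.
rewrite (is_lm_uniq le_order lm2 (binomial_lm (Lns _ w2L))) => {u0 lm2}.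
move/msuppB_le; rewrite mem_cat !msuppX !inE => /orP[/eqP->|/eqP->]; apply/negP => h.
  by case/eqP: ne; rewrite (min_nonstd_lem (Lmin _ w1L) h (Lns _ w2L)).
have := nf_lem h (Lns _ w2L); rewrite (eq_nf (v := w1)) ?eqxx //; exact: dg_nf.
Qed.

End NormalForm.
End InitialIdeal.

(** * Robust ideals generated by quadrics *)

Section WeightOrder.
Variables (n : nat) (F : pred 'I_n).
Implicit Types u v w : 'X_{1..n}.

Definition weight u := (\sum_(i < n | ~~ F i) u i)%N.

(** An elimination order: below a monomial supported on [F] there are only
    monomials supported on [F]. *)
Definition weight_le u v :=
  (weight u < weight v)%N || (weight u == weight v) && (u <= v)%O.

Lemma weightD u v : weight (u + v)%MM = (weight u + weight v)%N.
Proof. by rewrite -big_split /=; apply: eq_bigr => i _; rewrite mnmDE. Qed.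

Lemma weight_eq0P u : reflect (forall i, ~~ F i -> u i = 0%N) (weight u == 0%N).
Proof.
rewrite sum_nat_eq0; apply: (iffP forallP) => h i; last by apply/implyP => /h->.
by move=> nF; have /implyP/(_ nF)/eqP := h i.
Qed.

Lemma weight_monomial_order : monomial_order weight_le.
Proof.
rewrite /weight_le; split.
- by move=> u v; case: ltngtP => //= _; exact: Order.TotalTheory.le_total.
- move=> u v; case: ltngtP => //= _; exact: Order.POrderTheory.le_anti.
- move=> v u w; case: (ltngtP (weight u)) => //= uv; case: (ltngtP (weight v)) => //= vw.
  + by rewrite (ltn_trans uv vw).
  + by rewrite -vw uv.
  + by rewrite uv vw.
  + by rewrite uv vw ltnn eqxx /=; exact: Order.POrderTheory.le_trans.
- move=> u; have -> : weight 0%MM = 0%N by rewrite /weight big1 // => i _; rewrite mnm0E.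
  by rewrite le0m andbT; case: (weight u).
- by move=> u v w; rewrite !weightD ltn_add2r eqn_add2r lemc_add2l.
Qed.

End WeightOrder.

Section RobustQuadrics.
Variables (K : fieldType) (n : nat) (D : eqType) (dg : 'X_{1..n} -> D).
Local Notation poly := {mpoly K[n]}.
Hypothesis dgD : forall u v w, (dg (u + w)%MM == dg (v + w)%MM) = (dg u == dg v).
Hypothesis dg_mdeg : forall u v, dg u = dg v -> mdeg u = mdeg v.
Hypothesis dg_linear : forall u v, mdeg u = 1%N -> dg u = dg v -> u = v.

Local Notation I := (@binomial_ideal K n D dg).
Local Notation UGB := (universal_groebner_basis I).

Lemma quadric_min_nonstd le u : monomial_order le ->
  mdeg u = 2%N -> nf dg le u != u -> min_nonstd dg le u.
Proof.
move=> lo u2 nu; rewrite /min_nonstd nu; apply/forallP => i; apply/implyP => ui.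
have iu : (U_(i) <= u)%MM by rewrite lep1mP.
apply/eqP/esym/dg_linear; last by rewrite (dg_nf dg_mdeg lo).
by move: u2; rewrite -{1}(submK iu) mdegD mdeg1; lia.
Qed.

Lemma eq_binomial (u v a b : 'X_{1..n}) : u != v ->
  'X_[u] - 'X_[v] = 'X_[a] - 'X_[b] :> poly -> u = a \/ u = b.
Proof.
move=> uv /(congr1 (mcoeff u)); rewrite !mcoeffB !mcoeffX eqxx eq_sym (negPf uv) subr0.
case: eqP => [->|_]; first by left.
case: eqP => [->|_]; first by right.
by rewrite subrr => /eqP; rewrite oner_eq0.
Qed.

Section Forward.
Hypothesis robI : robust I.
Hypothesis quadI : generated_by_quadrics I.

(** The quadrics of one reduced Gröbner basis already generate the ideal, so
    by minimality they are all of the universal one. *)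
Lemma universal_quadric le p : monomial_order le -> UGB p ->
  exists u, [/\ mdeg u = 2%N, nf dg le u != u &
    p = 'X_[u] - 'X_[nf dg le u] \/ - p = 'X_[u] - 'X_[nf dg le u]].
Proof.
move=> lo up.
pose S' (q : poly) := exists u, [/\ mdeg u = 2%N, nf dg le u != u & q = 'X_[u] - 'X_[nf dg le u]].
have S'U q : S' q -> UGB q.
  case=> u [u2 nu ->]; apply: (min_nonstd_universal _ dgD dg_mdeg lo).
  exact: quadric_min_nonstd.
have [genU minU] := robI.
have genS' : generates S' I.
  move=> q; split=> [S'q|Iq].
    by apply/genU; apply: ideal_gen_sub S'q => g /S'U; exact: ideal_gen_in.
  have [S [S2 genS]] := quadI; have {Iq} := (genS q).2 Iq.
  apply: ideal_gen_sub => g Sg.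
  have Ig : I g by apply/genS; exact: ideal_gen_in.
  rewrite (mem_binomial_ideal (rep := nf dg le) (dg_nf dg_mdeg lo) (eq_nf dg_mdeg lo)
    (fun a => binomial_ideal_fibre_sum dgD a Ig)).
  apply: ideal_gen_sum => m mg; apply: ideal_genZ.
  have m2 : mdeg m = 2%N by apply: (dhomog_mf (S2 g Sg)).
  case: (eqVneq (nf dg le m) m) => [->|nm]; first by rewrite subrr; exact: ideal_gen0.
  by apply: ideal_gen_in; exists m.
by case: (minU S' S'U genS' p up) => [] [u [u2 nu e]]; exists u; split; auto.
Qed.

(** For an elimination order, the normal form of a monomial supported on [F] is
    supported on [F], and so is the quadric of the reduced basis that divides
    the larger of [u] and [v]. *)
Lemma kernel_quadric (F : pred 'I_n) u v :
  u != v -> dg u = dg v ->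
  (forall i, ~~ F i -> u i = 0%N) -> (forall i, ~~ F i -> v i = 0%N) ->
  exists u' v', [/\ mdeg u' = 2%N, u' != v', dg u' = dg v',
    (forall i, ~~ F i -> u' i = 0%N) & (forall i, ~~ F i -> v' i = 0%N)].
Proof.
have lo := weight_monomial_order F; set le := weight_le F in lo.
wlog nu : u v / nf dg le u != u.
  move=> wl uv duv Fu Fv; case: (eqVneq (nf dg le u) u) => nu; last exact: (wl u v).
  apply: (wl v u) => //; last by rewrite eq_sym.
  by rewrite -(eq_nf dg_mdeg lo duv) nu.
move=> _ _ Fu _; have [w mw wu] := min_nonstd_exists nu.
have nw : nf dg le w != w by case/andP: mw.
have Fw i : ~~ F i -> w i = 0%N.
  by move=> /Fu ui; apply/eqP; rewrite -leqn0 -ui (mnm_lepP wu).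
exists w, (nf dg le w); split=> //; rewrite 1?eq_sym ?(dg_nf dg_mdeg lo) //; last first.
  apply/weight_eq0P; have := nf_le dg_mdeg lo (erefl (dg w)).
  by rewrite /le /weight_le (eqP (introT (weight_eq0P _ _) Fw)); lia.
have [a [a2 na e]] := universal_quadric lo (min_nonstd_universal K dgD dg_mdeg lo mw).
have b2 : mdeg (nf dg le a) = 2%N by rewrite (dg_mdeg (dg_nf dg_mdeg lo a)).
have wn : w != nf dg le w by rewrite eq_sym.
case: e => e; first by case: (eq_binomial wn e) => ->.
rewrite opprB in e; rewrite -(dg_mdeg (dg_nf dg_mdeg lo w)).
by case: (eq_binomial nw e) => ->.
Qed.

(** Three quadrics in one fibre give three binomials of the universal basis,
    only two of which are in a given reduced basis. *)
Lemma no_three_quadrics u v w :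
  u != v -> u != w -> v != w -> dg u = dg v -> dg u = dg w -> mdeg u = 2%N ->
  (forall t, dg t = dg u -> (forall i, u i = 0%N -> t i = 0%N) -> t = u) ->
  (forall t, dg t = dg v -> (forall i, v i = 0%N -> t i = 0%N) -> t = v) -> False.
Proof.
move=> uDv uDw vDw uv uw u2 iso_u iso_v.
have least x t : (forall t, dg t = dg x -> (forall i, x i = 0%N -> t i = 0%N) -> t = x) ->
    dg t = dg x -> nf dg (weight_le [pred i | x i != 0%N]) t = x.
  move=> iso tx; set F := [pred i | x i != 0%N].
  have lo := weight_monomial_order F.
  apply: iso; rewrite ?(dg_nf dg_mdeg lo) // => i xi.
  suff /weight_eq0P h : weight F (nf dg (weight_le F) t) == 0%N by apply: h; rewrite /F /= xi.
  have := nf_le dg_mdeg lo (esym tx).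
  have /eqP : weight F x == 0%N by apply/weight_eq0P => j; rewrite negbK => /eqP.
  by rewrite /weight_le => ->; lia.
set F1 := [pred i | u i != 0%N]; set F2 := [pred i | v i != 0%N].
have lo1 := weight_monomial_order F1; have lo2 := weight_monomial_order F2.
have nf2 : nf dg (weight_le F2) w = v by apply: least; rewrite // -uw.
have mw : min_nonstd dg (weight_le F2) w.
  by apply: quadric_min_nonstd; rewrite ?nf2 // -(dg_mdeg uw).
have [a [_ na e]] := universal_quadric lo1 (min_nonstd_universal K dgD dg_mdeg lo2 mw).
rewrite /binomial_nf nf2 in e.
have nf1 x : dg x = dg u -> x != u -> x != nf dg (weight_le F1) a.
  move=> xu; apply: contraNneq => xa; rewrite xa.
  have {1}-> : nf dg (weight_le F1) a = nf dg (weight_le F1) x.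
    by apply: (eq_nf dg_mdeg lo1); rewrite xa (dg_nf dg_mdeg lo1).
  by apply/eqP/least.
have wDv : w != v by rewrite eq_sym.
rewrite eq_sym in uDv; rewrite eq_sym in uDw.
have nv := nf1 v (esym uv) uDv; have nw := nf1 w (esym uw) uDw.
case: e => e; have {e} e2 := e; last rewrite opprB in e2.
  case: (eq_binomial wDv e2) => h; last by rewrite h eqxx in nw.
  have e3 : 'X_[v] - 'X_[w] = 'X_[nf dg (weight_le F1) a] - 'X_[a] :> poly.
    by rewrite -[LHS]opprB e2 opprB.
  case: (eq_binomial vDw e3) => h'; first by rewrite h' eqxx in nv.
  by rewrite h h' eqxx in wDv.
have e3 : 'X_[w] - 'X_[v] = 'X_[nf dg (weight_le F1) a] - 'X_[a] :> poly.
  by rewrite -[LHS]opprB e2 opprB.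
case: (eq_binomial vDw e2) => h; last by rewrite h eqxx in nv.
case: (eq_binomial wDv e3) => h'; first by rewrite h' eqxx in nw.
by rewrite h h' eqxx in wDv.
Qed.

End Forward.

Section Backward.
Hypothesis quadric_below : forall u v, dg u = dg v -> u != v ->
  (forall i, u i = 0%N \/ v i = 0%N) ->
  exists u' v', [/\ (u' <= u)%MM, (v' <= v)%MM, dg u' = dg v' & mdeg u' = 2%N].
Hypothesis small_fibres : forall u v w, mdeg u = 2%N -> dg u = dg v -> dg u = dg w ->
  u != v -> w = u \/ w = v.

Lemma coprime_parts u v : dg u = dg v -> exists g u0 v0,
  [/\ u = (g + u0)%MM, v = (g + v0)%MM, dg u0 = dg v0 & forall i, u0 i = 0%N \/ v0 i = 0%N].
Proof.
move=> uv; pose g : 'X_{1..n} := [multinom minn (u i) (v i) | i < n].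
have eu : u = (g + (u - g))%MM by apply/mnmP => i; rewrite mnmDE mnmBE mnmE; lia.
have ev : v = (g + (v - g))%MM by apply/mnmP => i; rewrite mnmDE mnmBE mnmE; lia.
exists g, (u - g)%MM, (v - g)%MM; split=> // [|i]; last by rewrite !mnmBE mnmE; lia.
by apply/eqP; rewrite -(dgD _ _ g) !(@addmC n _ g) -eu -ev uv.
Qed.

Lemma dg_sub u u' v v' : (u' <= u)%MM -> (v' <= v)%MM -> dg u = dg v -> dg u' = dg v' ->
  dg (u - u')%MM = dg (v - v')%MM.
Proof.
move=> uu' vv' uv uv'; have /eqP h1 : dg (v - v' + u')%MM == dg (v - v' + v')%MM.
  by rewrite ![(v - v' + _)%MM]addmC dgD uv'.
by apply/eqP; rewrite -(dgD _ _ u') submK // uv h1 submK.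
Qed.

Lemma order_lem_add le (u v w x : 'X_{1..n}) : monomial_order le ->
  le u v -> le w x -> le (u + w)%MM (v + x)%MM.
Proof.
case=> _ _ tr _ add uv wx; apply: (tr (v + w)%MM); first exact: add.
by rewrite ![(v + _)%MM](@addmC n v); exact: add.
Qed.

(** A quadric below a pair [v < u] is either decreasing, or can be removed
    and leaves a smaller decreasing pair. *)
Lemma nonstd_quadric le u : monomial_order le -> nf dg le u != u ->
  exists u', [/\ (u' <= u)%MM, mdeg u' = 2%N & nf dg le u' != u'].
Proof.
move=> lo nu; have [tot anti _ _ add] := lo.
have {nu} : exists v, [/\ dg u = dg v, u != v & le v u].
  exists (nf dg le u); rewrite eq_sym (dg_nf dg_mdeg lo); split=> //.
  exact: (nf_le dg_mdeg lo).
case=> v []; have [k] := ubnP (mdeg u); elim: k u v => // k IHk u v le_k.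
move=> /coprime_parts[g [u0 [v0 [eu0 ev0 uv dis]]]].
rewrite {}eu0 {}ev0 in le_k *; rewrite eqm_add2l => uDv vu.
have {}vu : le v0 u0.
  case/orP: (tot v0 u0) => // uv0; have h := add _ _ g uv0.
  rewrite !(@addmC n _ g) in h; have /addmI e := anti _ _ (introT andP (conj h vu)).
  by rewrite e eqxx in uDv.
have [u' [v' [uu' vv' uv' u2]]] := quadric_below uv uDv dis.
case/orP: (tot v' u') => [vu'|vu'].
  exists u'; split=> //; first exact: lepm_trans uu' (lem_addl _ _).
  apply/eqP => nu'.
  have e : u' = v' by apply: anti; rewrite vu' -{1}nu' (nf_le dg_mdeg lo).
  suff u'0 : u' = 0%MM by rewrite u'0 mdeg0 in u2.
  apply/mnmP => i; rewrite mnm0E; apply/eqP; rewrite -leqn0.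
  by case: (dis i) => <-; rewrite ?(mnm_lepP uu') // e (mnm_lepP vv').
have eu := submK uu'; have ev := submK vv'.
have dg_rest := dg_sub uu' vv' uv uv'.
have [||||u'' [h1 h2 h3]] := IHk (u0 - u')%MM (v0 - v')%MM.
- by have := mdegD (u0 - u')%MM u'; rewrite eu u2; move: le_k; rewrite mdegD; lia.
- exact: dg_rest.
- apply: contraNneq uDv => e.
  have r0 : (u0 - u')%MM = 0%MM.
    apply/mnmP => i; rewrite mnm0E; case: (dis i) => z; last rewrite e.
      by rewrite mnmBE z.
    by rewrite mnmBE z.
  have u'u0 : u' = u0 by rewrite -eu r0 add0m.
  have v'v0 : v' = v0 by rewrite -ev -e r0 add0m.
  by apply/eqP/anti; rewrite -{1}u'u0 -{1}v'v0 vu' vu.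
- case/orP: (tot (v0 - v')%MM (u0 - u')%MM) => // h.
  have := order_lem_add lo h vu'; rewrite eu ev => {}h.
  by rewrite (anti _ _ (introT andP (conj h vu))) eqxx in uDv.
exists u''; split=> //; apply: lepm_trans h1 _; apply: lepm_trans (lem_subr _ _) _.
exact: lem_addl.
Qed.

Lemma ideal_gen_coeff (S : poly -> Prop) p u : ideal_gen S p -> p@_u != 0 ->
  exists g x, [/\ S g, x \in msupp g & (x <= u)%MM].
Proof.
move=> [k [c [g [Sg ->]]]]; rewrite raddf_sum /= => ne.
have [i] : exists i, (c i * g i)@_u != 0.
  apply/existsP; apply: contraNT ne => /existsPn h; rewrite big1 // => i _.
  by apply/eqP; have := h i; rewrite negbK.
rewrite -mcoeff_msupp => /msuppM_le /allpairsP[[x y] /= [_ yg ->]].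
by exists (g i), y; split=> //; exact: lem_addl.
Qed.

Lemma monomial_ideal_dvd (W : 'X_{1..n} -> Prop) (S : poly -> Prop) u :
  (forall q, S q -> exists2 w, W w & q = 'X_[w]) -> ideal_gen S ('X_[u] : poly) ->
  exists2 w, W w & (w <= u)%MM.
Proof.
move=> SW uS; have [|g [x [Sg xg xu]]] := ideal_gen_coeff (u := u) uS.
  by rewrite mcoeffX eqxx oner_eq0.
by have [w Ww eg] := SW g Sg; exists w => //; move: xg xu; rewrite eg msuppX inE => /eqP->.
Qed.

(** A leading monomial is divisible by a nonstandard quadric and, in a reduced
    basis, by no other leading monomial; it is therefore quadratic. *)
Lemma universal_is_quadric p : UGB p ->
  exists u v, [/\ dg u = dg v, mdeg u = 2%N, u != v & p = 'X_[u] - 'X_[v]].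
Proof.
case=> le [B [lo [[BI genB] monic red] pB]].
have [u [lmu1 lmu2] pu1] := monic p pB; have lmu : is_lm le p u by [].
have nonstd m : nf dg le m != m -> exists h w, [/\ h \in B, is_lm le h w, (w <= m)%MM & mdeg w = 2%N].
  move=> nm; have [m' [m'm m'2 nm']] := nonstd_quadric lo nm.
  have [||w [h hB lmh] wm'] := @monomial_ideal_dvd (fun w => exists2 h, h \in B & is_lm le h w) _ m' _ ((genB _).2 _).
  - by move=> q [g [w [gB lmg ->]]]; exists w => //; exists g.
  - apply: ideal_gen_in; exists (binomial_nf K dg le m'), m'; split=> //.
      by apply: binomialI; rewrite (dg_nf dg_mdeg lo).
    exact: (binomial_lm _ dg_mdeg lo nm').
  exists h, w; split=> //; first exact: lepm_trans wm' m'm.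
  suff -> : w = m' by [].
  have nw := initial_nonstandard dgD dg_mdeg lo (BI h hB) lmh.
  apply: (min_nonstd_lem dgD dg_mdeg lo) => //; exact: quadric_min_nonstd.
have nu := initial_nonstandard dgD dg_mdeg lo (BI p pB) lmu.
have [h [w [hB lmh wu w2]]] := nonstd u nu.
have hp : h = p.
  by apply/eqP; apply: contraTT wu => hp; apply: (red p h w u) => //; rewrite eq_sym.
have u2 : mdeg u = 2%N by rewrite -w2; congr mdeg; apply: (is_lm_uniq lo lmu); rewrite -hp.
have std m : m \in msupp p -> m != u -> nf dg le m = m.
  move=> mp mu; apply/eqP; apply: contraT => nm.
  have [g [w' [gB lmg w'm w'2]]] := nonstd m nm.
  have gp : g = p.
    by apply/eqP; apply: contraTT w'm => gp; apply: (red p g w' m) => //; rewrite eq_sym.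
  have w'u : w' = u by apply: (is_lm_uniq lo _ lmu); rewrite -gp.
  have [_ anti _ _ _] := lo.
  by case/eqP: mu; apply: anti; rewrite lmu2 //= (lem_monomial_order lo) // -w'u.
exists u, (nf dg le u); rewrite (dg_nf dg_mdeg lo) eq_sym nu; split=> //.
apply/eqP; rewrite -subr_eq0; set q := _ - _.
have qI : I q.
  apply: ideal_genD; first exact: BI.
  by apply: ideal_genN; apply: binomialI; rewrite (dg_nf dg_mdeg lo).
have stdq m : m \in msupp q -> nf dg le m = m.
  case: (eqVneq m u) => [->|mu].
    by rewrite mcoeff_msupp /q !mcoeffB pu1 !mcoeffX eqxx (negPf nu) subr0 subrr eqxx.
  move/msuppB_le; rewrite mem_cat => /orP[mp|]; first exact: std.
  move/msuppB_le; rewrite mem_cat !msuppX !inE (negPf mu) /= => /eqP->.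
  by apply: (eq_nf dg_mdeg lo); rewrite (dg_nf dg_mdeg lo).
apply/eqP/mpolyP => m; rewrite mcoeff0; apply/eqP; apply: contraT; rewrite -mcoeff_msupp => mq.
have := binomial_ideal_fibre_sum dgD (dg m) qI.
rewrite /fibre_sum (bigD1_seq m) ?msupp_uniq //= eqxx big1_seq ?addr0 => [/eqP|].
  by rewrite mcoeff_eq0 mq.
move=> m' /andP[mm' m'q]; case: eqP => // dm; case/eqP: mm'.
by rewrite -(stdq m' m'q) -(stdq m mq); exact: (eq_nf dg_mdeg lo).
Qed.

Lemma generic_order : monomial_order (weight_le (@predT 'I_n)).
Proof. exact: weight_monomial_order. Qed.

Lemma quadric_universal u v : mdeg u = 2%N -> dg u = dg v -> ideal_gen UGB ('X_[u] - 'X_[v] : poly).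
Proof.
move=> u2 uv; have lo := generic_order; set le := weight_le _ in lo.
have v2 : mdeg v = 2%N by rewrite -(dg_mdeg uv).
case: (eqVneq u v) => [->|nuv]; first by rewrite subrr; exact: ideal_gen0.
have key x y : dg x = dg y -> x != y -> mdeg x = 2%N -> nf dg le x != x ->
    ideal_gen UGB ('X_[x] - 'X_[y] : poly).
  move=> xy nxy x2 nx; have [e|<-] := small_fibres x2 xy (esym (dg_nf dg_mdeg lo x)) nxy.
    by rewrite e eqxx in nx.
  apply: ideal_gen_in; apply: (min_nonstd_universal _ dgD dg_mdeg lo).
  exact: quadric_min_nonstd.
case: (eqVneq (nf dg le u) u) => nu; last exact: key.
rewrite -opprB; apply: ideal_genN; apply: key => //; rewrite 1?eq_sym //.
by rewrite -(eq_nf dg_mdeg lo uv) nu eq_sym.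
Qed.

Lemma binomial_universal u v : dg u = dg v -> ideal_gen UGB ('X_[u] - 'X_[v] : poly).
Proof.
have [k] := ubnP (mdeg u); elim: k u v => // k IHk u v le_k.
case: (eqVneq u v) => [-> _|uDv]; first by rewrite subrr; exact: ideal_gen0.
move=> /coprime_parts[g [u0 [v0 [eu0 ev0 uv dis]]]].
rewrite {}eu0 {}ev0 in le_k uDv *; rewrite eqm_add2l in uDv.
rewrite -!mulpX -mulrBr; apply: ideal_genM.
have [u' [v' [uu' vv' uv' u2]]] := quadric_below uv uDv dis.
have eu := submK uu'; have ev := submK vv'.
have dg_rest := dg_sub uu' vv' uv uv'.
have -> : 'X_[u0] - 'X_[v0] = 'X_[u0 - u'] * ('X_[u'] - 'X_[v']) +
    'X_[v'] * ('X_[u0 - u'] - 'X_[v0 - v']) :> poly.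
  by rewrite !mulrBr !mulpX eu [(v' + (v0 - v'))%MM]addmC ev [(v' + _)%MM]addmC; ring.
apply: ideal_genD; apply: ideal_genM; first exact: quadric_universal.
apply: IHk => //.
by have := mdegD (u0 - u')%MM u'; rewrite eu u2; move: le_k; rewrite mdegD; lia.
Qed.

Lemma universal_generates : generates UGB I.
Proof.
move=> p; split; apply: ideal_gen_sub => q; last by case=> u [v [uv ->]]; exact: binomial_universal.
by case=> le [B [_ [[BI _] _ _] qB]]; exact: BI.
Qed.

(** The monomials of a quadric of the universal basis are the whole fibre, so a
    generating subset must contain it up to sign. *)
Lemma robust_quadratic : robust I /\ generated_by_quadrics I.
Proof.
split; last first.
  exists UGB; split; last exact: universal_generates.
  move=> p /universal_is_quadric[u [v [uv u2 _ ->]]].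
  by apply: rpredB; rewrite dhomogX /= -?(dg_mdeg uv) u2.
split; first exact: universal_generates.
move=> S' S'U genS' p Up; have [u [v [uv u2 nuv ep]]] := universal_is_quadric Up.
have S'p : ideal_gen S' p by apply/genS'; rewrite ep; exact: binomialI.
have [|g [x [Sg xg xu]]] := ideal_gen_coeff (u := u) S'p.
  by rewrite ep mcoeffB !mcoeffX eqxx (eq_sym v) (negPf nuv) subr0 oner_eq0.
have [a [b [ab a2 nab eg]]] := universal_is_quadric (S'U g Sg).
have b2 : mdeg b = 2%N by rewrite -(dg_mdeg ab).
have xE : x = u.
  have x2 : mdeg x = 2%N.
    by move: xg; rewrite eg => /msuppB_le; rewrite mem_cat !msuppX !inE => /orP[]/eqP->.
  have := mdegD (u - x)%MM x; rewrite submK // u2 x2 => h.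
  have /eqP : mdeg (u - x) = 0%N by lia.
  by rewrite mdeg_eq0 => /eqP r; rewrite -(submK xu) r add0m.
move: xg; rewrite {}xE eg => /msuppB_le; rewrite mem_cat !msuppX !inE.
have nu w : w != u -> dg u = dg w -> w = v.
  by move=> wu uw; case: (small_fibres u2 uv uw nuv) => // e; rewrite e eqxx in wu.
case/orP => /eqP e; subst.
  by left; rewrite -(nu b) // -?eg // eq_sym.
by right; rewrite opprB -(nu a) // -?eg.
Qed.

End Backward.
End RobustQuadrics.

End BinomialIdeals.

(** * Toric ideals of graphs *)

Section Adjacency.
Variables (T : finType) (G : sgraph T).

Lemma adj_sym : ssrbool.symmetric (adj G).
Proof. by move=> x y; rewrite /adj /= setUC. Qed.

Lemma adj_irr : irreflexive (adj G).
Proof.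
move=> x; apply/negP => h; have /andP[_] := forall_inP (sgraph_valP G) _ h.
by rewrite setUid cards1.
Qed.

Lemma edge_card2 E : E \in eset G -> exists x y, x != y /\ E = [set x; y].
Proof.
move=> EG; have /andP[_ /cards2P[x [y [xy ->]]]] := forall_inP (sgraph_valP G) _ EG.
by exists x, y.
Qed.

Lemma edge_sub E : E \in eset G -> E \subset vset G.
Proof. by move=> EG; have /andP[] := forall_inP (sgraph_valP G) _ EG. Qed.

Lemma adj_vset x y : adj G x y -> (x \in vset G) && (y \in vset G).
Proof. by move/edge_sub; rewrite subUset !sub1set. Qed.

End Adjacency.

Section ToricGraph.
Variables (K : fieldType) (T : finType) (G : sgraph T).
Local Notation n := #|eset G|.
Local Notation ed i := (enum_val i : {set T}).
Implicit Types (u v w : 'X_{1..n}) (i j k l : 'I_n).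

Lemma degAE u x : degA u x = \sum_(i | x \in ed i) u i.
Proof.
rewrite /degA sum_ffunE [RHS]big_mkcond /=; apply: eq_bigr => i _.
rewrite ffunMnE /edge_vec sum_ffunE.
under eq_bigr do rewrite ffunE.
case: ifP => xi; last first.
  rewrite big1 ?GRing.mul0rn // => y yi.
  by case: eqP => // xy; rewrite -xy xi in yi.
rewrite (bigD1 x) //= eqxx big1; first by rewrite GRing.addr0 natn.
by move=> y /andP[_ /negPf]; rewrite eq_sym => ->.
Qed.

Lemma degA1 i x : degA U_(i)%MM x = (x \in ed i) :> nat.
Proof.
rewrite degAE big_mkcond (bigD1 i) //= mnm1E eqxx big1 ?addn0; first by case: ifP.
by move=> j /negPf ji; rewrite mnm1E eq_sym ji if_same.
Qed.

Lemma degAD u v x : degA (u + v)%MM x = degA u x + degA v x.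
Proof. by rewrite !degAE -big_split /=; apply: eq_bigr => i _; rewrite mnmDE. Qed.

Lemma eq_degA u v : (forall x, degA u x = degA v x) -> degA u = degA v.
Proof. by move=> h; apply/ffunP. Qed.

Lemma degA_addr u v w : (degA (u + w)%MM == degA (v + w)%MM) = (degA u == degA v).
Proof.
apply/eqP/eqP => /ffunP h; apply: eq_degA => x; have := h x; rewrite !degAD; last by move=> ->.
by move/addIn.
Qed.

Lemma degA_mdeg u v : degA u = degA v -> mdeg u = mdeg v.
Proof.
suff sum2 w : \sum_x degA w x = (mdeg w).*2.
  by move=> uv; apply: double_inj; rewrite -!sum2 uv.
rewrite mdegE -mul2n big_distrr /=.
under eq_bigr do rewrite degAE big_mkcond.
rewrite exchange_big /=; apply: eq_bigr => i _.
rewrite -big_mkcond sum_nat_const.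
by have [x [y [xy ->]]] := edge_card2 (enum_valP i); rewrite cards2 xy.
Qed.

Lemma mdeg1_U u : mdeg u = 1 -> exists i, u = U_(i)%MM.
Proof. by move/eqP/mdeg1P => [i /eqP->]; exists i. Qed.

Lemma degA_linear u v : mdeg u = 1 -> degA u = degA v -> u = v.
Proof.
move=> u1 uv; have [|j vj] := @mdeg1_U v; first by rewrite -(degA_mdeg uv).
have [i ui] := mdeg1_U u1; rewrite {}ui {}vj in uv *.
congr mnm1; apply: enum_val_inj; apply/setP => x.
by move/ffunP: uv => /(_ x); rewrite !degA1; do 2!case: (_ \in _).
Qed.

Lemma mdeg2_UU u : mdeg u = 2 -> exists i j, u = (U_(i) + U_(j))%MM.
Proof.
move=> u2; have /existsP[i ui] : [exists i, u i != 0].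
  apply: contraT => /existsPn h; have : mdeg u = 0; last by rewrite u2.
  by rewrite mdegE big1 // => i _; apply/eqP; have := h i; rewrite negbK.
have iu : (U_(i) <= u)%MM by rewrite lep1mP.
have [|j uj] := @mdeg1_U (u - U_(i))%MM.
  by have := mdegD (u - U_(i))%MM U_(i)%MM; rewrite submK // mdeg1 u2; lia.
by exists j, i; rewrite -uj submK.
Qed.

Lemma cancel_edge i j k u :
  degA (U_(i) + U_(j))%MM = degA (U_(i) + U_(k))%MM -> j = k.
Proof.
move=> h; have /eqP h' : degA U_(j)%MM == degA U_(k)%MM.
  by rewrite -(degA_addr _ _ U_(i)) ![(_ + U_(i))%MM]addmC h.
by apply/eqP; rewrite -eq_mnm1; apply/eqP/degA_linear; rewrite ?mdeg1.
Qed.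

(** Neither edge of the second monomial can be an edge of the first one, for
    the other edges would then agree too; hence an edge at [t] leads to a vertex
    of the opposite edge, and the edge at [s] leads to the remaining one. *)
Lemma quadric_square i j k l :
  degA (U_(i) + U_(j))%MM = degA (U_(k) + U_(l))%MM ->
  (U_(i) + U_(j))%MM != (U_(k) + U_(l))%MM ->
  exists s t q r, uniq [:: s; t; q; r] /\
    [/\ ed i = [set s; t], ed j = [set q; r] &
     (ed k = [set t; q] /\ ed l = [set r; s]) \/ (ed l = [set t; q] /\ ed k = [set r; s])].
Proof.
move=> dg ne.
have [s [t [st ei]]] := edge_card2 (enum_valP i).
have deg x : (x \in ed i) + (x \in ed j) = (x \in ed k) + (x \in ed l).
  by have /ffunP/(_ x) := dg; rewrite !degAD !degA1.
have ik : i != k.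
  by apply: contraNneq ne => e; subst k; rewrite (cancel_edge 0%MM dg).
have il : i != l.
  apply: contraNneq ne => e; subst l; rewrite [(U_(k) + _)%MM]addmC in dg *.
  by rewrite (cancel_edge 0%MM dg).
wlog tk : k l dg ne deg ik il / t \in ed k.
  move=> wl; case: (boolP (t \in ed k)) => [tk|tk]; first exact: (wl k l).
  have tl : t \in ed l.
    have := deg t; rewrite ei set22 (negPf tk); by case: (t \in ed l).
  have [|||s' [t' [q' [r' [un [h1 h2 h3]]]]]] := wl l k _ _ _ il ik tl.
  - by rewrite dg addmC.
  - by rewrite [X in _ != X]addmC.
  - by move=> x; rewrite deg addnC.
  by exists s', t', q', r'; split=> //; split=> //; case: h3; auto.
have [a [b [ab ek]]] := edge_card2 (enum_valP k).
have [q tq kE] : exists2 q, t != q & ed k = [set t; q].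
  move: tk; rewrite ek !inE => /orP[]/eqP->; first by exists b.
  by exists a; rewrite 1?eq_sym // setUC.
have sk : s \notin ed k.
  apply: contra ik => sk; apply/eqP/enum_val_inj.
  rewrite ei kE; move: sk; rewrite kE !inE (negPf st) /= => /eqP->.
  by rewrite setUC.
have sl : s \in ed l.
  have := deg s; rewrite ei set21 (negPf sk); by case: (s \in ed l).
have [c [d [cd el]]] := edge_card2 (enum_valP l).
have [r rs lE] : exists2 r, r != s & ed l = [set r; s].
  move: sl; rewrite el !inE => /orP[]/eqP->; last by exists c.
  by exists d; rewrite 1?eq_sym // setUC.
have sq : s != q by apply: contraNneq sk => ->; rewrite kE set22.
have tr : t != r.
  apply: contraNneq il => e; apply/eqP/enum_val_inj; rewrite ei lE e.
  by rewrite setUC.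
have qr : q != r.
  apply/eqP => e; have := deg q; rewrite kE lE ei !inE eqxx e eqxx orbT.
  by rewrite -e eq_sym (negPf sq) eq_sym (negPf tq); case: (q \in _).
exists s, t, q, r; split.
  by rewrite /= !inE !negb_or st sq tr tq qr eq_sym rs.
split=> //; last by left.
have qj : q \in ed j.
  have := deg q; rewrite kE ei !inE eqxx orbT (eq_sym q s) (negPf sq) (eq_sym q t) (negPf tq).
  by case: (q \in ed j).
have rj : r \in ed j.
  have := deg r; rewrite lE ei !inE eqxx (eq_sym r t) (negPf tr) (negPf rs).
  by case: (r \in ed j) => //; case: (_ \in _).
have [a' [b' [ab' ej]]] := edge_card2 (enum_valP j).
by apply/esym/eqP; rewrite eqEcard subUset !sub1set qj rj ej !cards2 ab' qr.
Qed.

Lemma adj_enum i x y : ed i = [set x; y] -> adj G x y.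
Proof. by move=> ei; rewrite /adj /= -ei enum_valP. Qed.

Lemma edge_index x y : adj G x y -> exists i, ed i = [set x; y].
Proof.
move=> xy; have xy' : [set x; y] \in eset G by exact: xy.
by exists (enum_rank_in xy' [set x; y]); rewrite enum_rankK_in.
Qed.

(** This makes the quadric the least monomial of its fibre for the order that
    eliminates the other edges. *)
Lemma disjoint_pair_isolated i j : i != j -> [disjoint ed i & ed j] ->
  forall t, degA t = degA (U_(i) + U_(j))%MM ->
  (forall k, (U_(i) + U_(j))%MM k = 0 -> t k = 0) -> t = (U_(i) + U_(j))%MM.
Proof.
move=> ij dis t dt supp.
have supp' k : k != i -> k != j -> t k = 0.
  by move=> ki kj; apply: supp; rewrite mnmDE !mnm1E eq_sym (negPf ki) eq_sym (negPf kj).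
have val a b : a != b -> [disjoint ed a & ed b] -> (forall k, k != a -> k != b -> t k = 0) ->
    degA t = degA (U_(a) + U_(b))%MM -> t a = 1.
  move=> ab dab sup dt'; have [x [y [xy ea]]] := edge_card2 (enum_valP a).
  have xa : x \in ed a by rewrite ea set21.
  have xb : x \in ed b = false.
    by apply/negP => xb; have := disjointFr dab xa; rewrite xb.
  have /ffunP/(_ x) := dt'; rewrite degAD !degA1 xa xb degAE (bigD1 a) //= big1 ?addn0 //.
  move=> k /andP[xk ka]; apply: sup => //; apply: contraTneq xk => ->; by rewrite xb.
have ti := val i j ij dis supp' dt.
have tj : t j = 1.
  apply: (val j i); rewrite 1?eq_sym // 1?disjoint_sym // 1?addmC // => k ki kj.
  exact: supp'.
apply/mnmP => k; rewrite mnmDE !mnm1E; case: (eqVneq i k) => [<-|ik].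
  by rewrite ti eq_sym (negPf ij).
case: (eqVneq j k) => [<-|jk]; first by rewrite tj.
by rewrite supp' // eq_sym.
Qed.

Section Forward.
Hypothesis robI : robust (toric_ideal K G).
Hypothesis quadI : generated_by_quadrics (toric_ideal K G).

(** The three perfect matchings of a 4-clique are quadrics of one fibre. *)
Lemma robust_no_K4 a b c d :
  ~~ [&& adj G a b, adj G a c, adj G a d, adj G b c, adj G b d & adj G c d].
Proof.
apply/negP => /and5P[ab ac ad bc /andP[bd cd]].
have ne x y : adj G x y -> x != y by apply: contraTneq => ->; rewrite adj_irr.
have [[iab Eab] [icd Ecd]] := (edge_index ab, edge_index cd).
have [[iac Eac] [ibd Ebd]] := (edge_index ac, edge_index bd).
have [[iad Ead] [ibc Ebc]] := (edge_index ad, edge_index bc).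
have dis x y z t : x != z -> x != t -> y != z -> y != t -> [disjoint [set x; y] & [set z; t]].
  move=> h1 h2 h3 h4; rewrite disjoint_subset; apply/subsetP => w; rewrite !inE.
  by case/orP => /eqP->; rewrite negb_or ?h1 ?h2 ?h3 ?h4.
have nab := ne _ _ ab; have nac := ne _ _ ac; have nad := ne _ _ ad.
have nbc := ne _ _ bc; have nbd := ne _ _ bd; have ncd := ne _ _ cd.
have neqi i j x y z t : ed i = [set x; y] -> ed j = [set z; t] -> x != z -> x != t -> i != j.
  move=> ei ej h1 h2; apply/eqP => e; have := set21 x y.
  by rewrite -ei e ej !inE (negPf h1) (negPf h2).
have deg i j i' j' : (forall x, (x \in ed i) + (x \in ed j) = (x \in ed i') + (x \in ed j')) ->
    degA (U_(i) + U_(j))%MM = degA (U_(i') + U_(j'))%MM.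
  by move=> h; apply: eq_degA => x; rewrite !degAD !degA1 h.
have in2 x y z : x != y -> (z \in [set x; y]) = (z == x) + (z == y) :> nat.
  by move=> xy; rewrite !inE; case: (eqVneq z x) => [->|_] //=; rewrite (negPf xy).
have d1 : degA (U_(iab) + U_(icd))%MM = degA (U_(iac) + U_(ibd))%MM.
  by apply: deg => x; rewrite Eab Ecd Eac Ebd !in2 // addnACA.
have d2 : degA (U_(iab) + U_(icd))%MM = degA (U_(iad) + U_(ibc))%MM.
  by apply: deg => x; rewrite Eab Ecd Ead Ebc !in2 // [(x == c) + _]addnC addnACA.
have neqU i j k l : i != k -> i != l -> (U_(i) + U_(j))%MM != (U_(k) + U_(l))%MM.
  move=> ik il; apply/eqP => /mnmP/(_ i); rewrite !mnmDE !mnm1E eqxx.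
  by rewrite (eq_sym k) (negPf ik) (eq_sym l) (negPf il).
have tD i j : mdeg (U_(i) + U_(j))%MM = 2 by rewrite mdegD !mdeg1.
apply: (@no_three_quadrics K _ _ (@degA T G) degA_addr degA_mdeg degA_linear robI quadI
  (U_(iab) + U_(icd))%MM (U_(iac) + U_(ibd))%MM (U_(iad) + U_(ibc))%MM) => //.
- apply: neqU; last exact: neqi Eab Ebd _ _.
  by rewrite setUC in Eab; apply: neqi Eab Eac _ _; rewrite // eq_sym.
- apply: neqU; last exact: neqi Eab Ebc _ _.
  by rewrite setUC in Eab; apply: neqi Eab Ead _ _; rewrite // eq_sym.
- apply: neqU; last exact: neqi Eac Ebc _ _.
  by rewrite setUC in Eac; apply: neqi Eac Ead _ _; rewrite // eq_sym.
- by apply: disjoint_pair_isolated; [exact: neqi Eab Ecd _ _|rewrite Eab Ecd; exact: dis].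
- apply: disjoint_pair_isolated; first exact: neqi Eac Ebd _ _.
  by rewrite Eac Ebd; apply: dis; rewrite // eq_sym.
Qed.

(** The positive and the negative part of [y] are exponents of two monomials of
    one fibre. *)
Lemma robust_kernel_square (y : {set T} -> int) :
  (forall E, y E != 0%R -> exists a b, adj G a b /\ E = [set a; b]) ->
  balanced y -> (exists E, y E != 0%R) ->
  exists s t q r, square_in y s t q r.
Proof.
move=> supp bal [E0 yE0].
pose pos (z : int) : nat := if z is Posz m then m else 0.
pose u : 'X_{1..n} := [multinom pos (y (ed i)) | i < n].
pose v : 'X_{1..n} := [multinom pos (- y (ed i))%R | i < n].
have uvE i : ((u i)%:Z - (v i)%:Z)%R = y (ed i).
  by rewrite !mnmE; case: (y (ed i)) => m /=; rewrite /pos; case: m => //=; lia.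
have dg : degA u = degA v.
  apply: eq_degA => x; apply/eqP; rewrite -eqz_nat -GRing.subr_eq0 !degAE.
  rewrite !(big_morph Posz PoszD (erefl _)) -GRing.sumrB.
  under eq_bigr do rewrite uvE.
  apply/eqP; rewrite -[RHS](bal x) -(big_enum_val_cond (fun E : {set T} => x \in E) y) /=.
  rewrite big_mkcondl; apply: eq_bigr => E _; case: ifP => // /negP nE.
  apply/esym/eqP; apply: contraT => /supp[a [b [ab e]]]; case: nE; rewrite e.
  exact: ab.
have [i0 ei0] : exists i, ed i = E0.
  by have [a [b [ab ->]]] := supp _ yE0; exact: edge_index.
have uDv : u != v.
  by apply/eqP => e; move: yE0; rewrite -ei0 -uvE e GRing.subrr eqxx.
pose F i := y (ed i) != 0%R.
have Fu i : ~~ F i -> u i = 0 by rewrite negbK => /eqP h; rewrite mnmE h.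
have Fv i : ~~ F i -> v i = 0 by rewrite negbK => /eqP h; rewrite mnmE h.
have [u' [v' [u2 ne dg' Fu' Fv']]] :=
  kernel_quadric degA_addr degA_mdeg degA_linear robI quadI uDv dg Fu Fv.
have [i [j eu]] := mdeg2_UU u2.
have [k [l ev]] := mdeg2_UU (esym (etrans (esym u2) (degA_mdeg dg'))).
rewrite {}eu {}ev in ne dg' Fu' Fv' {u2}.
have [s [t [q [r [un [ei ej ekl]]]]]] := quadric_square dg' ne.
have inF b (z : 'X_{1..n}) : (forall i, ~~ F i -> z i = 0) -> z b != 0 -> y (ed b) != 0%R.
  by move=> h; apply: contraNneq => ya; rewrite h // /F ya eqxx.
have Ui a b c : (a == c) || (b == c) -> (U_(a) + U_(b))%MM c != 0.
  by rewrite mnmDE !mnm1E; case: eqP => //= _ ->.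
have yi : y (ed i) != 0%R by apply: (inF _ _ Fu'); rewrite Ui ?eqxx.
have yj : y (ed j) != 0%R by apply: (inF _ _ Fu'); rewrite Ui ?eqxx ?orbT.
have yk : y (ed k) != 0%R by apply: (inF _ _ Fv'); rewrite Ui ?eqxx.
have yl : y (ed l) != 0%R by apply: (inF _ _ Fv'); rewrite Ui ?eqxx ?orbT.
exists s, t, q, r; rewrite ei in yi; rewrite ej in yj; split=> //.
  by case: ekl => -[h _]; rewrite -h.
by case: ekl => -[_ h]; rewrite -h.
Qed.

End Forward.

Section Backward.
Hypothesis even4 : forall c, cycle (adj G) c -> uniq c -> ~~ odd (size c) -> size c <= 4.
Variables (a : T) (f : T -> bool).
Hypothesis colF : forall x y, x != a -> y != a -> adj G x y -> f x != f y.
Hypothesis odd_meet : forall p q,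
  cycle (adj G) (a :: p) -> uniq (a :: p) -> odd (size p).+1 ->
  cycle (adj G) (a :: q) -> uniq (a :: q) -> odd (size q).+1 -> has (mem p) q.

Let support u : rel T := [rel x y | [exists i, (ed i == [set x; y]) && (u i != 0)]].

Let support_sym u : ssrbool.symmetric (support u).
Proof. by move=> x y; rewrite /support /= [[set y; x]]setUC. Qed.

Let support_adj u : subrel (support u) (adj G).
Proof. by move=> x y /existsP[i /andP[/eqP/adj_enum]]. Qed.

Let supportP u x : [exists y, support u x y] = (degA u x != 0).
Proof.
rewrite degAE sum_nat_eq0; apply/existsP/forallPn => [[y /existsP[i /andP[/eqP ei ui]]]|[i]].
  by exists i; rewrite ei set21.
rewrite negb_imply => /andP[xi ui]; have [b [c [_ ei]]] := edge_card2 (enum_valP i).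
move: xi; rewrite ei !inE => /orP[]/eqP->.
  by exists c; apply/existsP; exists i; rewrite ei eqxx.
by exists b; apply/existsP; exists i; rewrite ei setUC eqxx.
Qed.

(** A vertex meets the support of a monomial iff its degree there is not zero,
    so the two supports cover the same vertices. *)
Lemma quadric_below u v : degA u = degA v -> u != v ->
  (forall i, u i = 0 \/ v i = 0) ->
  exists u' v', [/\ (u' <= u)%MM, (v' <= v)%MM, degA u' = degA v' & mdeg u' = 2].
Proof.
move=> dg uDv dis.
have disRB x y : support u x y -> support v x y -> False.
  move=> /existsP[i /andP[/eqP ei ui]] /existsP[j /andP[/eqP ej vj]].
  have ij : i = j by apply: enum_val_inj; rewrite ei.
  by subst j; case: (dis i) => h; rewrite h in ui vj.
have bal x : [exists y, support u x y] = [exists y, support v x y].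
  by rewrite !supportP dg.
have [x nx] : exists x, [exists y, support u x y].
  have /existsP[i ne] : [exists i, u i != v i].
    by apply: contraT => /existsPn h; case/eqP: uDv; apply/mnmP => i; apply/eqP; have := h i; rewrite negbK.
  have [x [y [_ ei]]] := edge_card2 (enum_valP i); exists x.
  case: (dis i) => z; [rewrite bal|]; apply/existsP; exists y; apply/existsP; exists i;
    by move: ne; rewrite ei eqxx z //= eq_sym.
have [b [c [d [t [h1 h2 h3 h4]]]]] := alternating_square_exists (support_sym u)
  (support_sym v) (@support_adj u) (@support_adj v) disRB even4 colF odd_meet bal nx.
have ne w y z : support w y z -> y != z.
  by move=> h; have := support_adj h; apply: contraTneq => ->; rewrite adj_irr.
have /existsP[i /andP[/eqP ei ui]] := h1; have /existsP[j /andP[/eqP ej uj]] := h3.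
have /existsP[k /andP[/eqP ek vk]] := h2; have /existsP[l /andP[/eqP el vl]] := h4.
have nbc := ne _ _ _ h1; have ncd := ne _ _ _ h2; have ndt := ne _ _ _ h3; have ntb := ne _ _ _ h4.
have bDd : b != d.
  by apply/eqP => e; apply: (disRB _ _ h1); rewrite support_sym e.
have cDt : c != t.
  by apply/eqP => e; apply: (disRB _ _ h1); rewrite support_sym e.
have le_add w p q : p != q -> w p != 0 -> w q != 0 -> (U_(p) + U_(q) <= w)%MM.
  move=> pq wp wq; apply/mnm_lepP => m; rewrite mnmDE !mnm1E.
  case: (eqVneq p m) => [<-|_]; first by rewrite eq_sym (negPf pq) lt0n.
  by case: (eqVneq q m) => [<-|//]; rewrite lt0n.
exists (U_(i) + U_(j))%MM, (U_(k) + U_(l))%MM; split.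
- apply: le_add => //; apply/eqP => e; have := set21 b c; rewrite -ei e ej !inE.
  by rewrite (negPf bDd) eq_sym (negPf ntb).
- apply: le_add => //; apply/eqP => e; have := set21 c d; rewrite -ek e el !inE.
  by rewrite (negPf cDt) eq_sym (negPf nbc).
- apply: eq_degA => z; rewrite !degAD !degA1 ei ej ek el.
  have in2 p q : p != q -> (z \in [set p; q]) = (z == p) + (z == q) :> nat.
    by move=> pq; rewrite !inE; case: (eqVneq z p) => [->|_] //=; rewrite (negPf pq).
  by rewrite !in2 //; move: (_ == b) (_ == c) (_ == d) (_ == t) => [] [] [] [].
by rewrite mdegD !mdeg1.
Qed.

(** Three vertices of a 4-clique avoid [a], and a triangle has no
    2-colouring. *)
Lemma hit_no_K4 b c d t :
  ~~ [&& adj G b c, adj G b d, adj G b t, adj G c d, adj G c t & adj G d t].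
Proof.
apply/negP => /and5P[bc bd bt cd /andP[ct dt]].
have ne y z : adj G y z -> y != z by apply: contraTneq => ->; rewrite adj_irr.
have tri x y z : adj G x y -> adj G y z -> adj G x z -> x != a -> y != a -> z != a -> False.
  move=> xy yz xz xa ya za; have := colF xa ya xy; have := colF ya za yz; have := colF xa za xz.
  by case: (f x); case: (f y); case: (f z).
have nbc := ne _ _ bc; have nbd := ne _ _ bd; have nbt := ne _ _ bt.
have ncd := ne _ _ cd; have nct := ne _ _ ct; have ndt := ne _ _ dt.
case: (eqVneq b a) => [ba|nb].
  by apply: (tri c d t) => //; rewrite -ba eq_sym.
case: (eqVneq c a) => [ca|nc].
  by apply: (tri b d t) => //; rewrite -ca // eq_sym.
case: (eqVneq d a) => [da|nd].
  by apply: (tri b c t) => //; rewrite -da // eq_sym.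
exact: (tri b c d).
Qed.

(** The fibre consists of perfect matchings of four vertices, and a third one
    would complete a 4-clique. *)
Lemma small_fibres u v w : mdeg u = 2 -> degA u = degA v -> degA u = degA w ->
  u != v -> w = u \/ w = v.
Proof.
move=> u2 uv uw nuv; case: (eqVneq w u) => [->|nwu]; first by left.
case: (eqVneq w v) => [->|nwv]; first by right.
have v2 : mdeg v = 2 by rewrite -(degA_mdeg uv).
have w2 : mdeg w = 2 by rewrite -(degA_mdeg uw).
have [i [j eu]] := mdeg2_UU u2; have [k [l ev]] := mdeg2_UU v2.
have [p [q ew]] := mdeg2_UU w2; subst u v w.
have [s [t [c [r [un [ei ej ekl]]]]]] := quadric_square uv nuv.
rewrite eq_sym in nwu; have [s' [t' [c' [r' [un' [ei' ej' ekl']]]]]] := quadric_square uw nwu.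
have eq_i (x y : 'I_n) : ed x = ed y -> x = y by exact: enum_val_inj.
have vw : (ed p = [set t; c] /\ ed q = [set r; s]) \/ (ed q = [set t; c] /\ ed p = [set r; s]) -> False.
  move=> h; case/negP: nwv; apply/eqP.
  case: h ekl => -[h1 h2] [] [h3 h4].
  - by rewrite (eq_i p k (etrans h1 (esym h3))) (eq_i q l (etrans h2 (esym h4))).
  - by rewrite addmC (eq_i q k (etrans h2 (esym h4))) (eq_i p l (etrans h1 (esym h3))).
  - by rewrite addmC (eq_i q k (etrans h1 (esym h3))) (eq_i p l (etrans h2 (esym h4))).
  - by rewrite (eq_i p k (etrans h2 (esym h4))) (eq_i q l (etrans h1 (esym h3))).
have cross : adj G s c -> adj G t r -> False.
  move=> sc tr; have := hit_no_K4 s t c r; rewrite (adj_enum ei) (adj_enum ej) sc tr.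
  by case: ekl => -[/adj_enum -> /adj_enum]; rewrite adj_sym => ->.
rewrite ei in ei'; rewrite ej in ej'.
case: (eq_set2 ei') => -[? ?]; case: (eq_set2 ej') => -[? ?]; subst s' t' c' r'.
- by case: (vw ekl').
- case: ekl' => -[/adj_enum tr /adj_enum cs]; by case: cross => //; rewrite adj_sym.
- case: ekl' => -[/adj_enum sc /adj_enum rt]; by case: cross => //; rewrite adj_sym.
by case: vw; case: ekl' => -[-> ->]; rewrite ![[set s; r]]setUC ![[set c; t]]setUC; auto.
Qed.

Lemma toric_robust_quadratic :
  robust (toric_ideal K G) /\ generated_by_quadrics (toric_ideal K G).
Proof.
exact: (robust_quadratic K degA_addr degA_mdeg degA_linear quadric_below small_fibres).
Qed.

End Backward.
End ToricGraph.

(** * Blocks *)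

Section MakeGraph.
Variables (T : finType) (V : {set T}) (e : rel T).

Lemma mkgraph_subproof :
  sgraph_axiom (V, [set E : {set T} | [exists x in V, exists y in V,
    [&& x != y, e x y & E == [set x; y]]]]).
Proof.
apply/forall_inP => E; rewrite inE => /exists_inP[x xV /exists_inP[y yV /and3P[xy _ /eqP->]]].
by rewrite subUset !sub1set xV yV cards2 xy.
Qed.

Definition mkgraph : sgraph T := SGraph mkgraph_subproof.

Hypothesis symE : ssrbool.symmetric e.

Lemma adj_mkgraph x y : adj mkgraph x y = [&& x \in V, y \in V, x != y & e x y].
Proof.
rewrite /adj /= inE; apply/exists_inP/and4P => [[u uV /exists_inP[v vV /and3P[uv euv /eqP E]]]|[xV yV xy exy]].
  by case: (eq_set2 E) => [[-> ->]|[-> ->]]; rewrite // eq_sym symE.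
by exists x => //; apply/exists_inP; exists y; rewrite // xy exy eqxx.
Qed.

End MakeGraph.

Section Subgraphs.
Variable T : finType.
Implicit Types (G H B : sgraph T) (x y v : T).

Lemma mem_eset G E : reflect (exists x y, adj G x y /\ E = [set x; y]) (E \in eset G).
Proof.
apply: (iffP idP) => [EG|[x [y [xy ->]]] //].
by have [x [y [_ e]]] := edge_card2 EG; exists x, y; rewrite /adj /= -e.
Qed.

Lemma subgraphP H G :
  reflect (vset H \subset vset G /\ forall x y, adj H x y -> adj G x y) (subgraph H G).
Proof.
apply: (iffP andP) => -[sV sE]; split=> //.
  by move=> x y; exact: (subsetP sE).
by apply/subsetP => E /mem_eset[x [y [xy ->]]]; exact: sE.
Qed.

Lemma sgraph_eq G H : vset G = vset H -> adj G =2 adj H -> G = H.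
Proof.
move=> eV eA; apply: val_inj => /=.
have eE : eset G = eset H.
  by apply/setP => E; apply/mem_eset/mem_eset => -[x [y [xy ->]]]; exists x, y; split; rewrite ?eA // -eA.
by move: eV eE; rewrite /vset /eset; case: (sgraph_val G) (sgraph_val H) => a b [c d] /= -> ->.
Qed.

Lemma subgraph_refl G : subgraph G G. Proof. by rewrite /subgraph !subxx. Qed.

Lemma subgraph_trans H G B : subgraph H G -> subgraph G B -> subgraph H B.
Proof.
by case/andP => a b /andP[c d]; rewrite /subgraph (subset_trans a c) (subset_trans b d).
Qed.

Lemma subgraph_anti H G : subgraph H G -> subgraph G H -> H = G.
Proof.
case/subgraphP => a b /subgraphP[c d]; apply: sgraph_eq.
  by apply/eqP; rewrite eqEsubset a c.
by move=> x y; apply/idP/idP; [exact: b|exact: d].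
Qed.

Lemma adj_del G v x y : adj (del_vertex G v) x y = [&& adj G x y, x != v & y != v].
Proof. by rewrite /adj /= inE !inE negb_or ![v == _]eq_sym. Qed.

Lemma vset_del G v x : (x \in vset (del_vertex G v)) = (x != v) && (x \in vset G).
Proof. by rewrite /= !inE. Qed.

Lemma connect_adj_sym G : connect_sym (adj G).
Proof. exact/sym_connect_sym/adj_sym. Qed.

Lemma connect_vset G x y : connect (adj G) x y -> x \in vset G -> y \in vset G.
Proof.
case/connectP => p pth -> xV; elim: p x xV pth => //= z p IHp x xV /andP[xz].
by apply: IHp; case/andP: (adj_vset xz).
Qed.

Lemma ncomp_le1 G :
  reflect {in vset G &, forall x y, connect (adj G) x y} (ncomp G <= 1).
Proof.
have symG := connect_adj_sym G.
have rV x : x \in vset G -> fingraph.root (adj G) x \in vset G.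
  by apply: connect_vset; exact: connect_root.
apply: (iffP idP) => [le1 x y xV yV|con].
  apply/(fingraph.rootP symG); apply: (card_le1_eqP le1); rewrite inE /= roots_root //= rV //.
apply/card_le1_eqP => x y; rewrite !inE /= => /andP[/eqP rx xV] /andP[/eqP ry yV].
by rewrite -rx -ry; apply/(fingraph.rootP symG)/con.
Qed.

Lemma ncomp_gt0 G : (0 < ncomp G) = (vset G != set0).
Proof.
have symG := connect_adj_sym G.
apply/card_gt0P/set0Pn => [[x]|[x xV]]; first by rewrite inE /= => /andP[_ xV]; exists x.
exists (fingraph.root (adj G) x); rewrite inE /= roots_root //=.
by apply: connect_vset xV; exact: connect_root.
Qed.

Lemma connectedP G :
  reflect (vset G != set0 /\ {in vset G &, forall x y, connect (adj G) x y}) (connected G).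
Proof.
rewrite /connected eqn_leq -[1 <= _]/(0 < _) ncomp_gt0 andbC.
by apply: (iffP andP) => -[h1 h2]; split=> //; exact/ncomp_le1.
Qed.

Lemma cut_vertexP G v : connected G ->
  reflect (v \in vset G /\ exists x y, [/\ x \in vset G, y \in vset G, x != v, y != v &
     ~~ connect (adj (del_vertex G v)) x y]) (cut_vertex G v).
Proof.
move=> conG; rewrite /cut_vertex (eqP conG).
apply: (iffP andP) => -[vV h]; split=> //.
  rewrite ltnNge in h; case: (boolP [exists x, exists y,
    [&& x \in vset G, y \in vset G, x != v, y != v & ~~ connect (adj (del_vertex G v)) x y]]).
    by case/existsP => x /existsP[y /and5P[? ? ? ? ?]]; exists x, y.
  move/existsPn=> nex; case/negP: h; apply/ncomp_le1 => x y; rewrite !vset_del.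
  case/andP => xv xV /andP[yv yV]; apply: contraT => ncon; case/existsP: (nex x).
  by exists y; rewrite xV yV xv yv.
rewrite ltnNge; apply/negP => /ncomp_le1 con; case: h => x [y [xV yV xv yv]]; case/negP.
by apply: con; rewrite vset_del ?xv ?yv.
Qed.

Lemma noncut_connect G v x y : connected G -> ~~ cut_vertex G v ->
  x \in vset G -> y \in vset G -> x != v -> y != v ->
  connect (adj (del_vertex G v)) x y.
Proof.
move=> conG nc xV yV xv yv; case: (boolP (v \in vset G)) => vV.
  by apply: contraT => ncon; case/negP: nc; apply/cut_vertexP => //; split=> //; exists x, y.
have e : adj (del_vertex G v) =2 adj G.
  move=> a b; rewrite adj_del; case: (boolP (adj G a b)) => //= /adj_vset/andP[aV bV].
  by apply/andP; split; apply: contraNneq vV => <-.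
by rewrite (eq_connect e); have [_ con] := connectedP _ conG; exact: con.
Qed.

Lemma biconnectedP G :
  reflect [/\ vset G != set0, {in vset G &, forall x y, connect (adj G) x y} &
    forall v x y, x \in vset G -> y \in vset G -> x != v -> y != v ->
      connect (adj (del_vertex G v)) x y] (biconnected G).
Proof.
apply: (iffP andP) => [[conG /forallP ncut]|[ne con cut]].
  have [ne con] := connectedP _ conG; split=> // v x y xV yV xv yv.
  exact: noncut_connect.
have conG : connected G by apply/connectedP.
split=> //; apply/forallP => v; apply/negP => /(cut_vertexP _ conG)[_ [x [y [xV yV xv yv]]]].
by rewrite cut.
Qed.

Lemma connect_subrel (e1 e2 : rel T) x y :
  subrel e1 e2 -> connect e1 x y -> connect e2 x y.
Proof. by move=> sub; apply: connect_sub => a b ab; exact/connect1/sub. Qed.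

(** A graph with a Hamiltonian cycle is biconnected; a single edge is the
    degenerate case of a cycle of length 2. *)
Lemma hamiltonian_biconnected H c : cycle (adj H) c -> uniq c -> c != [::] ->
  vset H =i c -> biconnected H.
Proof.
move=> cyc un nc HV; apply/biconnectedP; split.
- by case: c nc HV {cyc un} => // x c _ HV; apply/set0Pn; exists x; rewrite HV mem_head.
- move=> x y; rewrite !HV; exact: connect_cycle.
move=> v x y; rewrite !HV => xc yc xv yv.
suff [d [pth dv dc]] : exists d, [/\ sorted (adj H) d, v \notin d &
    forall z, z \in c -> z != v -> z \in d].
  case: d pth dv dc => [|a d] /= pth dv dc; first by have := dc x xc xv.
  have con z : z \in a :: d -> connect (adj (del_vertex H v)) a z.
    apply: (path_connect (p := d)).
    elim: d a pth dv {dc} => //= b d IHd a /andP[ab pth].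
    rewrite inE negb_or => /andP[va vd]; rewrite IHd // andbT adj_del ab.
    by move: vd; rewrite inE negb_or ![_ == v]eq_sym va => /andP[].
  apply: (connect_trans (y := a)); last exact/con/dc.
  by rewrite connect_adj_sym; exact/con/dc.
case: (boolP (v \in c)) => vc; last first.
  exists c; split=> //; case: c cyc {un nc HV xc yc vc} => //= a d.
  by rewrite rcons_path => /andP[].
have [p [cp up _ mp]] := rot_to_cycle vc cyc un; exists p; split.
- by move: cp; rewrite /= rcons_path => /andP[/path_sorted].
- by case/andP: up.
by move=> z; rewrite mp inE => /orP[/eqP->|//]; rewrite eqxx.
Qed.

Definition gunion G H : sgraph T :=
  mkgraph (vset G :|: vset H) [rel x y | adj G x y || adj H x y].

Lemma adj_gunion G H x y : adj (gunion G H) x y = adj G x y || adj H x y.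
Proof.
rewrite adj_mkgraph => [|a b]; last by rewrite /= (adj_sym G) (adj_sym H).
apply/idP/idP => [/and4P[]//|/= h]; rewrite h andbT !inE.
have ne : x != y by apply: contraTneq h => ->; rewrite !adj_irr.
by case/orP: h => /adj_vset/andP[-> ->]; rewrite ?orbT ne.
Qed.

(** Whichever vertex is removed, one of the two common vertices remains and
    links the two graphs. *)
Lemma gunion_biconnected G H x y : biconnected G -> biconnected H -> x != y ->
  x \in vset G -> x \in vset H -> y \in vset G -> y \in vset H ->
  biconnected (gunion G H).
Proof.
move=> /biconnectedP[_ conG cutG] /biconnectedP[_ conH cutH] xy xG xH yG yH.
apply/biconnectedP; split.
- by apply/set0Pn; exists x; rewrite inE xG.
- have con z : z \in vset (gunion G H) -> connect (adj (gunion G H)) x z.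
    rewrite inE => /orP[zG|zH].
      by apply: connect_subrel (conG _ _ xG zG) => a b; rewrite adj_gunion => ->.
    by apply: connect_subrel (conH _ _ xH zH) => a b; rewrite adj_gunion => ->; rewrite orbT.
  by move=> a b /con xa /con xb; apply: connect_trans xb; rewrite connect_adj_sym.
move=> v; have [w [wv wG wH]] : exists w, [/\ w != v, w \in vset G & w \in vset H].
  case: (eqVneq x v) => [xv|xv]; last by exists x.
  by exists y; rewrite -xv eq_sym.
have con z : z \in vset (gunion G H) -> z != v -> connect (adj (del_vertex (gunion G H) v)) w z.
  rewrite inE => /orP[zG|zH] zv.
    apply: connect_subrel (cutG v _ _ wG zG wv zv) => a b; rewrite !adj_del adj_gunion.
    by case/and3P => -> -> ->.
  apply: connect_subrel (cutH v _ _ wH zH wv zv) => a b; rewrite !adj_del adj_gunion.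
  by case/and3P => -> -> ->; rewrite orbT.
move=> a b aV bV av bv; apply: connect_trans (con b bV bv).
by rewrite connect_adj_sym; exact: con.
Qed.

Lemma blockP G B : reflect [/\ subgraph B G, biconnected B &
    forall H, subgraph H G -> biconnected H -> subgraph B H -> H = B] (B \in blocks G).
Proof.
rewrite inE; apply: (iffP and3P) => -[h1 h2 h3]; split=> //.
  by move=> H a b c; have /implyP/(_ _)/eqP := forallP h3 H; apply; apply/and3P.
by apply/forallP => H; apply/implyP => /and3P[a b c]; apply/eqP/h3.
Qed.

Lemma block_of_biconnected G H : subgraph H G -> biconnected H ->
  exists2 B, B \in blocks G & subgraph H B.
Proof.
move=> HG bH; pose P B := [&& subgraph B G, biconnected B & subgraph H B].
have PH : P H by rewrite /P HG bH subgraph_refl.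
case: (arg_maxnP (fun B => #|vset B| + #|eset B|) PH) => B /and3P[BG bB HB] maxB.
exists B => //; apply/blockP; split=> // H' H'G bH' BH'.
have le : #|vset H'| + #|eset H'| <= #|vset B| + #|eset B|.
  by apply: maxB; rewrite /P H'G bH' (subgraph_trans HB).
have /andP[sV sE] := BH'; apply: subgraph_anti BH'.
have cV := subset_leq_card sV; have cE := subset_leq_card sE.
have [leV leE] : #|vset H'| <= #|vset B| /\ #|eset H'| <= #|eset B|.
  move: le cV cE; clear.
  by move: #|vset B| #|eset B| #|vset H'| #|eset H'| => a b c d; lia.
have eV : vset B = vset H' by apply/eqP; rewrite eqEcard sV.
have eE : eset B = eset H' by apply/eqP; rewrite eqEcard sE.
by rewrite /subgraph eV eE !subxx.
Qed.

Lemma cycle_in_block G c : cycle (adj G) c -> uniq c -> c != [::] ->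
  (forall x, x \in c -> x \in vset G) ->
  exists2 B, B \in blocks G & cycle (adj B) c /\ (forall x, x \in c -> x \in vset B).
Proof.
move=> cyc un nc cV; pose H := mkgraph [set x in c] (adj G).
have adjH x y : adj H x y = [&& x \in c, y \in c & adj G x y].
  rewrite adj_mkgraph; last exact: adj_sym.
  rewrite !inE; case: (eqVneq x y) => //= ->; by rewrite adj_irr !andbF.
have cycH : cycle (adj H) c.
  by apply: (sub_in_cycle (P := mem c)) cyc; [move=> x y xc yc xy; rewrite adjH xy xc yc|exact/allP].
have [||B BG HB] := @block_of_biconnected G H _ (hamiltonian_biconnected cycH un nc _).
- apply/subgraphP; split=> [|x y]; first by apply/subsetP => x; rewrite inE => /cV.
  by rewrite adjH => /and3P[].
- by move=> x; rewrite inE.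
have [sV sA] := subgraphP _ _ HB; exists B => //; split; first exact: sub_cycle cycH.
by move=> x xc; apply: (subsetP sV); rewrite inE.
Qed.

(** By maximality both blocks are equal to their union. *)
Lemma eq_block G B1 B2 x y : B1 \in blocks G -> B2 \in blocks G -> x != y ->
  x \in vset B1 -> x \in vset B2 -> y \in vset B1 -> y \in vset B2 -> B1 = B2.
Proof.
move=> /blockP[s1 b1 m1] /blockP[s2 b2 m2] xy x1 x2 y1 y2.
have bU := gunion_biconnected b1 b2 xy x1 x2 y1 y2.
have sU : subgraph (gunion B1 B2) G.
  have [v1 a1] := subgraphP _ _ s1; have [v2 a2] := subgraphP _ _ s2.
  apply/subgraphP; rewrite subUset v1 v2; split=> // a b.
  by rewrite adj_gunion => /orP[]; auto.
transitivity (gunion B1 B2); [apply/esym/m1 => //|apply: m2 => //].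
all: apply/subgraphP; rewrite ?subsetUl ?subsetUr; split=> // a b.
all: by rewrite adj_gunion => ->; rewrite ?orbT.
Qed.

End Subgraphs.

(** * Bipartite blocks *)

Section BipartiteBlocks.
Variable T : finType.
Implicit Types (G H B : sgraph T) (x y v : T).

Definition coloured G (g : T -> bool) := forall x y, adj G x y -> g x != g y.

Lemma colour_bipartition G A A' : bipartition G A A' -> coloured G (fun x => x \in A).
Proof.
case=> _ dis part x y /part[a [b [aA bA /eq_set2 e]]].
have bA' : b \notin A by rewrite (disjointFl dis bA).
by case: e => -[-> ->]; rewrite aA (negPf bA').
Qed.

Lemma bipartition_colour G g :
  coloured G g -> bipartition G [set x in vset G | g x] [set x in vset G | ~~ g x].
Proof.
move=> col; split.
- by apply/setP => x; rewrite !inE -andb_orr orbN andbT.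
- rewrite disjoint_subset; apply/subsetP => x; rewrite !inE => /andP[-> ->] //.
move=> E /mem_eset[x [y [xy ->]]]; have /andP[xV yV] := adj_vset xy; have := col x y xy.
case gx: (g x); case gy: (g y) => // _; first by exists x, y; rewrite !inE xV yV gx gy.
by exists y, x; rewrite !inE xV yV gx gy setUC.
Qed.

Lemma bipartiteP G : bipartite G <-> exists g, coloured G g.
Proof.
split=> [[A [A' /colour_bipartition]]|[g /bipartition_colour]] h; first by eexists; exact: h.
by do 2!eexists; exact: h.
Qed.

Lemma nonbipartite_odd_cycle G : ~ bipartite G ->
  exists2 c, cycle (adj G) c /\ uniq c & odd (size c).
Proof.
move=> nb; have [[f hf]|//] := two_colouring_or_odd_cycle (@adj_sym T G).
by case: nb; apply/bipartiteP; exists f.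
Qed.

Lemma coloured_cycle_even G g c : coloured G g -> cycle (adj G) c -> ~~ odd (size c).
Proof. by move=> col; apply: (colour_cycle (f := g)) => u v _ _; exact: col. Qed.

Lemma cycle_vset G c x : cycle (adj G) c -> x \in c -> x \in vset G.
Proof.
move=> cyc xc; have := next_cycle cyc xc.
by case/adj_vset/andP.
Qed.

Definition short_cycles G := forall c, cycle (adj G) c -> uniq c -> size c <= 4.

Section Bipartite.
Variables (H : sgraph T) (g : T -> bool).
Hypotheses (bicH : biconnected H) (colH : coloured H g) (shortH : short_cycles H).

(** Removing [x1] leaves a second path from [x0] to [x2], and all cycles
    through [x1] have length 4. *)
Lemma second_middle x0 x1 x2 : adj H x0 x1 -> adj H x1 x2 -> x0 != x2 ->
  exists z, [/\ z != x1, adj H x0 z & adj H z x2].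
Proof.
move=> a01 a12 n02; have [_ _ cut] := biconnectedP _ bicH.
have ne a b : adj H a b -> a != b by apply: contraTneq => ->; rewrite adj_irr.
have /andP[x0V _] := adj_vset a01; have /andP[_ x2V] := adj_vset a12.
have /connect_uniq_path[p [pth un lp]] := cut x1 x0 x2 x0V x2V (ne _ _ a01) (ltac:(rewrite eq_sym; exact: ne a12)).
have pth' : path (adj H) x0 p by apply: sub_path pth => a b; rewrite adj_del => /and3P[].
have x1p : x1 \notin x0 :: p.
  rewrite inE negb_or eq_sym (ne _ _ a01) /=; apply/negP => x1p.
  have [p1 [p2 ep]] := mem_split x1p.
  by move: pth; rewrite ep cat_path /= adj_del eqxx !andbF.
have cyc : cycle (adj H) (x1 :: x0 :: p).
  by rewrite /= rcons_path lp adj_sym a01 pth' adj_sym.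
have un' : uniq (x1 :: x0 :: p) by rewrite cons_uniq x1p un.
have le4 := shortH cyc un'; have ev := coloured_cycle_even colH cyc.
case: p lp un pth' ev le4 x1p {pth cyc un'} => [|z [|y [|]]] //=.
  by move=> e; rewrite e eqxx in n02.
move=> -> _ /and3P[a0z az2 _] _ _; rewrite !inE !negb_or => /and3P[_ nz _].
by exists z; rewrite eq_sym.
Qed.

(** The second middle vertices of the two halves of the walk would close a
    6-cycle. *)
Lemma adj_of_path3 x0 x1 x2 x3 : adj H x0 x1 -> adj H x1 x2 -> adj H x2 x3 -> adj H x0 x3.
Proof.
move=> a01 a12 a23; case: (eqVneq x0 x2) => [->//|n02]; case: (eqVneq x1 x3) => [<-//|n13].
have [z [nz1 a0z az2]] := second_middle a01 a12 n02.
have [w [nw2 a1w aw3]] := second_middle a12 a23 n13.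
case: (eqVneq z x3) => [<-//|nz3]; case: (eqVneq w x0) => [<-//|nw0].
have cyc : cycle (adj H) [:: x0; x1; w; x3; x2; z].
  by rewrite /= a01 a1w aw3 (adj_sym H x3) a23 (adj_sym H x2) az2 (adj_sym H z) a0z.
have neq a b : g a != g b -> a != b by apply: contraNneq => ->.
have := colH a01; have := colH a12; have := colH a23; have := colH a0z.
have := colH az2; have := colH a1w; have := colH aw3.
move=> c1 c2 c3 c4 c5 c6 c7.
have un : uniq [:: x0; x1; w; x3; x2; z].
  rewrite /= !inE !negb_or (eq_sym x0 w) nw0 n02 n13 nw2 (eq_sym x3 z) nz3 (eq_sym x1 z) nz1.
  by rewrite !neq //; move: c1 c2 c3 c4 c5 c6 c7;
     case: (g x0); case: (g x1); case: (g x2); case: (g x3); case: (g z); case: (g w).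
by have := shortH cyc un.
Qed.

(** A walk of odd length between the two vertices is shortened by replacing
    three steps by one. *)
Lemma opposite_adj x y : x \in vset H -> y \in vset H -> g x != g y -> adj H x y.
Proof.
have [_ con _] := biconnectedP _ bicH => xV yV; have /connectP[p pth ->] := con x y xV yV.
have [n] := ubnP (size p); elim: n x p pth {con xV yV} => // n IHn x.
case=> [|x1 [|x2 p]] /=; first by rewrite eqxx.
  by rewrite andbT.
case/and3P => a01 a12 pth le ne.
have a23 : adj H x2 (last x2 p).
  apply: IHn => //; first by lia.
  move: ne (colH a01) (colH a12).
  by case: (g x); case: (g x1); case: (g x2); case: (g _).
exact: adj_of_path3 a12 a23.
Qed.

(** The block is complete bipartite. Two sides of three vertices would contain
    a 6-cycle, and a side with a single vertex would be a cut vertex unless the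
    other side is a single vertex as well. *)
Lemma bipartite_block_shape u v : adj H u v ->
  single_edge H \/ exists l, is_K2 l H.
Proof.
move=> uv; have [_ con cut] := biconnectedP _ bicH.
have part := bipartition_colour colH; set A := [set x in _ | g x] in part.
set A' := [set x in _ | ~~ g x] in part.
have comp x y : x \in A -> y \in A' -> [set x; y] \in eset H.
  rewrite !inE => /andP[xV gx] /andP[yV gy]; apply: opposite_adj => //.
  by rewrite gx (negPf gy).
have [a aA [b bA']] : exists2 a, a \in A & exists b, b \in A'.
  have /andP[uV vV] := adj_vset uv; have := colH uv; case gu: (g u); case gv: (g v) => // _.
    by exists u; rewrite ?inE ?uV ?gu //; exists v; rewrite inE vV gv.
  by exists v; rewrite ?inE ?vV ?gv //; exists u; rewrite inE uV gu.
(* a side with one vertex [c] leaves no edge once [c] is removed *)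
have star (S S' : {set T}) c : S = [set c] -> S :|: S' = vset H -> [disjoint S & S'] ->
    (forall x y, adj H x y -> (x \in S) != (y \in S)) -> #|S'| <= 1.
  move=> eS eV dis colS; apply/card_le1_eqP => x y xS yS; apply/eqP; apply: contraT => xy.
  have inV z : z \in S' -> z \in vset H by rewrite -eV inE orbC => ->.
  have nc z : z \in S' -> z != c by move=> zS; have := disjointFl dis zS; rewrite eS inE => ->.
  have /connectP[[|z p] /=] := cut c x y (inV _ xS) (inV _ yS) (nc _ xS) (nc _ yS).
    by move=> _ e; rewrite e eqxx in xy.
  case/andP; rewrite adj_del => /and3P[xz _ zc] _ _.
  by have := colS _ _ xz; rewrite (disjointFl dis xS) eS !inE (negPf zc).
have [eV dis _] := part.
have colA x y : adj H x y -> (x \in A) != (y \in A).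
  by move=> xy; have /andP[xV yV] := adj_vset xy; rewrite !inE xV yV; exact: colH.
have dis' : [disjoint A' & A] by rewrite disjoint_sym.
have colA' x y : adj H x y -> (x \in A') != (y \in A').
  move=> xy; have /andP[xV yV] := adj_vset xy; rewrite !inE xV yV /=; have := colH xy.
  by case: (g x); case: (g y).
case: (ltnP 1 #|A|) => cA; case: (ltnP 1 #|A'|) => cA'.
- right; case: (ltnP 2 #|A|) => cA2; last first.
    exists #|A'|; split=> //; exists A, A'; split=> //; by apply/eqP; rewrite eqn_leq cA cA2.
  case: (ltnP 2 #|A'|) => cA2'; last first.
    exists #|A|; split=> //; exists A', A; split=> //.
    + split; [by rewrite setUC|exact: dis'|] => E; case: part => _ _ h /h[x [y [xA yA ->]]].
      by exists y, x; rewrite setUC.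
    + by apply/eqP; rewrite eqn_leq cA' cA2'.
    + by move=> x y xA yA; rewrite setUC; exact: comp.
  have /card_gt2P[a1 [a2 [a3 [[h1 h2 h3] [n12 n23 n31]]]]] := cA2.
  have /card_gt2P[b1 [b2 [b3 [[k1 k2 k3] [m12 m23 m31]]]]] := cA2'.
  have cyc : cycle (adj H) [:: a1; b1; a2; b2; a3; b3].
    have ad x y : x \in A -> y \in A' -> adj H x y by exact: comp.
    have ad' x y : x \in A -> y \in A' -> adj H y x by move=> xA yA; rewrite adj_sym ad.
    by rewrite /= (ad a1) // (ad' a2 b1) // (ad a2) // (ad' a3 b2) // (ad a3) // ad'.
  have un : uniq [:: a1; b1; a2; b2; a3; b3].
    have nab x y : x \in A -> y \in A' -> x != y.
      by move=> xA yA; apply: contraTneq yA => <-; rewrite (disjointFr dis xA).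
    rewrite /= !inE !negb_or n12 (eq_sym a1 a3) n31 n23 m12 (eq_sym b1 b3) m31 m23.
    have nba x y : x \in A -> y \in A' -> y != x by rewrite eq_sym; exact: nab.
    by rewrite (nab a1) // (nab a1) // (nab a1) // (nba a2) // (nba a3) // (nab a2) //
      (nab a2) // (nba a3) // (nab a3).
  by have := shortH cyc un.
- have A'1 : A' = [set b] by apply/eqP; rewrite eq_sym eqEcard sub1set bA' cards1 cA'.
  have := star A' A b A'1 _ dis' colA'; rewrite setUC eV => /(_ erefl).
  by rewrite leqNgt cA.
- have A1 : A = [set a] by apply/eqP; rewrite eq_sym eqEcard sub1set aA cards1 cA.
  by have := star A A' a A1 eV dis colA; rewrite leqNgt cA'.
left; have A'1 : A' = [set b] by apply/eqP; rewrite eq_sym eqEcard sub1set bA' cards1 cA'.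
have A1 : A = [set a] by apply/eqP; rewrite eq_sym eqEcard sub1set aA cards1 cA.
exists [set a; b]; last by rewrite -eV A1 A'1.
case: part => _ _ h; apply/setP => E; rewrite !inE; apply/idP/eqP => [/h|->]; last exact: comp.
by rewrite A1 A'1 => -[x [y [/set1P-> /set1P->]]].
Qed.

End Bipartite.
End BipartiteBlocks.

(** * From the block structure to the cycles *)

Section CycleConditions.
Variable T : finType.
Implicit Types (G H B : sgraph T) (x y v : T).

Definition even_cycles_short G :=
  forall c, cycle (adj G) c -> uniq c -> ~~ odd (size c) -> size c <= 4.

Definition coloured_off G a (f : T -> bool) :=
  forall x y, x != a -> y != a -> adj G x y -> f x != f y.

Definition odd_cycles_meet_again G a := forall p q,
  cycle (adj G) (a :: p) -> uniq (a :: p) -> odd (size p).+1 ->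
  cycle (adj G) (a :: q) -> uniq (a :: q) -> odd (size q).+1 -> has (mem p) q.

(** The condition on cycles between the block structure and the algebra: even
    cycles are squares, and all odd cycles pass through [a], where no two of
    them meet in [a] only. *)
Definition cycle_condition G a f :=
  [/\ even_cycles_short G, coloured_off G a f & odd_cycles_meet_again G a].

Lemma coloured_off_odd_cycle G a f c :
  coloured_off G a f -> cycle (adj G) c -> odd (size c) -> a \in c.
Proof.
move=> col cyc; apply: contraTT => ac; apply: (colour_cycle (e := adj G) (f := f)) => // u v uc vc.
by apply: col; [apply: contraNneq ac => <-|apply: contraNneq ac => <-].
Qed.

Lemma meet_again_at_two G a b f f' : a != b ->
  coloured_off G a f -> coloured_off G b f' -> odd_cycles_meet_again G a.
Proof.
move=> ab _ colb p q cp up op cq uq oq.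
have := coloured_off_odd_cycle colb cp op; have := coloured_off_odd_cycle colb cq oq.
by rewrite !inE eq_sym (negPf ab) /= => bq bp; apply/hasP; exists b.
Qed.

Lemma alternating_count G g x p : coloured G g -> path (adj G) x p ->
  (count g p).*2 + g x = size p + g (last x p).
Proof.
move=> col; elim: p x => [|y p IHp] x //= /andP[xy /IHp]; have := col _ _ xy.
by move: (count g p) (size p) => m k; case: (g x); case: (g y); case: (g _) => //=; lia.
Qed.

(** Every second vertex of a cycle is one of the two vertices of the small
    side. *)
Lemma K2_short l H : is_K2 l H -> short_cycles H.
Proof.
case=> _ [A [A' [/colour_bipartition col A2 _ _]]] [|x p] //= cyc un.
have := alternating_count col cyc; rewrite last_rcons size_rcons => /addIn.
have -> : count (fun z => z \in A) (rcons p x) = count (fun z => z \in A) (x :: p).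
  by rewrite -cats1 count_cat /= addn0 addnC.
have : count (fun z => z \in A) (x :: p) <= 2.
  rewrite -size_filter -A2; have un' : uniq [seq z <- x :: p | z \in A] by rewrite filter_uniq.
  rewrite -(card_uniqP un'); apply: subset_leq_card; apply/subsetP => z.
  by rewrite mem_filter => /andP[].
by move: (count _ _) (size p) => m k; lia.
Qed.

Lemma single_edge_short H : single_edge H -> short_cycles H.
Proof.
case=> E [eE eV] c cyc un; have : size c <= #|E|.
  rewrite -(card_uniqP un); apply: subset_leq_card; apply/subsetP => z.
  by move/(cycle_vset cyc); rewrite eV.
have EH : E \in eset H by rewrite eE set11.
have [x [y [_ ->]]] := edge_card2 EH; rewrite cards2.
by case: (_ != _) => /=; lia.
Qed.

Lemma short_blocks_short G :
  (forall B, B \in blocks G -> (exists l, is_K2 l B) \/ single_edge B) -> short_cycles G.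
Proof.
move=> h c cyc un; case: (eqVneq c [::]) => [->//|nc].
have [|B BG [cB _]] := cycle_in_block cyc un nc; first by move=> x; exact: cycle_vset.
by case: (h B BG) => [[l /K2_short]|/single_edge_short]; apply.
Qed.

(** Every odd cycle of [G] lies in the only block that is not bipartite. *)
Lemma cycle_condition_block G B a f :
  cycle_condition B a f -> B \in blocks G ->
  (forall B', B' \in blocks G -> B' <> B -> bipartite B') ->
  (forall B', B' \in blocks G -> bipartite B' -> (exists l, is_K2 l B') \/ single_edge B') ->
  exists f', cycle_condition G a f'.
Proof.
move=> [evB colB meetB] BG bip shape.
have inblock c : cycle (adj G) c -> uniq c -> c != [::] ->
    cycle (adj B) c \/ (size c <= 4 /\ ~~ odd (size c)).
  move=> cyc un nc; have [|D DG [cD _]] := cycle_in_block cyc un nc.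
    by move=> x; exact: cycle_vset.
  case: (eqVneq D B) => [<-|/eqP nDB]; first by left.
  right; have bD := bip D DG nDB; have [g colD] := (bipartiteP D).1 bD; split.
    by case: (shape D DG bD) => [[l /K2_short]|/single_edge_short]; apply.
  exact: coloured_cycle_even colD cD.
have oddB c : cycle (adj G) c -> uniq c -> odd (size c) -> cycle (adj B) c.
  move=> cyc un od; have nc : c != [::] by case: (c) od.
  by case: (inblock c cyc un nc) => // -[_]; rewrite od.
have [[f' hf]|[d [cyd und odd_d ad]]] := two_colouring_off a (@adj_sym T G).
  exists f'; split=> //.
    move=> c cyc un od; case: (eqVneq c [::]) => [->//|nc].
    by case: (inblock c cyc un nc) => [cB|[]//]; exact: evB.
  by move=> p q cp up op cq uq oq; apply: meetB => //; apply: oddB.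
by rewrite (coloured_off_odd_cycle colB (oddB d cyd und odd_d) odd_d) in ad.
Qed.

End CycleConditions.

(** Cycles are carried along injective homomorphisms. *)
Lemma cycle_condition_hom (T U : finType) (H : sgraph T) (I : sgraph U) (h : T -> U) a f :
  {in vset H &, injective h} -> (forall x y, adj H x y -> adj I (h x) (h y)) ->
  a \in vset H -> cycle_condition I (h a) f -> cycle_condition H a (f \o h).
Proof.
move=> inj hom aV [ev col meet].
have cmap c : cycle (adj H) c -> cycle (adj I) (map h c).
  by case: c => //= x p; rewrite -map_rcons path_map; apply: sub_path => u v; exact: hom.
have umap c : cycle (adj H) c -> uniq c -> uniq (map h c).
  by move=> cyc un; rewrite map_inj_in_uniq // => u v uc vc; apply: inj; exact: cycle_vset cyc _.
split.
- by move=> c cyc un od; rewrite -(size_map h); apply: ev; rewrite ?size_map; auto.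
- move=> x y xa ya xy; have /andP[xV yV] := adj_vset xy; apply: col; last exact: hom.
    by apply: contraNneq xa => /inj ->.
  by apply: contraNneq ya => /inj ->.
move=> p q cp up op cq uq oq.
have /hasP[w /mapP[v vq ev'] /= /mapP[u up' eu]] : has (mem (map h p)) (map h q).
  by apply: meet; rewrite ?size_map //; [exact: cmap cp|exact: umap cp up|exact: cmap cq|exact: umap cq uq].
apply/hasP; exists v => //=; rewrite -(inj u v) -?eu //.
  by apply: cycle_vset cp _; rewrite inE up' orbT.
by apply: cycle_vset cq _; rewrite inE vq orbT.
Qed.

(** * The three kinds of non bipartite blocks *)

Section Families.
Variable T : finType.
Implicit Types (G H B : sgraph T) (x y v : T).

Lemma adj_neq G x y : adj G x y -> x != y.
Proof. by apply: contraTneq => ->; rewrite adj_irr. Qed.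

(** The common features of a non bipartite [K_{2,l}] with an edge, used for it
    both as a block and as a summand of a 2-clique sum. *)
Definition odd_edge_extension B K g x y :=
  [/\ coloured K g, short_cycles K, x != y, g x = g y &
    forall u v, adj B u v = adj K u v || ([set u; v] == [set x; y])].

Lemma odd_edge_extensionC B K g x y :
  odd_edge_extension B K g x y -> odd_edge_extension B K g y x.
Proof. by case=> a b c d h; split; rewrite 1?eq_sym // => u v; rewrite h [[set y; x]]setUC. Qed.

Lemma K2_plus_extension l B E : is_K2_plus l B E ->
  exists K g x y, odd_edge_extension B K g x y /\
    [/\ E = [set x; y], x \in vset K, y \in vset K & vset B = vset K].
Proof.
case=> K [x [y [K2 [xK yK xy ->] eV eE nb]]].
have [_ [A [A' [/colour_bipartition col _ _ _]]]] := K2.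
have adjB u v : adj B u v = adj K u v || ([set u; v] == [set x; y]).
  by rewrite /adj /= eE !inE orbC.
exists K, (fun z => z \in A), x, y; split; last by [].
split=> //; first exact: K2_short K2.
apply/eqP; apply: contraT => ne; case: nb; apply/bipartiteP; exists (fun z => z \in A) => u v.
rewrite adjB => /orP[/col//|/eqP/eq_set2[[-> ->]|[-> ->]]] //.
by rewrite eq_sym.
Qed.

Lemma extension_off B K g x y : odd_edge_extension B K g x y -> coloured_off B x g.
Proof.
case=> col _ _ _ adjB u v ux vx; rewrite adjB => /orP[/col//|/eqP/eq_set2[]] [e1 e2].
  by rewrite e1 eqxx in ux.
by rewrite e2 eqxx in vx.
Qed.

(** An even cycle through the edge [{x, y}] would join [x] and [y] in [K] by a
    walk of odd length. *)
Lemma extension_even B K g x y : odd_edge_extension B K g x y -> even_cycles_short B.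
Proof.
move=> ext c cyc un ev; have [col short xy gxy adjB] := ext.
have adjK u v : adj B u v -> u != x -> v != x -> adj K u v.
  move=> uv ux vx; move: uv; rewrite adjB => /orP[//|/eqP/eq_set2[]] [e1 e2].
    by rewrite e1 eqxx in ux.
  by rewrite e2 eqxx in vx.
have adjKy u : adj B x u -> u != y -> adj K x u.
  rewrite adjB => /orP[//|/eqP/set2_inj ->]; by rewrite eqxx.
case: (boolP (x \in c)) => xc; last first.
  apply: short => //; apply: (sub_in_cycle (P := mem c)) cyc; last exact/allP.
  by move=> u v uc vc uv; apply: adjK => //; [apply: contraNneq xc => <-|apply: contraNneq xc => <-].
have [p [cp up sp _]] := rot_to_cycle xc cyc un; rewrite sp in ev *.
case: p cp up ev {sp} => [|z p] //= /andP[xz]; rewrite rcons_path => /andP[pth lx].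
rewrite inE negb_or => /andP[/andP[nxz xp] /andP[zp up]]; rewrite negbK => ev.
have pthK : path (adj K) z p.
  apply: (sub_in_path (P := [pred w | w != x])) pth.
    by move=> u v; rewrite !inE => ux vx uv; exact: adjK.
  rewrite /= eq_sym nxz; apply/allP => w wp /=; by apply: contraNneq xp => <-.
have lz : g (last z p) = g z.
  have := colour_walk (f := g) (fun u v _ _ => @col u v) pthK.
  by rewrite (negPf ev).
rewrite adj_sym in lx.
case: (eqVneq z y) => [zy|zy].
  case: p ev lz lx zp {pth pthK up xp} => [|w p] //= ev lz lx zp.
  have := col _ _ (adjKy _ lx _); rewrite lz zy gxy eqxx => /(_ _)/negP; case=> //.
  apply: contraNneq zp => h; rewrite zy -h; exact: mem_last.
case: (eqVneq (last z p) y) => [ly|ly].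
  by have := col _ _ (adjKy _ xz zy); rewrite gxy -ly lz eqxx.
apply: (short [:: x, z & p]).
  by rewrite /= adjKy // rcons_path pthK adj_sym adjKy.
by rewrite /= inE negb_or nxz xp zp up.
Qed.

Lemma K2_plus_condition l B E : is_K2_plus l B E -> exists a f, a \in vset B /\ cycle_condition B a f.
Proof.
case/K2_plus_extension => K [g [x [y [ext [_ xK yK eV]]]]].
have ext' := odd_edge_extensionC ext; have [_ _ xy _ _] := ext.
exists x, g; split; [by rewrite eV|split].
- exact: extension_even ext.
- exact: extension_off ext.
- exact: meet_again_at_two xy (extension_off ext) (extension_off ext').
Qed.

Section CliqueSum.
Variables (B G1 K1 G2 : sgraph T) (g1 g2 : T -> bool).
Hypothesis adjB : forall u v, adj B u v = adj G1 u v || adj G2 u v.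
Hypotheses (col2 : coloured G2 g2) (short2 : short_cycles G2).

Section Off.
Variables (x y : T).
Hypothesis ext : odd_edge_extension G1 K1 g1 x y.
Hypothesis xy2 : adj G2 x y.
Hypothesis meet : vset G1 :&: vset G2 = [set x; y].

Let only u : u \in vset G1 -> u \in vset G2 -> (u == x) || (u == y).
Proof.
move=> u1 u2; have : u \in vset G1 :&: vset G2 by rewrite inE u1.
by rewrite meet !inE.
Qed.

(** The colouring of [G2] is flipped if necessary to agree with that of [G1] at
    [y], the only common vertex once [x] is removed. *)
Lemma clique_sum_off : exists f, coloured_off B x f.
Proof.
have off1 := extension_off ext.
pose f u := if u \in vset G1 then g1 u else g2 u (+) (g2 y (+) g1 y).
have f2 u : u \in vset G2 -> u != x -> f u = g2 u (+) (g2 y (+) g1 y).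
  move=> u2 ux; rewrite /f; case: ifP => // u1; have := only u1 u2.
  by rewrite (negPf ux) /= => /eqP->; rewrite addKb.
exists f => u v ux vx; rewrite adjB => /orP[uv|uv]; have /andP[uV vV] := adj_vset uv.
  by rewrite /f uV vV; exact: off1.
rewrite !f2 //; move: (g2 y (+) g1 y) (col2 uv) => d.
by case: (g2 u); case: (g2 v); case: d.
Qed.

Let side (i : bool) := if i then G1 else G2.

Let apex i u : (u == x) || (u == y) -> u \in vset (side i).
Proof.
move=> uxy; have : u \in vset G1 :&: vset G2 by rewrite meet !inE.
by rewrite inE => /andP[u1 u2]; case: i.
Qed.

Let side_uniq i j u : u \in vset (side i) -> u \in vset (side j) ->
  (u != x) && (u != y) -> i = j.
Proof.
by case: i; case: j => //= h1 h2; rewrite -negb_or; rewrite only.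
Qed.

Let adj_side_of u v : adj B u v -> exists i, adj (side i) u v.
Proof. by rewrite adjB => /orP[]; [exists true|exists false]. Qed.

Let adj_side i u v : adj B u v -> u \in vset (side i) -> v \in vset (side i) ->
  adj (side i) u v.
Proof.
move=> /[dup] uvB /adj_side_of[j uv] ui vi; have /andP[uj vj] := adj_vset uv.
case: (eqVneq i j) => [->//|ij].
have ap w : w \in vset (side i) -> w \in vset (side j) -> (w == x) || (w == y).
  move=> wi wj; apply: contraTT ij; rewrite negb_or negbK => h.
  exact/eqP/(side_uniq wi wj h).
have uDv := adj_neq uv; have [_ _ _ _ adj1] := ext.
suff [xyi yxi] : adj (side i) x y /\ adj (side i) y x.
  by case/orP: (ap u ui uj) uDv => /eqP->; case/orP: (ap v vi vj) => /eqP->; rewrite ?eqxx.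
rewrite (adj_sym (side i) y); case: (i) => /=; last by rewrite xy2.
by rewrite adj1 eqxx orbT.
Qed.

(** A walk that avoids the two vertices of the clique stays on one side. *)
Let one_side i u p : u \in vset (side i) -> path (adj B) u p ->
  (forall w, w \in u :: p -> (w != x) && (w != y)) ->
  forall w, w \in u :: p -> w \in vset (side i).
Proof.
elim: p u => [|v p IHp] u ui /=; first by move=> _ _ w; rewrite inE => /eqP->.
case/andP => uv pth away w; rewrite inE => /orP[/eqP->//|wv].
have [j uvj] := adj_side_of uv; have /andP[uj vj] := adj_vset uvj.
have ij := side_uniq ui uj (away u (mem_head _ _)).
apply: IHp wv => //; first by rewrite ij.
by move=> w' w'v; apply: away; rewrite inE w'v orbT.
Qed.

Let arc_path i p : path (adj B) x (rcons p y) -> (forall w, w \in p -> w \in vset (side i)) ->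
  path (adj (side i)) x (rcons p y).
Proof.
move=> pth ps; apply: (sub_in_path (P := mem (vset (side i)))) pth.
  by move=> u v ui vi uv; exact: adj_side.
apply/allP => w; rewrite inE mem_rcons inE => /or3P[/eqP->|/eqP->|/ps//];
  by apply: apex; rewrite eqxx ?orbT.
Qed.

(** An arc inside [G1] has even length because [x] and [y] have the same colour
    in [K1]; an arc inside [G2] has odd length because they are adjacent. *)
Let arc_parity i p : path (adj B) x (rcons p y) -> p != [::] ->
  (forall w, w \in p -> (w != x) && (w != y)) ->
  (forall w, w \in p -> w \in vset (side i)) -> odd (size p) = i.
Proof.
move=> pth np away ps; have {pth} := arc_path pth ps; case: i ps => /= ps pth; last first.
  have := colour_walk (f := g2) (fun u v _ _ => @col2 u v) pth.
  rewrite last_rcons size_rcons; have := col2 xy2.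
  by move=> /=; case: (g2 x); case: (g2 y); case: odd.
have [col1 _ _ gxy adj1] := ext.
have inK u v : adj G1 u v -> (u \in p) || (v \in p) -> adj K1 u v.
  rewrite adj1 => /orP[//|/eqP/eq_set2 e] /orP[] h; have := away _ h;
    by case: e => -[-> ->]; rewrite eqxx ?andbF.
have pthK : path (adj K1) x (rcons p y).
  case: p np away ps pth inK => [|z p] //= _ away ps /andP[xz pth] inK.
  rewrite inK ?mem_head ?orbT //=; move: pth; rewrite !rcons_path => /andP[pth ly].
  rewrite inK ?mem_last // andbT.
  apply: (sub_in_path (P := mem (z :: p))) pth; last exact/allP.
  by move=> u v uz vz uv; apply: inK; rewrite ?uz.
have := colour_walk (f := g1) (fun u v _ _ => @col1 u v) pthK.
rewrite last_rcons size_rcons gxy /=; by case: (g1 y); case: odd.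
Qed.

Hypothesis short1 : even_cycles_short G1.

Let side_cycle i c : cycle (adj B) c -> uniq c -> ~~ odd (size c) ->
  (forall w, w \in c -> w \in vset (side i)) -> size c <= 4.
Proof.
move=> cyc un ev ci; have cyc' : cycle (adj (side i)) c.
  apply: (sub_in_cycle (P := mem c)) cyc; last exact/allP.
  by move=> u v uc vc uv; apply: adj_side; rewrite ?ci.
by case: i cyc' {ci} => cyc'; [exact: short1|exact: short2].
Qed.

Let inside u p : path (adj B) u p -> (forall w, w \in p -> (w != x) && (w != y)) ->
  exists i, forall w, w \in p -> w \in vset (side i).
Proof.
case: p => [|v p] /=; first by exists true.
case/andP => uv pth away; have [i uvi] := adj_side_of uv; have /andP[_ vi] := adj_vset uvi.
by exists i; exact: one_side.
Qed.

Let through_one z p : (z == x) || (z == y) -> cycle (adj B) (z :: p) -> uniq (z :: p) ->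
  ~~ odd (size p).+1 -> (forall w, w \in p -> (w != x) && (w != y)) -> (size p).+1 <= 4.
Proof.
move=> zxy cyc un ev away.
have pth : path (adj B) z p by move: cyc; rewrite /= rcons_path => /andP[].
have [i pi] := inside pth away.
apply: (side_cycle (i := i) (c := z :: p)) => // w; rewrite inE => /orP[/eqP->|]; last exact: pi.
exact: apex.
Qed.

(** An even cycle cannot have one arc on each side, so it lies in [G1] or in
    [G2]. *)
Lemma clique_sum_even : even_cycles_short B.
Proof.
move=> c cyc un ev; case: (boolP (x \in c)) => xc; last first.
  case: (boolP (y \in c)) => yc.
    have [p [cp up sp mp]] := rot_to_cycle yc cyc un; rewrite sp in ev *.
    apply: (@through_one y) => // [|w wp]; first by rewrite eqxx orbT.
    apply/andP; split; first by apply: contraNneq xc => <-; rewrite mp inE wp orbT.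
    by apply: contraTneq wp => ->; case/andP: up.
  case: c cyc un ev xc yc => [//|u p] cyc un ev xc yc.
  have pth : path (adj B) u (rcons p u) := cyc.
  have [|i pi] := inside pth.
    move=> w; rewrite mem_rcons => wp; apply/andP; split.
      by apply: contraNneq xc => <-.
    by apply: contraNneq yc => <-.
  by apply: (side_cycle (i := i)) => // w; rewrite -mem_rcons; exact: pi.
have [p [cp up sp mp]] := rot_to_cycle xc cyc un; rewrite sp in ev *.
case: (boolP (y \in p)) => yp; last first.
  apply: (@through_one x) => // [|w wp]; first by rewrite eqxx.
  apply/andP; split; first by apply: contraTneq wp => ->; case/andP: up.
  by apply: contraNneq yp => <-.
have [p1 [p2 ep]] := mem_split yp; rewrite {}ep in cp up ev yp *.
have /uniq_countP up' := up.
have [pth1 pth2] : path (adj B) x (rcons p1 y) /\ path (adj B) y (rcons p2 x).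
  by move: cp; rewrite /= rcons_cat /= -cat_rcons cat_path last_rcons => /andP[].
have away1 w : w \in p1 -> (w != x) && (w != y).
  move=> wp; move: up; rewrite /= mem_cat cat_uniq negb_or => /and5P[/andP[xp _] _ yp1 _ _].
  apply/andP; split; first by apply: contraNneq xp => <-.
  by apply: contraNneq yp1 => e; apply/hasP; exists y; rewrite ?mem_head //= -e.
have away2 w : w \in p2 -> (w != x) && (w != y).
  move=> wp; move: up; rewrite /= mem_cat cat_uniq negb_or inE negb_or /=.
  case/and5P=> /and3P[_ _ xp] _ _ yp2 _.
  apply/andP; split; first by apply: contraNneq xp => <-.
  by apply: contraNneq yp2 => <-.
have pth1' : path (adj B) x p1 by move: pth1; rewrite rcons_path => /andP[].
have pth2' : path (adj B) y p2 by move: pth2; rewrite rcons_path => /andP[].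
have [i pi] := inside pth1' away1; have [j pj] := inside pth2' away2.
have both k : (forall w, w \in p1 -> w \in vset (side k)) ->
    (forall w, w \in p2 -> w \in vset (side k)) -> (size (p1 ++ y :: p2)).+1 <= 4.
  move=> h1 h2; apply: (side_cycle (i := k) (c := x :: p1 ++ y :: p2)) => // w.
  rewrite inE mem_cat inE => /orP[/eqP->|/or3P[|/eqP->|]]; [|exact: h1| |exact: h2];
    by apply: apex; rewrite eqxx ?orbT.
case: (eqVneq p1 [::]) => [e1|n1]; first by apply: (both j) => //; rewrite e1.
case: (eqVneq p2 [::]) => [e2|n2]; first by apply: (both i) => //; rewrite e2.
case: (eqVneq i j) => [ij|nij]; first by apply: (both i) => //; rewrite ij.
have o1 := arc_parity pth1 n1 away1 pi.
have o2 : odd (size (rev p2)) = j.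
  apply: arc_parity; rewrite ?(path_rev_sym (@adj_sym T B)) //.
  - by rewrite -size_eq0 size_rev size_eq0.
  - by move=> w; rewrite mem_rev; exact: away2.
  - by move=> w; rewrite mem_rev; exact: pj.
rewrite size_rev in o2; move: ev nij; rewrite size_cat /= !(oddD, oddS) /= o1 o2.
by case: (i); case: (j).
Qed.

End Off.
End CliqueSum.

Lemma double_K2_condition r s B : is_double_K2 r s B ->
  exists a f, a \in vset B /\ cycle_condition B a f.
Proof.
case=> G1 [G2 [E [K2p [ss K2] EG2 meet [eV eE]]]].
have [K [g [x [y [ext [eE' xK yK eV1]]]]]] := K2_plus_extension K2p.
have K22 : is_K2 s G2 by [].
have [A [A' [/colour_bipartition col _ _ _]]] := K2.
have adjB u v : adj B u v = adj G1 u v || adj G2 u v.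
  by rewrite /adj /= eE inE.
have short2 := K2_short K22; rewrite {}eE' in EG2 meet.
have ext' := odd_edge_extensionC ext; have [_ _ xy _ _] := ext.
have [f off] := clique_sum_off adjB col ext meet.
have [f' off'] : exists f', coloured_off B y f'.
  by apply: (clique_sum_off adjB col ext'); rewrite // setUC.
exists x, f; split; first by rewrite eV inE eV1 xK.
split=> //; last exact: meet_again_at_two xy off off'.
exact: (clique_sum_even adjB col short2 ext EG2 meet (extension_even ext)).
Qed.

End Families.

Section Identification.
Variables (U : finType) (R : sgraph U) (x1 x2 : U).
Local Notation I := (identify R x1 x2).

Lemma adj_identifyN u : adj I None (Some u) =
  [&& u \in vset R, u != x1, u != x2 & adj R u x1 || adj R u x2].
Proof.
rewrite /adj /= inE; apply/orP/and4P => [[/imsetP[E _ e]|/imsetP[w]]|[uV u1 u2 uadj]].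
- by have := set21 None (Some u); rewrite e => /imsetP[].
- rewrite !inE negb_or => /andP[/andP[/andP[w1 w2] wV] wadj] /eq_set2[[]//|[_ [->]]].
  by [].
right; apply/imsetP; exists u; last by rewrite setUC.
by rewrite !inE negb_or u1 u2 uV.
Qed.

Lemma adj_identifyS u v : adj I (Some u) (Some v) =
  [&& adj R u v, u != x1, u != x2, v != x1 & v != x2].
Proof.
have SE a b : [set Some z | z in [set a; b]] = [set Some a; Some b] :> {set option U}.
  by rewrite imsetU1 imset_set1.
rewrite /adj /= inE; apply/orP/and5P => [[/imsetP[E]|/imsetP[w _ e]]|[uv u1 u2 v1 v2]].
- rewrite inE => /and3P[/mem_eset[a [b [ab ->]]]]; rewrite !inE !negb_or SE.
  move=> /andP[a1 b1] /andP[a2 b2] /eq_set2[] [[->] [->]].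
    by rewrite (ab : [set a; b] \in eset R) !(eq_sym _ x1) !(eq_sym _ x2) a1 a2 b1 b2.
  rewrite [[set b; a]]setUC (ab : [set a; b] \in eset R).
  by rewrite !(eq_sym _ x1) !(eq_sym _ x2) a1 a2 b1 b2.
- by case: (eq_set2 e) => -[].
left; apply/imsetP; exists [set u; v]; last by rewrite SE.
by rewrite inE [_ \in eset R]uv !inE !negb_or ![x1 == _]eq_sym ![x2 == _]eq_sym u1 u2 v1 v2.
Qed.

Lemma adj_identifyNN : adj I None None = false.
Proof. exact: adj_irr. Qed.

Variable g : U -> bool.
Hypotheses (colR : coloured R g) (g12 : g x1 != g x2) (shortR : short_cycles R).

Let end_vertex (i : bool) := if i then x1 else x2.

Let some_inj : injective (@Some U). Proof. by move=> a b []. Qed.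

(** The indices [i] and [j] record which of the two identified vertices the
    first and the last edge of the cycle come from. *)
Lemma cycle_identifyN p : cycle (adj I) (None :: p) -> uniq (None :: p) -> p != [::] ->
  exists p' i j, [/\ p = map Some p', path (adj R) (end_vertex i) (rcons p' (end_vertex j)),
    uniq p', x1 \notin p' & x2 \notin p'].
Proof.
rewrite cons_uniq => cyc /andP[np up] pnil.
have [p' ep] : exists p', p = map Some p'.
  elim: p np {cyc up pnil} => [|[u|] p IHp]; rewrite ?inE //; first by exists [::].
  by move/IHp => [p' ->]; exists (u :: p').
exists p'; rewrite {}ep {np} in cyc up pnil *; rewrite (map_inj_uniq some_inj) in up.
case: p' cyc up pnil => [//|u p'] cyc up _.
have {cyc} : adj I None (Some u) && path (adj I) (Some u) (map Some p') &&
    adj I (Some (last u p')) None.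
  by move: cyc; rewrite /= rcons_path last_map andbA.
rewrite [adj I _ None]adj_sym !adj_identifyN => /andP[/andP[/and4P[uV u1 u2 uadj] pth]].
case/and4P => lV l1 l2 ladj.
have exi w : adj R w x1 || adj R w x2 -> exists i, adj R w (end_vertex i).
  by case/orP; [exists true|exists false].
have [i ui] := exi _ uadj; have [j lj] := exi _ ladj.
have [pR [p1 p2]] : path (adj R) u p' /\ (x1 \notin u :: p') /\ (x2 \notin u :: p').
  elim: p' u u1 u2 pth {up lV l1 l2 ladj lj uV uadj ui} => [|v p' IHp] u u1 u2 /=.
    by rewrite !inE eq_sym u1 eq_sym u2.
  rewrite adj_identifyS => /andP[/and5P[uv _ _ v1 v2] /(IHp _ v1 v2)[-> [h1 h2]]].
  split; first by rewrite uv.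
  by split; rewrite in_cons negb_or eq_sym ?u1 ?u2.
exists i, j; split=> //; by rewrite /= adj_sym ui rcons_path pR lj.
Qed.

Lemma identify_path_parity p i j : path (adj R) (end_vertex i) (rcons p (end_vertex j)) ->
  odd (size p) = (i == j).
Proof.
move=> pth; have := colour_walk (f := g) (fun u v _ _ => @colR u v) pth.
rewrite last_rcons size_rcons /=; move: g12; rewrite /end_vertex.
by case: (i); case: (j) => /=; case: (g x1); case: (g x2); case: odd.
Qed.

Lemma end_vertex_notin i (p : seq U) : x1 \notin p -> x2 \notin p -> end_vertex i \notin p.
Proof. by case: i. Qed.

(** An even cycle through the identified vertex comes from a cycle of [R], an
    odd one from a path between [x1] and [x2]. Two such paths that meet only at
    their ends would form a cycle of [R] with at least six vertices. *)
Lemma identify_condition : exists f, cycle_condition I None f.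
Proof.
exists (fun z => if z is Some u then g u else true); split.
- move=> c cyc un ev; case: (boolP (None \in c)) => nc; last first.
    have [c' ec] : exists c', c = map Some c'.
      elim: c nc {cyc un ev} => [|[u|] c IHc]; rewrite ?inE //; first by exists [::].
      by move/IHc => [c' ->]; exists (u :: c').
    rewrite {}ec {nc ev} in cyc un *; rewrite size_map; apply: shortR; last first.
      by rewrite (map_inj_uniq some_inj) in un.
    case: c' cyc {un} => //= u c'; rewrite -map_rcons path_map; apply: sub_path => a b /=.
    by rewrite adj_identifyS => /and5P[].
  have [p [cp up sp _]] := rot_to_cycle nc cyc un; rewrite sp in ev *.
  case: (eqVneq p [::]) => [->//|pnil].
  have [p' [i [j [ep pth up' p1 p2]]]] := cycle_identifyN cp up pnil.
  rewrite {}ep size_map in ev *; have par := identify_path_parity pth.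
  have ij : i = j by apply/eqP; rewrite -par; move: ev => /=; rewrite negbK.
  apply: (shortR (c := end_vertex i :: p')); first by rewrite ij in pth *.
  by rewrite cons_uniq up' end_vertex_notin.
- move=> [u|] [v|] // _ _; rewrite adj_identifyS => /and5P[uv _ _ _ _]; exact: colR.
have odd_path p : cycle (adj I) (None :: p) -> uniq (None :: p) -> odd (size p).+1 ->
    exists p', [/\ path (adj R) x1 (rcons p' x2), forall z, (Some z \in p) = (z \in p'),
      1 < size p' & [/\ uniq p', x1 \notin p' & x2 \notin p']].
  move=> cp up op; have pnil : p != [::].
    by apply: contraTneq cp => ->; rewrite /= adj_identifyNN.
  have [p' [i [j [ep pth up' p1 p2]]]] := cycle_identifyN cp up pnil.
  have par := identify_path_parity pth; rewrite ep size_map /= in op pnil.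
  have sp : 1 < size p' by case: (p') op pnil => [|? []].
  have mem z : (Some z \in p) = (z \in p') by rewrite ep mem_map.
  rewrite par in op; case: i j pth op {par} => -[] // pth _; first by exists p'.
  exists (rev p'); rewrite !mem_rev rev_uniq size_rev; split=> //.
    exact: path_rev_sym (@adj_sym U R) _ _ _ pth.
  by move=> z; rewrite mem_rev.
move=> p q cp up op cq uq oq.
have [p' [pth mp sp [up' p1 p2]]] := odd_path p cp up op.
have [q' [qth mq sq [uq' q1 q2]]] := odd_path q cq uq oq.
case: (boolP (has (mem p') q')) => [/hasP[z zq /= zp]|dis].
  by apply/hasP; exists (Some z); rewrite ?mq //= mp.
have cyc : cycle (adj R) (x1 :: p' ++ x2 :: rev q').
  rewrite /= rcons_cat rcons_cons -cat_rcons cat_path pth last_rcons.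
  exact: path_rev_sym (@adj_sym U R) _ _ _ qth.
have x12 : x1 != x2 by apply: contraNneq g12 => ->.
have un : uniq (x1 :: p' ++ x2 :: rev q').
  rewrite cons_uniq mem_cat inE mem_rev !negb_or p1 x12 q1 /=.
  rewrite cat_uniq up' cons_uniq mem_rev q2 rev_uniq uq' /= negb_or p2 andbT /=.
  by rewrite has_rev.
have := shortR cyc un; rewrite /= size_cat /= size_rev.
move: sp sq; case: (size p') => [|[|m]] //; case: (size q') => [|[|k]] // _ _.
by rewrite !addSn !addnS.
Qed.

End Identification.

Lemma necklace_condition (T : finType) (B : sgraph T) : is_necklace_K2 B ->
  exists a f, a \in vset B /\ cycle_condition B a f.
Proof.
case=> U [R [B1 [Bk [Bs [x1 [x2 [[bipR _] shape _ [_ [d [[p [pth lp sp]] _] od]] iso]]]]]]].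
have [g colR] := (bipartiteP R).1 bipR.
have shortR := short_blocks_short shape.
have g12 : g x1 != g x2.
  have := colour_walk (f := g) (fun u v _ _ => @colR u v) pth.
  by rewrite lp sp od; case: (g x1) => ->.
have [f cond] := identify_condition colR g12 shortR.
case: iso => F [[F' FK F'K] Fadj].
pose h (y : T) : option U := if insub y is Some y' then val (F' y') else None.
have hE (y : {y | y \in vset B}) : h (val y) = val (F' y) by rewrite /h valK.
have inV : None \in vset (identify R x1 x2) by rewrite !inE.
pose a := F (Sub None inV).
exists (val a), (f \o h); split; first exact: valP.
apply: (cycle_condition_hom (h := h) (I := identify R x1 x2)).
- move=> y z yV zV; rewrite -[y]/(val (Sub y yV : {y | y \in vset B})).
  rewrite -[z]/(val (Sub z zV : {y | y \in vset B})) !hE => /val_inj/(can_inj F'K) -> //.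
- move=> y z yz; have /andP[yV zV] := adj_vset yz.
  move: yz; rewrite -[y]/(val (Sub y yV : {y | y \in vset B})).
  rewrite -[z]/(val (Sub z zV : {y | y \in vset B})) !hE Fadj !F'K.
  exact.
- exact: valP.
by rewrite hE FK.
Qed.

(** * Chains of blocks *)

Lemma zip_behead_map (A : Type) (f : nat -> A) a n :
  zip (map f (iota a n.+1)) (behead (map f (iota a n.+1))) =
  [seq (f k, f k.+1) | k <- iota a n].
Proof. by elim: n a => //= n IHn a; congr cons; exact: IHn. Qed.

(** When [x1] and [x2] arise from one vertex of a biconnected graph, every
    cut vertex of [R] separates them, and no part of [R] that it cuts off misses
    both: this is the hypothesis [reach]. *)
Section Chain.
Variables (U : finType) (R : sgraph U) (x1 x2 : U).
Local Notation V := (vset R).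
Local Notation off c := (adj (del_vertex R c)).
Hypotheses (conR : connected R) (x1V : x1 \in V) (x2V : x2 \in V).
Hypotheses (ncut1 : ~~ cut_vertex R x1) (ncut2 : ~~ cut_vertex R x2).
Hypothesis reach : forall c v, v \in V -> c != x1 -> c != x2 -> v != c ->
  connect (off c) x1 v || connect (off c) x2 v.

Let off_sym c : connect_sym (off c).
Proof. exact: connect_adj_sym. Qed.

Lemma path_off c u p : path (adj R) u p -> c \notin u :: p -> path (off c) u p.
Proof.
elim: p u => //= v p IHp u /andP[uv pth]; rewrite !inE !negb_or => /and3P[cu cv cp].
by rewrite adj_del uv eq_sym cu eq_sym cv IHp // inE negb_or cv.
Qed.

Lemma connect_off_self c u : connect (off c) u c -> u = c.
Proof.
rewrite off_sym => /connectP[[|v p] /=]; first by [].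
by rewrite adj_del eqxx andbF.
Qed.

(** The part of [R - a] around [s] persists in [R - b] when it misses [b]. *)
Lemma connect_off_other a b s v :
  connect (off a) s v -> ~~ connect (off a) s b -> connect (off b) s v.
Proof.
case/connectP => p pth -> nb; apply/connectP; exists p => //.
apply: path_off; first by apply: sub_path pth => u w; rewrite adj_del => /and3P[].
by apply: contra nb => bp; exact: (path_connect pth).
Qed.

Lemma left_pairwise p : path (adj R) x1 p -> uniq (x1 :: p) ->
  pairwise (fun a b => connect (off b) x1 a) p.
Proof.
elim/last_ind: p => // p b IHp; rewrite rcons_path -rcons_cons rcons_uniq pairwise_rcons.
case/andP => pth _ /andP[bp un]; rewrite IHp // andbT; apply/allP => a ap /=.
by apply: (path_connect (path_off pth bp)); rewrite inE ap orbT.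
Qed.

Lemma right_pairwise u p : path (adj R) u p -> uniq p ->
  pairwise (fun a b => connect (off a) (last u p) b) p.
Proof.
elim: p u => // a p IHp u; rewrite [last _ _]/= [path _ _ _]/= cons_uniq => /andP[_ pth] /andP[ap un].
rewrite pairwise_cons IHp // andbT; apply/allP => b bp.
case: p pth ap bp {IHp un} => [//|c p] /= /andP[_ pth] ap bp.
have con := path_connect (path_off pth ap).
by apply: connect_trans (con b bp); rewrite off_sym con // mem_last.
Qed.

Section AlongPath.
Variable p : seq U.
Hypotheses (pth : path (adj R) x1 p) (unp : uniq (x1 :: p)) (lp : last x1 p = x2).

Let cs := [seq c <- p | cut_vertex R c].
Let m := size cs.
Let c_ i := nth x1 cs i.
Let left c v := connect (off c) x1 v.
Let right c v := connect (off c) x2 v.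

Let cut_neq c : cut_vertex R c -> (c != x1) && (c != x2).
Proof.
move=> cc; apply/andP; split; first by apply: contraNneq ncut1 => <-.
by apply: contraNneq ncut2 => <-.
Qed.

Let cut_separates c : cut_vertex R c -> ~~ connect (off c) x1 x2.
Proof.
move=> cc; apply/negP => con; have /andP[c1 c2] := cut_neq cc.
have /(cut_vertexP _ conR)[_ [y [z [yV zV yc zc]]]] := cc; case/negP.
have toy v : v \in V -> v != c -> connect (off c) x1 v.
  by move=> vV vc; case/orP: (reach vV c1 c2 vc) => // h; exact: connect_trans con h.
by apply: connect_trans (toy z zV zc); rewrite off_sym toy.
Qed.

Let cut_in_cs c : cut_vertex R c = (c \in cs).
Proof.
rewrite mem_filter; case: (boolP (cut_vertex R c)) => //= cc.
have /andP[c1 _] := cut_neq cc; apply/esym; apply: contraT => cp.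
case/negP: (cut_separates cc); rewrite -lp; apply: (path_connect (path_off pth _)); last exact: mem_last.
by rewrite inE negb_or c1.
Qed.

Let cut_c i : i < m -> cut_vertex R (c_ i).
Proof. by move=> im; rewrite cut_in_cs mem_nth. Qed.

Let c_V i : i < m -> c_ i \in V.
Proof. by move/cut_c; rewrite /cut_vertex => /andP[]. Qed.

Let csP c : cut_vertex R c -> exists2 j, j < m & c = c_ j.
Proof. by rewrite cut_in_cs => /(nthP x1)[j jm <-]; exists j. Qed.

Let left_c i j : i < j -> j < m -> left (c_ j) (c_ i).
Proof.
move=> ij jm; have /(pairwiseP x1) := pairwise_filter (fun c => cut_vertex R c) (left_pairwise pth unp).
by apply; rewrite // inE (ltn_trans ij).
Qed.

Let right_c i j : i < j -> j < m -> right (c_ i) (c_ j).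
Proof.
move=> ij jm; have unp' : uniq p by case/andP: unp.
have /(pairwiseP x1) := pairwise_filter (fun c => cut_vertex R c) (right_pairwise pth unp').
by rewrite lp; apply; rewrite // inE (ltn_trans ij).
Qed.

Let not_both i v : i < m -> left (c_ i) v -> right (c_ i) v -> False.
Proof.
move=> im l r; case/negP: (cut_separates (cut_c im)).
by apply: connect_trans l _; rewrite off_sym.
Qed.

Let one_side i v : i < m -> v \in V -> v != c_ i -> left (c_ i) v || right (c_ i) v.
Proof. by move=> im vV vc; have /andP[a b] := cut_neq (cut_c im); exact: reach. Qed.

Let left_self i : i < m -> left (c_ i) (c_ i) = false.
Proof.
move=> im; apply/negP => /connect_off_self e; have /andP[a _] := cut_neq (cut_c im).
by rewrite -e eqxx in a.
Qed.

Let right_self i : i < m -> right (c_ i) (c_ i) = false.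
Proof.
move=> im; apply/negP => /connect_off_self e; have /andP[_ a] := cut_neq (cut_c im).
by rewrite -e eqxx in a.
Qed.

Let right_mono i j v : i < j -> j < m -> right (c_ j) v -> right (c_ i) v.
Proof.
move=> ij jm r; apply: connect_off_other r _; apply/negP => r.
exact: not_both jm (left_c ij jm) r.
Qed.

(** The vertices between consecutive cut vertices [c_ i.-1] and [c_ i]. *)
Let V_ i := [set v in V | [forall j : 'I_m,
  if j < i then ~~ left (c_ j) v else ~~ right (c_ j) v]].
Let D_ i := mkgraph (V_ i) (adj R).

Let V_P i v : reflect [/\ v \in V, forall j, j < m -> j < i -> ~~ left (c_ j) v &
   forall j, j < m -> i <= j -> ~~ right (c_ j) v] (v \in V_ i).
Proof.
rewrite inE; apply: (iffP andP) => [[vV /forallP h]|[vV h1 h2]]; split=> //.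
- by move=> j jm ji; have := h (Ordinal jm); rewrite /= ji.
- by move=> j jm ji; have := h (Ordinal jm); rewrite /= ltnNge ji.
by apply/forallP => j; case: ltnP => ji; [exact: h1|exact: h2].
Qed.

Let adj_D i u v : adj (D_ i) u v = [&& u \in V_ i, v \in V_ i & adj R u v].
Proof.
rewrite adj_mkgraph; last exact: adj_sym.
by case: (eqVneq u v) => //= ->; rewrite adj_irr !andbF.
Qed.

Let D_sub i : subgraph (D_ i) R.
Proof.
apply/subgraphP; split=> [|u v]; last by rewrite adj_D => /and3P[].
by apply/subsetP => v /V_P[].
Qed.

(** Removing a cut vertex leaves the other vertices of [H] on one side of it;
    [H] lies between the last cut vertex on its left and the next one. *)
Let biconnected_in_D H : subgraph H R -> biconnected H -> exists2 i, i <= m & vset H \subset V_ i.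
Proof.
move=> /subgraphP[HV HA] /biconnectedP[_ _ cutH].
pose P c := ~~ [exists v in vset H, right c v].
exists (find P cs); first exact: find_size.
apply/subsetP => v vH; apply/V_P; split; first exact: (subsetP HV).
  move=> j jm jf; have := before_find x1 jf; rewrite /P => /negbFE/exists_inP[w wH rw].
  apply/negP => lv; apply: (not_both jm _ rw); apply: (connect_trans lv).
  apply: (@connect_subrel _ (adj (del_vertex H (c_ j)))).
    by move=> a b; rewrite !adj_del => /and3P[/HA-> -> ->].
  apply: cutH => //; apply/eqP => e.
    by move: lv; rewrite e left_self.
  by move: rw; rewrite e right_self.
move=> j jm fj; have fm : find P cs < m by exact: leq_ltn_trans jm.
have := nth_find x1 (_ : has P cs); rewrite has_find => /(_ fm)/exists_inPn/(_ v vH) h.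
apply: contra h; move: fj; rewrite leq_eqVlt => /orP[/eqP->//|fj].
exact: right_mono fj jm.
Qed.

(** A path that enters and leaves the part around [s] passes through [c] twice;
    so a path between two vertices of [V_ i] does not leave [V_ i]. *)
Let stays s c y q : s != c -> path (adj R) y q -> uniq (y :: q) ->
  ~~ connect (off c) s y -> ~~ connect (off c) s (last y q) ->
  forall w, w \in y :: q -> ~~ connect (off c) s w.
Proof.
move=> sc pq uq ny nl w; rewrite inE => /orP[/eqP->//|wq].
have [q1 [q2 eq_q]] := mem_split wq; apply/negP => sw.
have nwc : w != c by apply: contraNneq sc => e; rewrite e in sw; rewrite (connect_off_self sw).
move: pq uq nl; rewrite eq_q cat_path last_cat /= => /and3P[p1 wl p2].
rewrite mem_cat inE !negb_or cat_uniq /= => /andP[/and3P[yq1 _ yq2] /and3P[_ /norP[_ h] /andP[wq2 _]]] nl.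
have c1 : c \in y :: q1.
  apply: contraT => nc; case/negP: ny; apply: connect_trans sw _; rewrite off_sym.
  apply: (path_connect (p := rcons q1 w)); last by rewrite inE mem_rcons mem_head orbT.
  by apply: path_off; rewrite ?rcons_path ?p1 // -rcons_cons mem_rcons inE negb_or eq_sym nwc.
have c2 : c \in w :: q2.
  apply: contraT => nc; case/negP: nl; apply: connect_trans sw _.
  by apply: (path_connect (path_off p2 nc)); exact: mem_last.
move: c2; rewrite inE eq_sym (negPf nwc) /= => c2.
move: c1; rewrite inE => /orP[/eqP e|c1]; first by rewrite -e c2 in yq2.
by case/hasP: h; exists c.
Qed.

Let V_stays i y q : path (adj R) y q -> uniq (y :: q) -> y \in V_ i -> last y q \in V_ i ->
  forall w, w \in y :: q -> w \in V_ i.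
Proof.
move=> pq uq /V_P[yV y1 y2] /V_P[_ l1 l2] w wq; apply/V_P; split.
- by apply: connect_vset yV; exact: path_connect wq.
- move=> j jm ji; apply: (stays _ pq uq) => //; [|exact: y1|exact: l1].
  by have /andP[a _] := cut_neq (cut_c jm); rewrite eq_sym.
move=> j jm ji; apply: (stays _ pq uq) => //; [|exact: y2|exact: l2].
by have /andP[_ a] := cut_neq (cut_c jm); rewrite eq_sym.
Qed.

Let connect_in_D i (e : rel U) y z : subrel e (adj R) -> y \in V_ i -> z \in V_ i ->
  connect e y z -> connect [rel a b | e a b && adj (D_ i) a b] y z.
Proof.
move=> sub yV zV /connect_uniq_path[q [pq uq lq]].
have pq' : path (adj R) y q by apply: sub_path pq.
have inV := V_stays pq' uq yV; rewrite lq in inV; have {}inV := inV zV.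
apply/connectP; exists q => //; apply: (sub_in_path (P := mem (V_ i))) pq; last exact/allP.
by move=> a b aV bV ab /=; rewrite ab adj_D aV bV sub.
Qed.

(* two vertices of [V_ i] are on the same side of every cut vertex *)
Let D_biconnected i y0 : y0 \in V_ i -> biconnected (D_ i).
Proof.
move=> y0V; have [_ con] := connectedP _ conR; apply/biconnectedP; split.
- by apply/set0Pn; exists y0.
- move=> y z yV zV; have /V_P[yR _ _] := yV; have /V_P[zR _ _] := zV.
  apply: connect_subrel (connect_in_D (fun a b h => h) yV zV (con y z yR zR)).
  by move=> a b /andP[].
move=> v y z yV zV yv zv; have /V_P[yR y1 y2] := yV; have /V_P[zR z1 z2] := zV.
have cyz : connect (off v) y z.
  case: (boolP (cut_vertex R v)) => cv; last exact: noncut_connect conR cv yR zR yv zv.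
  have [j jm vj] := csP cv; rewrite {}vj in cv yv zv *; case: (ltnP j i) => ji.
    have ry : right (c_ j) y by have := one_side jm yR yv; rewrite (negPf (y1 j jm ji)).
    have rz : right (c_ j) z by have := one_side jm zR zv; rewrite (negPf (z1 j jm ji)).
    by apply: (connect_trans (y := x2)); rewrite // off_sym.
  have ly : left (c_ j) y by have := one_side jm yR yv; rewrite (negPf (y2 j jm ji)) orbF.
  have lz : left (c_ j) z by have := one_side jm zR zv; rewrite (negPf (z2 j jm ji)) orbF.
  by apply: (connect_trans (y := x1)); rewrite // off_sym.
apply: connect_subrel (connect_in_D _ yV zV cyz); last by move=> a b; rewrite adj_del => /and3P[].
by move=> a b /andP[]; rewrite !adj_del => /and3P[_ -> ->] ->.
Qed.

(* the ends of the [i]-th block in the chain *)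
Let lv i := nth x1 (x1 :: cs) i.
Let rv i := nth x2 cs i.

Let lv_left i : i < m -> left (c_ i) (lv i).
Proof.
case: i => [|i] im; first exact: connect0.
by rewrite /lv /=; exact: left_c.
Qed.

Let rv_right i j : i < j -> j <= m -> right (c_ i) (rv j).
Proof.
move=> ij jm; rewrite /rv; case: (ltnP j m) => jm'; last by rewrite nth_default //; exact: connect0.
by rewrite (set_nth_default x1) //; exact: right_c.
Qed.

Let lv_V i : i <= m -> lv i \in V_ i.
Proof.
case: i => [|i] im; apply/V_P.
  split=> // j jm _; apply/negP => r; apply: (not_both jm _ r); exact: connect0.
split; first exact: c_V.
  move=> j jm; rewrite ltnS leq_eqVlt => /orP[/eqP->|ji]; first by rewrite /lv /= left_self.
  by apply/negP => l; apply: (not_both jm l); exact: right_c.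
by move=> j jm ij; apply/negP => r; apply: (not_both jm _ r); exact: left_c.
Qed.

Let rv_V i : i <= m -> rv i \in V_ i.
Proof.
move=> im; apply/V_P; split.
- rewrite /rv; case: (ltnP i m) => im'; last by rewrite nth_default.
  by rewrite (set_nth_default x1) //; exact: c_V.
- by move=> j jm ji; apply/negP => l; apply: (not_both jm l); exact: rv_right.
move=> j jm ij; have im' := leq_ltn_trans ij jm; rewrite /rv (set_nth_default x1) //.
move: ij; rewrite leq_eqVlt => /orP[/eqP->|ij]; first by rewrite right_self.
by apply/negP => r; apply: (not_both jm _ r); exact: left_c.
Qed.

Let V_sub i k : i <= m -> k <= m -> V_ i \subset V_ k -> i = k.
Proof.
move=> im km sub; case: (ltngtP i k) => // ik.
  have im' := leq_trans ik km; have /V_P[_ h _] := subsetP sub _ (lv_V im).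
  by case/negP: (h i im' ik); exact: lv_left.
have km' := leq_trans ik im; have /V_P[_ _ h] := subsetP sub _ (rv_V im).
by case/negP: (h k km' (leqnn k)); exact: rv_right.
Qed.

Let c_in_V i j : i <= m -> j < m -> (c_ j \in V_ i) = (i == j) || (i == j.+1).
Proof.
move=> im jm; apply/idP/orP => [/V_P[_ h1 h2]|[]/eqP e].
- case: (ltngtP i j) => [ij|ji|->]; [|right|by left].
    by case/negP: (h2 i (ltn_trans ij jm) (leqnn i)); exact: right_c.
  rewrite eqn_leq ji andbT leqNgt; apply/negP => ji'.
  case: i im h1 ji' {ji h2} => // i im h1 ji'.
  by case/negP: (h1 i im (leqnn _)); exact: left_c.
- have := rv_V im; rewrite e /rv (set_nth_default x1) //.
by have := lv_V im; rewrite e.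
Qed.

Let blocks_D D : reflect (exists2 i, i <= m & D = D_ i) (D \in blocks R).
Proof.
apply: (iffP (blockP _ _)) => [[sD bD maxD]|[i im ->]].
  have [i im DV] := biconnected_in_D sD bD; exists i => //; apply/esym/maxD => //.
    exact: D_biconnected (lv_V im).
  have [_ DA] := subgraphP _ _ sD; apply/subgraphP; split=> // a b ab.
  by have /andP[aD bD'] := adj_vset ab; rewrite adj_D !(subsetP DV) // DA.
split; [exact: D_sub|exact: D_biconnected (lv_V im)|] => H sH bH DH.
have [k km HV] := biconnected_in_D sH bH; have /subgraphP[DHV _] := DH.
have ik : i = k by apply: V_sub => //; exact: subset_trans DHV HV.
have [_ HA] := subgraphP _ _ sH; apply: subgraph_anti => //; apply/subgraphP.
rewrite {1}ik; split=> // a b ab; have /andP[aH bH'] := adj_vset ab.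
by rewrite adj_D ik !(subsetP HV) // HA.
Qed.

(* the block tree as a path: blocks at even, cut vertices at odd positions *)
Let node k : (sgraph U + U)%type := if odd k then inr (c_ k./2) else inl (D_ k./2).

Let half_odd k : odd k -> k < m.*2.+1 -> k./2 < m.
Proof. by move=> ok; rewrite -{1}(odd_double_half k) ok add1n ltnS ltn_double. Qed.

Let half_le k : k < m.*2.+1 -> k./2 <= m.
Proof. by rewrite ltnS -{2}(doubleK m); exact: half_leq. Qed.

Let node_inj : {in gtn m.*2.+1 &, injective node}.
Proof.
move=> k l; rewrite !inE /= => km lm; rewrite /node.
have ek := odd_double_half k; have el := odd_double_half l.
case ok: (odd k); case ol: (odd l) => //; last first.
  move/(congr1 (fun z : sgraph U + U => if z is inl B then vset B else set0)) => /= e.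
  by rewrite -ek -el ok ol (@V_sub k./2 l./2) ?half_le // -[V_ k./2]/(vset (D_ _)) e.
move=> [] /eqP; rewrite nth_uniq ?half_odd // => [/eqP e|].
  by rewrite -ek -el ok ol e.
by rewrite filter_uniq //; case/andP: unp.
Qed.

Let nodes := map node (iota 0 m.*2.+1).

Let mem_nodes z : reflect (exists2 k, k < m.*2.+1 & z = node k) (z \in nodes).
Proof.
apply: (iffP mapP) => [[k]|[k km ->]]; first by rewrite mem_iota add0n => km ->; exists k.
by exists k; rewrite // mem_iota add0n.
Qed.

Let node_cut j : node j.*2.+1 = inr (c_ j).
Proof. by rewrite /node /= odd_double uphalf_double. Qed.

Let node_block i : node i.*2 = inl (D_ i).
Proof. by rewrite /node odd_double doubleK. Qed.

Let block_tree_path : is_path_graph (block_tree R) nodes.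
Proof.
split.
- by rewrite map_inj_in_uniq ?iota_uniq // => k l; rewrite !mem_iota !add0n; exact: node_inj.
- apply/setP => z; rewrite !inE; apply/orP/mem_nodes => [[]/imsetP[y]|[k km ->]].
  + move=> /blocks_D[i im ->] ->; exists i.*2; last by rewrite node_block.
    by rewrite ltnS leq_double.
  + rewrite inE => /csP[j jm ->] ->; exists j.*2.+1; last by rewrite node_cut.
    by rewrite ltnS ltn_double.
  rewrite /node; case ok: (odd k); [right|left]; apply: imset_f.
    by rewrite inE cut_c ?half_odd.
  by apply/blocks_D; exists k./2; rewrite ?half_le.
rewrite /nodes zip_behead_map; apply/setP => E; apply/idP/imsetP.
  case/imset2P => D u /blocks_D[i im ->]; rewrite inE inE => /andP[/csP[j jm ->]].
  rewrite /= c_in_V // => ij ->.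
  case/orP: ij => /eqP->.
    exists (node j.*2, node j.*2.+1); last by rewrite node_block node_cut.
    by apply/mapP; exists j.*2 => //; rewrite mem_iota add0n ltn_double.
  exists (node j.*2.+1, node j.*2.+2); last first.
    by rewrite node_cut -doubleS node_block setUC.
  by apply/mapP; exists j.*2.+1 => //; rewrite mem_iota add0n ltn_Sdouble.
case=> ab /mapP[k]; rewrite mem_iota add0n /= => km -> -> /=.
rewrite -{}(odd_double_half k) in km *; set i := k./2 in km *.
have im : i < m.
  by rewrite -ltn_double; apply: leq_ltn_trans km; rewrite leq_addl.
case: (odd k); rewrite ?add1n ?add0n -?doubleS ?node_cut !node_block.
  rewrite setUC; apply: imset2_f; first by apply/blocks_D; exists i.+1.
  rewrite inE; apply/andP; split; first by rewrite inE cut_c.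
  by change (c_ i \in V_ i.+1); rewrite c_in_V // eqxx orbT.
apply: imset2_f; first by apply/blocks_D; exists i; rewrite // ltnW.
rewrite inE; apply/andP; split; first by rewrite inE cut_c.
by change (c_ i \in V_ i); rewrite c_in_V ?eqxx // ltnW.
Qed.

Let blocks_of_nodes n : pmap (fun z => if z is inl B then Some B else None)
  (map node (iota 0 n.*2.+1)) = map D_ (iota 0 n.+1).
Proof.
elim: n => [|n IHn]; first by [].
rewrite doubleS -[n.*2.+3]addn1 iotaD map_cat pmap_cat -[n.*2.+2]addn1 iotaD map_cat pmap_cat IHn.
rewrite -[in RHS](addn1 n.+1) iotaD map_cat -catA; congr (_ ++ _).
by rewrite /= !add0n addn1 node_cut -doubleS node_block.
Qed.

Lemma block_chain_along_path c : cut_vertex R c ->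
  exists B1 Bs Bk, [/\ block_chain R (B1 :: rcons Bs Bk), x1 \in vset B1 & x2 \in vset Bk].
Proof.
move=> /csP[j jm _]; have m0 : 0 < m by exact: leq_ltn_trans jm.
have em : iota 1 m = rcons (iota 1 m.-1) m.
  by rewrite -[in LHS](prednK m0) -[m.-1.+1]addn1 iotaD /= add1n prednK // cats1.
exists (D_ 0), (map D_ (iota 1 m.-1)), (D_ m); split.
- exists nodes; first exact: block_tree_path.
  rewrite /nodes blocks_of_nodes /=; congr cons.
  by rewrite em map_rcons.
- exact: (lv_V (leq0n m)).
by have := rv_V (leqnn m); rewrite /rv nth_default.
Qed.

End AlongPath.

Lemma block_chain_exists c : cut_vertex R c ->
  exists B1 Bs Bk, [/\ block_chain R (B1 :: rcons Bs Bk), x1 \in vset B1 & x2 \in vset Bk].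
Proof.
have [_ con] := connectedP _ conR; have [p [pth un lp]] := connect_uniq_path (con _ _ x1V x2V).
exact: (block_chain_along_path pth un lp).
Qed.

End Chain.

(** * From the cycles to the block structure *)

Lemma connect_hom (T U : finType) (e : rel T) (e' : rel U) (h : T -> U) a b :
  (forall u v, e u v -> e' (h u) (h v)) -> connect e a b -> connect e' (h a) (h b).
Proof.
move=> hom /connectP[p pth ->]; apply/connectP; exists (map h p); last by rewrite last_map.
by rewrite path_map; apply: sub_path pth => u v; exact: hom.
Qed.

(** A block without edges would be a single vertex, properly contained in the
    block of an edge at this vertex. *)
Lemma block_edge (T : finType) (G B : sgraph T) a b :
  connected G -> adj G a b -> B \in blocks G -> exists u v, adj B u v.
Proof.
move=> conG ab BG; have [sB bB maxB] := blockP _ _ BG.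
have [/set0Pn[v vB] conB _] := biconnectedP _ bB.
case: (boolP [exists u, exists w, adj B u w]) => [/existsP[u /existsP[w uw]]|none]; first by exists u, w.
have noB u w : adj B u w = false.
  by apply/negP => uw; case/negP: none; apply/existsP; exists u; apply/existsP; exists w.
have [sV _] := subgraphP _ _ sB; have vG := subsetP sV v vB.
have [t tG tv] : exists2 t, t \in vset G & t != v.
  have /andP[aG bG] := adj_vset ab; case: (eqVneq a v) => [e|]; last by exists a.
  by exists b; rewrite // -e eq_sym (adj_neq ab).
have [w vw] : exists w, adj G v w.
  have [_ con] := connectedP _ conG; have /connectP[[|w p]] := con v t vG tG.
    by move=> _ e; rewrite e eqxx in tv.
  by case/andP => vw _ _; exists w.
have [||||D DG [cD DV]] := @cycle_in_block _ G [:: v; w].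
- by rewrite /= vw adj_sym vw.
- by rewrite /= inE (adj_neq vw).
- by [].
- by move=> z; rewrite !inE => /orP[]/eqP->; case/andP: (adj_vset vw).
have [sD bD _] := blockP _ _ DG.
have DB : D = B.
  apply: maxB => //; apply/subgraphP; split=> [|u z]; last by rewrite noB.
  apply/subsetP => u uB; have /connectP[[|z p] /=] := conB v u vB uB.
    by move=> _ ->; apply: DV; rewrite mem_head.
  by rewrite noB.
by move: cD; rewrite DB /= noB.
Qed.

Section Split.
Variables (T : finType) (B : sgraph T) (x : T) (f : T -> bool).
Hypotheses (bicB : biconnected B) (evenB : even_cycles_short B).
Hypotheses (offB : coloured_off B x f) (nbB : ~ bipartite B).
Hypothesis meetB : odd_cycles_meet_again B x.

(** Splitting [x] into [Some x], which keeps the neighbours of colour [true],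
    and [None], which keeps the others, turns [B] into a bipartite graph. *)
Let merge (p : option T) : T := if p is Some u then u else x.
Let keeps (p q : option T) := (merge p == x) ==> (f (merge q) == (p == Some x)).
Let split_adj : rel (option T) := [rel p q | [&& adj B (merge p) (merge q), keeps p q & keeps q p]].
Let R := mkgraph (None |: [set Some u | u in vset B]) split_adj.
Let x1 := Some x.
Let x2 : option T := None.
Let colour (p : option T) := if p is Some u then (u != x) && f u else true.

Let xB : x \in vset B.
Proof.
apply: contraT => nx; case: nbB; apply/bipartiteP; exists f => u v uv.
have /andP[uB vB] := adj_vset uv.
by apply: offB => //; [apply: contraNneq nx => <-|apply: contraNneq nx => <-].
Qed.

Let memR p : (p \in vset R) = (merge p \in vset B).
Proof.
rewrite !inE; case: p => [u|] /=; last by rewrite xB.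
by rewrite mem_imset // => a b [].
Qed.

Let adjR p q : adj R p q = [&& adj B (merge p) (merge q), keeps p q & keeps q p].
Proof.
rewrite adj_mkgraph; last first.
  move=> a b; by rewrite /split_adj /= adj_sym [keeps a b && _]andbC.
change ([&& p \in vset R, q \in vset R, p != q & split_adj p q] = split_adj p q).
rewrite !memR.
apply/idP/idP => [/and4P[]//|/= h]; rewrite h andbT.
have /and3P[pq _ _] := h; have /andP[-> ->] := adj_vset pq => /=.
by apply: contraTneq pq => ->; rewrite adj_irr.
Qed.

Let adjR_some u v : u != x -> v != x -> adj R (Some u) (Some v) = adj B u v.
Proof. by move=> ux vx; rewrite adjR /keeps /= (negPf ux) (negPf vx) /= andbT. Qed.

Let adjR_x1 u : adj R (Some x) (Some u) = adj B x u && f u.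
Proof.
rewrite adjR /keeps /= !eqxx /=; case: (boolP (adj B x u)) => //= xu.
have /negPf ux : u != x by rewrite eq_sym (adj_neq xu).
by rewrite ux andbT; case: (f u).
Qed.

Let adjR_x2 u : adj R None (Some u) = adj B x u && ~~ f u.
Proof.
rewrite adjR /keeps /= !eqxx /=; case: (boolP (adj B x u)) => //= xu.
have /negPf ux : u != x by rewrite eq_sym (adj_neq xu).
by rewrite ux andbT; case: (f u).
Qed.

Let adjR_x12 : adj R x1 x2 = false.
Proof. by rewrite adjR /= adj_irr. Qed.

Let colourR : coloured R colour.
Proof.
have key p q : adj R p q -> merge p = x -> colour p != colour q.
  rewrite adjR => /and3P[uv + _] px; rewrite /keeps px eqxx /= => /eqP fq.
  rewrite px in uv; have qx := adj_neq uv; case: q qx fq {uv} => [v|]; rewrite /= ?eqxx //.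
  rewrite eq_sym => -> ->; case: p px => [u|] //= ->.
  by rewrite !eqxx.
move=> p q pq; case: (eqVneq (merge p) x) => [|px]; first exact: key.
case: (eqVneq (merge q) x) => [qx|qx]; first by rewrite eq_sym; apply: key => //; rewrite adj_sym.
case: p q pq px qx => [u|] [v|]; rewrite /= ?eqxx // => uv ux vx.
by rewrite ux vx /=; apply: offB; rewrite // -adjR_some.
Qed.

Let neighbour b : exists2 u, adj B x u & f u = b.
Proof.
case: (boolP [exists u, adj B x u && (f u == b)]) => [/existsP[u /andP[xu /eqP fu]]|/existsPn none].
  by exists u.
case: nbB; apply/bipartiteP; exists (fun u => if u == x then b else f u) => u v uv.
have nbr w : adj B x w -> b != f w.
  by move=> xw; have := none w; rewrite xw /= eq_sym.
case: (eqVneq u x) => [ux|ux]; case: (eqVneq v x) => [vx|vx].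
- by rewrite ux vx adj_irr in uv.
- by apply: nbr; rewrite -ux.
- by rewrite eq_sym; apply: nbr; rewrite -vx adj_sym.
exact: offB.
Qed.

(* two vertices other than the copies of [x] are connected even without them *)
Let core u v : u \in vset B -> v \in vset B -> u != x -> v != x ->
  forall c, merge c = x -> connect (adj (del_vertex R c)) (Some u) (Some v).
Proof.
move=> uB vB ux vx c cx; have [_ _ cut] := biconnectedP _ bicB.
apply: (connect_hom (h := Some)) (cut x u v uB vB ux vx) => a b.
rewrite !adj_del => /and3P[ab ax bx]; rewrite adjR_some // ab /=.
by apply/andP; split; [apply: contraNneq ax|apply: contraNneq bx] => e; rewrite -cx -e.
Qed.

Let nbr1 : exists u, [/\ u \in vset B, u != x & adj R x1 (Some u)].
Proof.
have [u xu fu] := neighbour true; exists u; rewrite adjR_x1 xu fu eq_sym (adj_neq xu).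
by case/andP: (adj_vset xu).
Qed.

Let nbr2 : exists u, [/\ u \in vset B, u != x & adj R x2 (Some u)].
Proof.
have [u xu fu] := neighbour false; exists u; rewrite adjR_x2 xu fu eq_sym (adj_neq xu).
by case/andP: (adj_vset xu).
Qed.

Let two_copies a : merge a = x -> a = x1 \/ a = x2.
Proof. by case: a => [u|] /= => [->|]; [left|right]. Qed.

Let off_end c d : merge c = x -> merge d = x -> c != d ->
  (exists u, [/\ u \in vset B, u != x & adj R d (Some u)]) ->
  forall p q, p \in vset R -> q \in vset R -> p != c -> q != c ->
    connect (adj (del_vertex R c)) p q.
Proof.
move=> cx dx cd [u [uB ux du]] p q pR qR pc qc.
have hub r : r \in vset R -> r != c -> connect (adj (del_vertex R c)) (Some u) r.
  rewrite memR => rB rc; case: (eqVneq (merge r) x) => [rx|rx].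
    have -> : r = d.
      move: cd rc; case: (two_copies cx) (two_copies dx) (two_copies rx) => -> [] -> [] -> //;
        by rewrite eqxx.
    rewrite connect_adj_sym; apply: connect1; rewrite adj_del du eq_sym cd /=.
    by apply: contraNneq ux => e; rewrite -cx -e.
  by case: r rB rc rx => [v|] //= vB _ vx; [exact: core|rewrite eqxx in vx].
by apply: connect_trans (hub q qR qc); rewrite connect_adj_sym; exact: hub.
Qed.

Let connectedR : connected R.
Proof.
have [u [uB ux x1u]] := nbr1.
apply/connectedP; split; first by apply/set0Pn; exists x1; rewrite memR.
have hub r : r \in vset R -> connect (adj R) (Some u) r.
  move=> rR; case: (eqVneq r x1) => [->|rx1].
    by apply: connect1; rewrite adj_sym.
  apply: (@connect_subrel _ (adj (del_vertex R x1))); first by move=> a b; rewrite adj_del => /and3P[].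
  apply: (@off_end x1 x2 erefl erefl isT nbr2) => //.
    by rewrite memR.
by move=> p q pR qR; apply: connect_trans (hub q qR); rewrite connect_adj_sym; exact: hub.
Qed.

Let noncut1 : ~~ cut_vertex R x1.
Proof.
apply/negP => /(cut_vertexP _ connectedR)[_ [p [q [pR qR pc qc]]]]; case/negP.
exact: (@off_end x1 x2 erefl erefl isT nbr2).
Qed.

Let noncut2 : ~~ cut_vertex R x2.
Proof.
apply/negP => /(cut_vertexP _ connectedR)[_ [p [q [pR qR pc qc]]]]; case/negP.
exact: (@off_end x2 x1 erefl erefl isT nbr1).
Qed.

(** [x] is no cut vertex of [B - c], so that every vertex of [R - c] still
    reaches one of the two copies of [x]. *)
Let reachR c v : v \in vset R -> c != x1 -> c != x2 -> v != c ->
  connect (adj (del_vertex R c)) x1 v || connect (adj (del_vertex R c)) x2 v.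
Proof.
case: c => [c|] // vR cx1 _ vc; have cx : c != x by apply: contraNneq cx1 => ->.
rewrite ![connect _ _ v]connect_adj_sym.
case: v vR vc => [v|]; last by rewrite connect0 orbT.
rewrite memR /= => vB vc; have nvc : v != c by apply: contraNneq vc => ->.
have [_ _ cut] := biconnectedP _ bicB.
have xc : x != c by rewrite eq_sym.
have /connectP[p pth lp] := cut c v x vB xB nvc xc.
elim: p v pth lp {vB vc nvc} => [|w p IHp] v /=; first by move=> _ <-; rewrite connect0.
rewrite adj_del => /andP[/and3P[vw nvc nwc] pth] lp.
case: (eqVneq v x) => [->|vx]; first by rewrite connect0.
have off p' q' : adj R p' q' -> p' != Some c -> q' != Some c ->
    connect (adj (del_vertex R (Some c))) p' q'.
  by move=> pq pc qc; apply: connect1; rewrite adj_del pq pc qc.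
have vc : Some v != Some c by apply: contraNneq nvc => -[->].
case: (eqVneq w x) => [wx|wx].
  rewrite wx adj_sym in vw; case fv: (f v); apply/orP; [left|right]; apply: off => //.
    by rewrite adj_sym adjR_x1 vw fv.
  by rewrite adj_sym adjR_x2 vw fv.
have vwR : connect (adj (del_vertex R (Some c))) (Some v) (Some w).
  by apply: off => //; rewrite adjR_some.
by case/orP: (IHp w pth lp) => h; rewrite (connect_trans vwR h) ?orbT.
Qed.

Let merge_path p q : path (adj R) p q -> path (adj B) (merge p) (map merge q).
Proof. by rewrite path_map; apply: sub_path => a b; rewrite adjR => /and3P[]. Qed.

Let merge_inj (s : seq (option T)) e : merge e = x -> e \notin s -> {in s &, injective merge}.
Proof.
move=> ex es p q ps qs; have np : p != e by apply: contraNneq es => <-.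
have nq : q != e by apply: contraNneq es => <-.
move=> pq; case: (eqVneq (merge p) x) => px.
  have qx : merge q = x by rewrite -pq.
  by move: np nq; case: (two_copies ex) (two_copies px) (two_copies qx) => -> [] -> [] ->;
    rewrite ?eqxx.
by case: p q pq px {ps qs np nq} => [u|] [v|] //= => [->//|->|_]; rewrite eqxx.
Qed.

(** A cycle of [R] through both copies of [x] would be two odd cycles of [B]
    that meet in [x] only. *)
Let shortR : short_cycles R.
Proof.
move=> c cyc un; have ev := coloured_cycle_even colourR cyc.
have short_off e : merge e = x -> e \notin c -> size c <= 4.
  move=> ex ec; rewrite -(size_map merge); apply: evenB; rewrite ?size_map //.
    case: (c) cyc {un ev ec} => //= p q; rewrite -map_rcons; exact: merge_path.
  by rewrite map_inj_in_uniq //; exact: merge_inj ex ec.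
case: (boolP (x1 \in c)) => c1; last exact: short_off c1.
case: (boolP (x2 \in c)) => c2; last exact: short_off c2.
have [p [cp up sp mp]] := rot_to_cycle c1 cyc un.
move: c2; rewrite mp inE => /orP[//|/mem_split[p1 [p2 ep]]]; rewrite {}ep in cp up {sp mp}.
have /uniq_countP up' := up.
have [pth1 pth2] : path (adj R) x1 (rcons p1 x2) /\ path (adj R) x2 (rcons p2 x1).
  by move: cp; rewrite /= rcons_cat /= -cat_rcons cat_path last_rcons => /andP[].
have arc a b q : merge a = x -> merge b = x -> colour a != colour b -> path (adj R) a (rcons q b) ->
    uniq q -> a \notin q -> b \notin q -> [/\ cycle (adj B) (x :: map merge q),
      uniq (x :: map merge q), odd (size (map merge q)).+1 & forall z, z \in q -> z = Some (merge z)].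
  move=> ax bx ab pth uq aq bq.
  have zE z : z \in q -> merge z != x /\ z = Some (merge z).
    move=> zq; have za : z != a by apply: contraNneq aq => <-.
    have zb : z != b by apply: contraNneq bq => <-.
    suff zx : merge z != x by split=> //; case: z zx {zq za zb} => [?|] //=; rewrite eqxx.
    apply/eqP => zx; move: ab za zb.
    by case: (two_copies ax) (two_copies bx) (two_copies zx) => -> [] -> [] ->; rewrite ?eqxx.
  split.
  - by have := merge_path pth; rewrite map_rcons ax bx.
  - rewrite cons_uniq map_inj_in_uniq ?uq ?andbT; last exact: merge_inj ax aq.
    by apply/negP => /mapP[z /zE[zx _] e]; rewrite -e eqxx in zx.
  - have := colour_walk (f := colour) (fun u v _ _ => @colourR u v) pth.
    rewrite last_rcons size_rcons size_map /=; move: ab.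
    by case: (colour a); case: (colour b); case: odd.
  by move=> z /zE[].
have x12 : colour x1 != colour x2 by rewrite /= eqxx.
have u1 : uniq p1 by count_uniq up'.
have u2 : uniq p2 by count_uniq up'.
have u3 : uniq (x1 :: p1) by count_uniq up'.
have u4 : uniq (x2 :: p1) by count_uniq up'.
have u5 : uniq (x1 :: p2) by count_uniq up'.
have u6 : uniq (x2 :: p2) by count_uniq up'.
have u7 : uniq (p1 ++ p2) by count_uniq up'.
have n1 : x1 \notin p1 by case/andP: u3. 
have n2 : x2 \notin p1 by case/andP: u4.
have n3 : x1 \notin p2 by case/andP: u5.
have n4 : x2 \notin p2 by case/andP: u6.
have [cy1 un1 od1 e1] := arc x1 x2 p1 erefl erefl x12 pth1 u1 n1 n2.
have x21 : colour x2 != colour x1 by rewrite eq_sym.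
have [cy2 un2 od2 e2] := arc x2 x1 p2 erefl erefl x21 pth2 u2 n4 n3.
have /hasP[w /mapP[a a2 wa] /= /mapP[b b1 wb]] := meetB cy1 un1 od1 cy2 un2 od2.
have ab : a = b by rewrite (e2 a a2) (e1 b b1) -wa -wb.
move: u7; rewrite cat_uniq => /and3P[_ /hasPn/(_ a a2) /=]; by rewrite ab b1.
Qed.

(** If [R] had no cut vertex, the two copies of [x], being of opposite colours,
    would be adjacent. *)
Lemma split_necklace : is_necklace_K2 B.
Proof.
have [c cc] : exists c, cut_vertex R c.
  apply/existsP; apply: contraT => /existsPn nc.
  have bicR : biconnected R by rewrite /biconnected connectedR; exact/forallP.
  have := opposite_adj bicR colourR shortR (x := x1) (y := x2).
  by rewrite adjR_x12 !memR /= eqxx => /(_ xB xB isT).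
have x1R : x1 \in vset R by rewrite memR.
have x2R : x2 \in vset R by rewrite memR.
have [B1 [Bs [Bk [chain x1B x2B]]]] := block_chain_exists connectedR x1R x2R noncut1 noncut2 reachR cc.
exists (option T), R, B1, Bk, Bs, x1, x2; split.
- by split=> //; apply/bipartiteP; exists colour.
- move=> D DR; have [sD bD _] := blockP _ _ DR; have [_ aD] := subgraphP _ _ sD.
  have [u [_ _ x1u]] := nbr1; have [v [w vw]] := block_edge connectedR x1u DR.
  have colD : coloured D colour by move=> a b /aD; exact: colourR.
  have shD : short_cycles D by move=> d cyd; apply: shortR; exact: sub_cycle cyd.
  by case: (bipartite_block_shape bD colD shD vw); auto.
- by [].
- split; first by rewrite adjR_x12.
  have [_ con] := connectedP _ connectedR.
  pose P n := [exists q : n.-tuple (option T), path (adj R) x1 q && (last x1 q == x2)].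
  have Pq q : path (adj R) x1 q -> last x1 q = x2 -> P (size q).
    by move=> h1 h2; apply/existsP; exists (in_tuple q); rewrite h1 h2 eqxx.
  have exP : exists n, P n.
    by have /connectP[q pq lq] := con _ _ x1R x2R; exists (size q); exact: Pq.
  case: (ex_minnP exP) => n /existsP[q /andP[pq /eqP lq]] minn; exists n.
    split; first by exists q; rewrite size_tuple.
    by move=> q' p' l'; apply: minn; exact: Pq.
  have := colour_walk (f := colour) (fun u v _ _ => @colourR u v) pq.
  by rewrite lq size_tuple /= eqxx addbF => <-.
pose mg (z : option (option T)) := if z is Some p then merge p else x.
have mgI z : z \in vset (identify R x1 x2) -> mg z \in vset B.
  rewrite in_setU1 => /orP[/eqP->//|/imsetP[q qR ->]].
  by move: qR; rewrite in_setD => /andP[_]; rewrite memR.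
pose unmg y := if y == x then None else Some (Some y).
have IP z : z \in vset (identify R x1 x2) -> z = None \/ exists2 u, u != x & z = Some (Some u).
  rewrite in_setU1 => /orP[/eqP->|/imsetP[q qR ->]]; first by left.
  move: qR; rewrite in_setD in_set2 negb_or => /andP[/andP[q1 q2] _]; right.
  case: q q1 q2 => [u|] // q1 _; exists u => //.
have unmgI y : y \in vset B -> unmg y \in vset (identify R x1 x2).
  move=> yB; rewrite /unmg; case: (eqVneq y x) => [_|yx]; first by rewrite in_setU1 eqxx.
  by rewrite in_setU1 /=; apply: imset_f; rewrite in_setD in_set2 memR yB andbT negb_or yx.
pose F (z : {z | z \in vset (identify R x1 x2)}) : {y | y \in vset B} := Sub (mg (val z)) (mgI _ (valP z)).
pose F' (y : {y | y \in vset B}) : {z | z \in vset (identify R x1 x2)} := Sub (unmg (val y)) (unmgI _ (valP y)).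
exists F; split.
  exists F' => [z|y]; apply: val_inj => /=; last first.
    by rewrite /unmg; case: eqVneq => [->|].
  by case: (IP _ (valP z)) => [->|[u ux ->]] /=; rewrite /unmg ?eqxx //= (negPf ux).
have nx1 u : u != x -> Some u != x1 by move=> ux; apply: contraNneq ux => -[->].
have idN u : u != x -> adj (identify R x1 x2) None (Some (Some u)) = adj B x u.
  move=> ux; rewrite adj_identifyN memR !(adj_sym R (Some u)) adjR_x1 adjR_x2 nx1 //=.
  rewrite -andb_orr orbN andbT; case: (boolP (adj B x u)) => [xu|]; last by rewrite andbF.
  by have /andP[_ ->] := adj_vset xu.
move=> z z' /=; case: (IP _ (valP z)) => [->|[u ux ->]]; case: (IP _ (valP z')) => [->|[v vx ->]] /=.
- by rewrite adj_identifyNN adj_irr.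
- exact: idN.
- by rewrite adj_sym [RHS]adj_sym idN.
by rewrite adj_identifyS adjR_some // (nx1 u ux) (nx1 v vx) andbT.
Qed.

End Split.

(** Two blocks with odd cycles share two vertices, so they coincide. *)
Lemma structure_of_cycles (T : finType) (G : sgraph T) :
  connected G -> ~ bipartite G -> even_cycles_short G ->
  (forall a b c d, ~~ [&& adj G a b, adj G a c, adj G a d, adj G b c, adj G b d & adj G c d]) ->
  (forall c d, cycle (adj G) c -> uniq c -> odd (size c) ->
     cycle (adj G) d -> uniq d -> odd (size d) ->
     exists x y, [/\ x != y, x \in c, x \in d, y \in c & y \in d]) ->
  exists B, [/\ B \in blocks G /\ ~ bipartite B, is_necklace_K2 B,
     (forall B', B' \in blocks G -> B' <> B -> bipartite B') &
     (forall B', B' \in blocks G -> bipartite B' -> (exists l, is_K2 l B') \/ single_edge B')].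
Proof.
move=> conG nbG evG noK4 share2.
have [c [cyc un] od] := nonbipartite_odd_cycle nbG.
have [x [f off]] := odd_cycles_hit (@adj_sym _ G) (@adj_irr _ G) evG noK4 share2 cyc un od.
have odd_nil (d : seq T) : odd (size d) -> d != [::] by case: d.
have [|B BG [cB _]] := cycle_in_block cyc un (odd_nil c od); first by move=> z; exact: cycle_vset.
have [sB bB _] := blockP _ _ BG; have [_ aB] := subgraphP _ _ sB.
have nbB : ~ bipartite B.
  by move/bipartiteP => [g colg]; have := coloured_cycle_even colg cB; rewrite od.
have [a [b ab]] : exists a b, adj G a b.
  case: (c) cyc od => [|a [|b d]] //=; first by rewrite adj_irr.
  by case/andP => ab _ _; exists a, b.
exists B; split=> //.
- apply: (split_necklace (x := x) (f := f)) => //.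
  + by move=> d cd; apply: evG; exact: sub_cycle cd.
  + by move=> u v ux vx /aB; exact: off.
  move=> p q cp up op cq uq oq.
  have cp' : cycle (adj G) (x :: p) by exact: sub_cycle cp.
  have cq' : cycle (adj G) (x :: q) by exact: sub_cycle cq.
  have [u [v [uv up' uq' vp' vq']]] := share2 _ _ cp' up op cq' uq oq.
  have [w [wx wp wq]] : exists w, [/\ w != x, w \in x :: p & w \in x :: q].
    by case: (eqVneq u x) => [e|ux]; [exists v; split; rewrite // -e eq_sym|exists u].
  by apply/hasP; exists w; move: wp wq; rewrite !inE (negPf wx).
- move=> B' B'G B'B; apply: NNPP => nb'.
  have [d [cd ud] odd_d] := nonbipartite_odd_cycle nb'.
  have [s' _ _] := blockP _ _ B'G; have [_ a'] := subgraphP _ _ s'.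
  have cd' : cycle (adj G) d by exact: sub_cycle cd.
  have [u [v [uv uc ud' vc vd]]] := share2 _ _ cyc un od cd' ud odd_d.
  by apply: B'B; apply: (eq_block B'G BG uv); apply: cycle_vset; eassumption.
move=> D DG /bipartiteP[g colD]; have [sD bD _] := blockP _ _ DG; have [_ aD] := subgraphP _ _ sD.
have [u [v uv]] := block_edge conG ab DG.
have shD : short_cycles D.
  by move=> d cd ud; apply: evG (coloured_cycle_even colD cd) => //; exact: sub_cycle cd.
by case: (bipartite_block_shape bD colD shD uv); auto.
Qed.

Theorem theorem1p2 (K : fieldType) (T : finType) (G : sgraph T)
    (connG : connected G) (nbipG : ~ bipartite G) :
  (robust (toric_ideal K G) /\ generated_by_quadrics (toric_ideal K G)) <->
  (exists B : sgraph T,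
     [/\ B \in blocks G /\ ~ bipartite B,
         (exists l e, is_K2_plus l B e) \/
         (exists r s, is_double_K2 r s B) \/
         is_necklace_K2 B,
         (forall B', B' \in blocks G -> B' <> B -> bipartite B') &
         (forall B', B' \in blocks G -> bipartite B' ->
            (exists l, is_K2 l B') \/ single_edge B')]).
Proof.
split=> [[robI quadI]|[B [[BG _] families bip shape]]].
  have square := robust_kernel_square robI quadI.
  have [_ conV] := connectedP _ connG.
  have [||c d cyc un od cyd ud odd_d|B [BG nk bip shape]] := @structure_of_cycles T G connG nbipG.
  - exact: (even_cycle_size4 (@adj_sym T G) (@adj_irr T G) square).
  - exact: robust_no_K4 robI quadI.
  - apply: (odd_cycles_share2 (@adj_sym T G) (@adj_irr T G) square) => //.
    by move=> x y xc yd; apply: conV; [exact: cycle_vset cyc xc|exact: cycle_vset cyd yd].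
  by exists B; split; auto.
have [a [f [aB cond]]] : exists a f, a \in vset B /\ cycle_condition B a f.
  case: families => [[l [E]]|[[r [s]]|]].
  - exact: K2_plus_condition.
  - exact: double_K2_condition.
  exact: necklace_condition.
have [f' [evG offG meetG]] := cycle_condition_block cond BG bip shape.
exact: (toric_robust_quadratic K evG offG meetG).
Qed.
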